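(* Let $\alpha,d\in\mathbb{N}$ and $f\in H^\alpha_\rho(\mathbb{R}^d)$, and define $g(\boldsymbol{t})=f(\boldsymbol{\Psi}_{\cot}(\boldsymbol{t}))\,\rho(\boldsymbol{\Psi}_{\cot}(\boldsymbol{t}))\prod_{k=1}^d\phi'(t_k)$ for $\boldsymbol{t}\in(0,1)^d$. Then: (i) For all multi-indices $\mathbf{r}\in\{0,1,\dots,\alpha\}^d$, $$\|D^{\mathbf{r}}g\|_{L^2([0,1]^d)}\le C_{d,\alpha}\|f\|_{H^\alpha_\rho(\mathbb{R}^d)},$$ where $C_{d,\alpha}>0$ is a constant independent of $\mathbf{r}$ and $f$ but depending on $d$ and $\alpha$. (ii) For every $\ell=1,\dots,d$, every $\mathbf{r}\in\{0,\dots,\alpha\}^d$ with $r_\ell\le\alpha-1$, and almost every $(t_1,\dots,t_{\ell-1},t_{\ell+1},\dots,t_d)\in(0,1)^{d-1}$, $$\lim_{t_\ell\to0+}D^{\mathbf{r}}g(\boldsymbol{t})=\lim_{t_\ell\to1-}D^{\mathbf{r}}g(\boldsymbol{t})=0,$$ and as a consequence the map $t_\ell\mapsto D^{\mathbf{r}}g(\boldsymbol{t})$ extends continuously to $[0,1]$ by zero. (iii) Furthermore, for $\mathbf{r}\in\{0,\dots,\alpha-1\}^d$ and every $\ell=1,\dots,d$, the limits in (ii) hold for every $(t_1,\dots,t_{\ell-1},t_{\ell+1},\dots,t_d)\in(0,1)^{d-1}$.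
   Context: $\rho(\boldsymbol{x})=(2\pi)^{-d/2}e^{-|\boldsymbol{x}|_2^2/2}$ is the standard Gaussian density on $\mathbb{R}^d$. $H^\alpha_\rho(\mathbb{R}^d)$ consists of all $f$ whose weak derivatives $D^{\mathbf{r}}f$ lie in $L^2_\rho(\mathbb{R}^d)=L^2(\mathbb{R}^d,\rho\,d\boldsymbol{x})$ for all $\mathbf{r}\in\mathbb{N}_0^d$ with $|\mathbf{r}|_\infty\le\alpha$, with norm $\|f\|_{H^\alpha_\rho(\mathbb{R}^d)}=\big(\sum_{|\mathbf{r}|_\infty\le\alpha}\|D^{\mathbf{r}}f\|^2_{L^2_\rho(\mathbb{R}^d)}\big)^{1/2}$. The change of variables is $\phi(t)=-\cot(\pi t)$ for $t\in(0,1)$ and $\boldsymbol{\Psi}_{\cot}(\boldsymbol{t})=(\phi(t_1),\dots,\phi(t_d))$ for $\boldsymbol{t}\in(0,1)^d$. $D^{\mathbf{r}}g$ is the weak derivative of $g$ on $(0,1)^d$. In (ii) the pointwise statements refer to a representative of $D^{\mathbf{r}}g$ that is continuous in $t_\ell\in(0,1)$ for almost every value of the remaining variables, and in (iii) to the continuous representative of $D^{\mathbf{r}}g$ on $(0,1)^d$. *)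

(* Defs.v *)
From HB Require Import structures.
From mathcomp Require Import all_boot all_order all_algebra.
From mathcomp Require Import all_classical all_reals all_analysis.

Set Implicit Arguments.
Unset Strict Implicit.
Unset Printing Implicit Defensive.
Import Order.TTheory GRing.Theory Num.Theory.
Import numFieldNormedType.Exports.

Local Open Scope classical_set_scope.
Local Open Scope ring_scope.

Definition rV_display : measure_display -> measure_display.
Proof. exact. Qed.

(* 'rV[T]_n carries the product sigma-algebra, generated by the coordinates;
   for T = R these are the Borel sets of R^n. *)
Section measurable_rV.
Context {d} {T : measurableType d} (n : nat).

Let coors (i : 'I_n) (v : 'rV[T]_n) : T := v 0 i.

Let rV_set0 : g_sigma_preimage coors set0.
Proof. exact: sigma_algebra0. Qed.

Let rV_setC A : g_sigma_preimage coors A -> g_sigma_preimage coors (~` A).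
Proof. exact: sigma_algebraC. Qed.

Let rV_bigcup (F : _^nat) : (forall i, g_sigma_preimage coors (F i)) ->
  g_sigma_preimage coors (\bigcup_i (F i)).
Proof. exact: sigma_algebra_bigcup. Qed.

HB.instance Definition _ := @isMeasurable.Build (rV_display d)
  'rV[T]_n (g_sigma_preimage coors) rV_set0 rV_setC rV_bigcup.

End measurable_rV.

Lemma measurable_coord d (T : measurableType d) n (i : 'I_n) :
  measurable_fun [set: 'rV[T]_n] (fun v => v 0 i).
Proof.
move=> _ Y mY; rewrite setTI; apply: sub_sigma_algebra => /=.
rewrite -bigcup_seq/=; exists i => /=; first by rewrite mem_index_enum.
by exists Y => //; rewrite setTI.
Qed.

Lemma measurable_fun_rV d1 d2 (T1 : measurableType d1) (T2 : measurableType d2)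
    n (f : T1 -> 'rV[T2]_n) :
  (forall i, measurable_fun [set: T1] (fun x => f x 0 i)) ->
  measurable_fun [set: T1] f.
Proof.
move=> mf; pose G := \big[setU/set0]_(i < n) preimage_set_system setT
  (fun v : 'rV[T2]_n => v 0 i) measurable.
apply: (@measurability _ _ _ _ _ _ G) => // A [B GB <-].
move: GB; rewrite /G -bigcup_seq/= => -[i _ [Y mY <-]].
by rewrite !setTI; have := mf i measurableT Y mY; rewrite setTI.
Qed.

Section lebesgue_rV.
Context {R : realType}.

Definition rV_cons n (p : measurableTypeR R * 'rV[R]_n) : 'rV[R]_n.+1 :=
  row_mx (p.1%:M : 'M[R]_1) p.2.

Definition rV_uncons n (v : 'rV[R]_n.+1) : measurableTypeR R * 'rV[R]_n :=
  (v 0 0, \row_(i < n) v 0 (lift 0 i)).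

Lemma rV_consK n : cancel (@rV_cons n) (@rV_uncons n).
Proof.
move=> [x v]; rewrite /rV_uncons/rV_cons/=; congr (_, _).
  rewrite (_ : 0 = lshift n (0 : 'I_1)); last exact/val_inj.
  by rewrite (row_mxEl (x%:M : 'M[R]_1)) mxE eqxx.
apply/rowP => i; rewrite mxE (_ : lift 0 i = @rshift 1 n i); last exact/val_inj.
by rewrite (row_mxEr (x%:M : 'M[R]_1)).
Qed.

Lemma measurable_rV_cons n : measurable_fun setT (@rV_cons n).
Proof.
apply: measurable_fun_rV => i.
have [j ->|->] := unliftP 0 i.
  have -> : (fun p => @rV_cons n p 0 (lift 0 j)) =
            (fun v : 'rV[R]_n => v 0 j) \o snd.
    apply/funext => p /=.
    by have /(congr1 (fun v : 'rV_n => v 0 j)) := congr1 snd (rV_consK p);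
      rewrite mxE.
  by apply: measurableT_comp; [exact: measurable_coord|exact: measurable_snd].
have -> : (fun p => @rV_cons n p 0 0) = fst.
  by apply/funext => p; exact: (congr1 fst (rV_consK p)).
exact: measurable_fst.
Qed.

Lemma measurable_rV_uncons n : measurable_fun setT (@rV_uncons n).
Proof.
apply: measurable_fun_pair => /=; first exact: (measurable_coord ord0).
apply: measurable_fun_rV => i.
apply: (eq_measurable_fun (fun v : 'rV[R]_n.+1 => v 0 (lift 0 i))).
  by move=> v _; rewrite mxE.
exact: measurable_coord.
Qed.

Section lebesgueS.
Variables (n : nat) (mu : {sigma_finite_measure set 'rV[R]_n -> \bar R}).

Definition lebesgueS : set 'rV[R]_n.+1 -> \bar R :=
  pushforward (@lebesgue_measure R \x mu)%E (@rV_cons n).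

HB.instance Definition _ := Measure.copy lebesgueS
  (Measure.clone _ _ _ lebesgueS
     (measure_function_pushforward__canonical__measure_function_Measure
        (@lebesgue_measure R \x mu)%E (@measurable_rV_cons n))).

Let sigma_finite_lebesgueS : sigma_finite setT lebesgueS.
Proof.
have /sigma_finiteP[F [TF ndF Foo]] := sigma_finiteT (@lebesgue_measure R).
have /sigma_finiteP[G [TG ndG Goo]] := sigma_finiteT mu.
exists (fun k => @rV_uncons n @^-1` (F k `*` G k)).
  rewrite -preimage_bigcup; apply/esym; rewrite -subTset => v _ /=.
  have [i _ Fi] : (\bigcup_k F k) (rV_uncons v).1 by rewrite -TF.
  have [j _ Gj] : (\bigcup_k G k) (rV_uncons v).2 by rewrite -TG.
  exists (maxn i j) => //; split.
    by move: Fi; exact/subsetPset/ndF/leq_maxl.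
  by move: Gj; exact/subsetPset/ndG/leq_maxr.
move=> k; have [mF Fk] := Foo k; have [mG Gk] := Goo k; split.
  rewrite -[X in measurable X]setTI; apply: measurable_rV_uncons => //.
  exact: measurableX.
rewrite /lebesgueS /pushforward -comp_preimage.
rewrite (_ : _ \o _ = id); last by apply/funext => p; exact: rV_consK.
by rewrite preimage_id product_measure1E// lte_mul_pinfty// ge0_fin_numE.
Qed.

HB.instance Definition _ := Measure_isSigmaFinite.Build _ _ _ lebesgueS
  sigma_finite_lebesgueS.

End lebesgueS.

(* For n = 0 this is the unit mass on the one-point space; lebesgue_rV_box
   identifies the measure for every n. *)
Fixpoint lebesgue_rV n : {sigma_finite_measure set 'rV[R]_n -> \bar R} :=
  if n is n'.+1 then lebesgueS (lebesgue_rV n') else \d_(0 : 'rV[R]_0).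

Lemma lebesgue_rV_box n (A : 'I_n -> set (measurableTypeR R)) :
  (forall i, measurable (A i)) ->
  lebesgue_rV n [set v | forall i, A i (v 0 i)] =
  (\prod_(i < n) lebesgue_measure (A i))%E.
Proof.
elim: n A => [A _|n IH A mA].
  by rewrite big_ord0/= diracE mem_set// => -[].
rewrite big_ord_recl -(IH (fun i => A (lift 0 i)))//=.
rewrite /lebesgueS /pushforward -product_measure1E//; last first.
  rewrite [X in measurable X](_ : _ =
      \bigcap_(i in setT) ((fun v : 'rV[R]_n => v 0 i) @^-1` A (lift 0 i)));
      last first.
    apply/seteqP; split => v /= Av i => [_|]; first exact: Av.
    exact: (Av i I).
  apply: fin_bigcap_measurable; first exact: finite_finset.
  move=> i _; rewrite -[X in measurable X]setTI.
  by apply: measurable_coord => //; exact: mA.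
congr (product_measure1 _ _ _); apply/seteqP; split => -[x v] /=.
  move=> Av; have := rV_consK (x, v) => -[x0 v0]; split.
    by rewrite -x0; exact: Av.
  by move=> i; rewrite -v0 mxE; exact: Av.
move=> [Ax Av] i; have [j ->|->] := unliftP 0 i; have [x0 v0] := rV_consK (x, v).
  by have := Av j; rewrite -[in X in X -> _]v0 mxE.
by rewrite x0.
Qed.

End lebesgue_rV.
Arguments lebesgue_rV {R} n.

Section weak_derivatives.
Context {R : realType} {d : nat}.
Implicit Types (U D : set 'rV[R]_d) (r : 'I_d -> nat).
Implicit Types (f u v phi w : 'rV[R]_d -> R).

Definition partial (i : 'I_d) f : 'rV[R]_d -> R := 'D_(delta_mx 0 i) f.

Definition partialn r f : 'rV[R]_d -> R :=
  foldr (fun i => iter (r i) (partial i)) f (enum 'I_d).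

(* Differentiability of every iterated partial derivative is C^oo. *)
Definition smooth f := forall s : seq 'I_d, forall x : 'rV[R]_d,
  differentiable (foldr partial f s) x.

Definition test_function U phi :=
  let supp := closure [set x | phi x != 0] in
  [/\ smooth phi, compact supp & supp `<=` U].

Definition locally_integrable_rV U f :=
  [/\ measurable_fun U f, open U & forall K, K `<=` U -> compact K ->
    (\int[lebesgue_rV d]_(x in K) `|f x|%:E < +oo)%E].

Definition is_wderiv U r f v :=
  [/\ locally_integrable_rV U f, locally_integrable_rV U v &
    forall phi, test_function U phi ->
      \int[lebesgue_rV d]_(x in U) (f x * partialn r phi x) =
      (-1) ^+ (\sum_i r i)%N * \int[lebesgue_rV d]_(x in U) (v x * phi x)].

Definition weakly_derivable U r f := exists v, is_wderiv U r f v.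

(* The weak derivative is unique only almost everywhere on U: a version is
   chosen and extended by 0 outside of U. It is meaningful only when
   weakly_derivable U r f holds. *)
Definition wderiv U r f : 'rV[R]_d -> R := get (is_wderiv U r f) \_ U.

Definition L2norm D w u : \bar R :=
  ((\int[lebesgue_rV d]_(x in D) (`|u x| ^+ 2 * w x)%:E) `^ 2^-1)%E.

Definition gauss_density (x : 'rV[R]_d) : R :=
  (2 * pi) `^ (- (d%:R / 2)) * expR (- ((\sum_i x 0 i ^+ 2) / 2)).

Definition gauss_sobolev (alpha : nat) f :=
  forall r, (forall i, (r i <= alpha)%N) ->
    weakly_derivable setT r f /\
    (L2norm setT gauss_density (wderiv setT r f) < +oo)%E.

Definition gauss_sobolev_norm (alpha : nat) f : \bar R :=
  ((\sum_(r : {ffun 'I_d -> 'I_alpha.+1})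
     L2norm setT gauss_density (wderiv setT (fun i => r i : nat) f) ^+ 2)
   `^ 2^-1)%E.

End weak_derivatives.

Section cotangent_transform.
Context {R : realType} {d : nat}.

Definition phi_cot (t : R) : R := - (cos (pi * t) / sin (pi * t)).

Definition Psi_cot (t : 'rV[R]_d) : 'rV[R]_d := \row_i phi_cot (t 0 i).

(* Only the values on (0,1)^d are relevant. *)
Definition cot_transform (f : 'rV[R]_d -> R) (t : 'rV[R]_d) : R :=
  f (Psi_cot t) * gauss_density (Psi_cot t) *
  \prod_(k < d) derive1 phi_cot (t 0 k).

Definition open_cube : set 'rV[R]_d := [set t | forall i, 0 < t 0 i < 1].

Definition closed_cube : set 'rV[R]_d := [set t | forall i, 0 <= t 0 i <= 1].

(* The point with l-th coordinate x and remaining coordinates s. *)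
Definition insert_coord (l : 'I_d) (s : 'rV[R]_d.-1) (x : R) : 'rV[R]_d :=
  \row_j oapp (fun k => s 0 k) x (unlift l j).

End cotangent_transform.
Arguments open_cube {R} d.
Arguments closed_cube {R} d.

Section representatives.
Context {R : realType} {d : nat}.
Implicit Types v h : 'rV[R]_d -> R.

Definition line_continuous_repr (l : 'I_d) v h :=
  h = v %[ae lebesgue_rV d in open_cube d] /\
  \forall s \ae lebesgue_rV d.-1, open_cube d.-1 s ->
    {in `]0, 1[, continuous (fun x => h (insert_coord l s x))}.

Definition continuous_repr v h :=
  h = v %[ae lebesgue_rV d in open_cube d] /\ {in open_cube d, continuous h}.

End representatives.

(* Main.v *)
(** The derivatives of [g] are explicit: with [t = phi_cot^-1 (x)] one has [d/dt = pi (1 + x^2) d/dx],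
so [D^r g], seen on R^d, is a finite sum of terms [D^j f * rho * prod_k q_k(x_k)] with
polynomials [q_k]. Since [rho * q^2 * prod_k (1 + x_k^2)] is bounded, these terms are in L^2
of the cube with the bound (i). For the integration by parts on the cube one needs no
boundary terms, for an arbitrary smooth function [phi] on R^d that need not vanish near the
boundary of the cube: pulled back to R^d, [phi] is bounded, and the Gaussian factor
lets one remove a cut-off of [phi] at infinity.

Using this with smooth approximations of [phi(y) = prod_(k in A) (y_k - c_k)^+ *
prod_(k notin A) 1_(c_k < y_k)] gives, for a set [A] of coordinates along which one more
derivative is available, the integral of [D^r g] (extended by 0) over every orthant [c < x]. By
Tonelli it is also the integral over the orthant of [(-1)^|A|] times the iterated tail integral
of [D_A D^r g] in the variables of [A], hence both functions agree almost everywhere on R^d. The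
tail integral is continuous in the variables of [A] (in all variables if [A] is everything), it
vanishes for [x_l >= 1], and it vanishes for [x_l < 0] because [D^r g] does; by
continuity it tends to 0 at both ends. [A = {l}] yields (ii), [A = {1,...,d}] yields (iii). *)
Require Import Defs.
From HB Require Import structures.
From mathcomp Require Import all_boot all_order all_algebra.
From mathcomp Require Import all_classical all_reals all_analysis.
From mathcomp Require Import measurable_realfun zify ring lra.

Set Implicit Arguments.
Unset Strict Implicit.
Unset Printing Implicit Defensive.
Import Order.TTheory GRing.Theory Num.Theory.
Import numFieldNormedType.Exports.

Local Open Scope classical_set_scope.
Local Open Scope ring_scope.

(** * Smooth cut-offs *)

(** Smoothness means differentiability of all iterated partial derivatives, so [elem1] and [elem]
    are grammars closed under differentiation, and all cut-offs are built inside them from the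
    functions x^(-n) exp(-1/x). The weak derivatives of f are indexed by multi-indices, whereas g is
    differentiated along a word of directions; symmetry of mixed partial derivatives links the two.
    No closed Leibniz formula is used: a derivative of g is a list of formal terms that depends on
    the multi-index alone, which is why the constant in (i) does not depend on f.

    Orthants serve as test sets because they are stable under intersection, generate the Borel sets,
    and have smoothed indicators that are mixed derivatives of smooth functions. These functions do
    not vanish near the boundary of the cube, so integration by parts must hold without compact
    support. Orthants also reach beyond the cube: the extension of D^r g by 0 is identified on all
    of R^d, and this carries the boundary information. Any other representative is compared with the
    tail integral by continuity and the density of sets of full measure. *)

Section exponential_bump.
Context {R : realType}.
Implicit Types (n : nat) (x : R).

(** [ebump 0] is the standard smooth function that is flat at 0. The powers x^(-n) are included
    because the derivative of a member of the family is a combination of two other members. *)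
Definition ebump n x : R := if 0 < x then x^-1 ^+ n * expR (- x^-1) else 0.

Lemma ebump_le0 n x : x <= 0 -> ebump n x = 0.
Proof. by rewrite /ebump leNgt => /negbTE ->. Qed.

Lemma ebump_ge0 n x : 0 <= ebump n x.
Proof.
rewrite /ebump; case: ifPn => // x0.
by rewrite mulr_ge0 ?expR_ge0// exprn_ge0// invr_ge0 ltW.
Qed.

Lemma ebumpS n x : x != 0 -> ebump n.+1 x = x^-1 * ebump n x.
Proof. by rewrite /ebump; case: ifPn => _ _; rewrite ?mulr0// exprS mulrA. Qed.

(** The exponential of 1/x dominates its Taylor term of order n+1, which leaves one spare power of
    x. *)
Lemma ebump_le n x : ebump n x <= n.+1`!%:R * `|x|.
Proof.
rewrite /ebump; case: ifPn => [x0|_]; last exact: mulr_ge0.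
have y0 : 0 < x^-1 by rewrite invr_gt0.
rewrite gtr0_norm// expRN ler_pdivrMr ?expR_gt0//.
have H := expR_ge1Dxn n (ltW y0).
have f0 : (0 : R) < n.+1`!%:R by rewrite ltr0n fact_gt0.
have -> : x^-1 ^+ n = n.+1`!%:R * x * (x^-1 ^+ n.+1 / n.+1`!%:R).
  by rewrite exprS; field; rewrite !gt_eqF// ltr0n.
rewrite ler_pM2l ?mulr_gt0//; apply: le_trans H.
by rewrite lerDr.
Qed.

Lemma ebump0_le1 x : ebump 0 x <= 1.
Proof.
rewrite /ebump; case: ifPn => // x0.
by rewrite expr0 mul1r -expR0 ler_expR oppr_le0 invr_ge0 ltW.
Qed.

Lemma is_derive_ebump n x :
  is_derive x 1 (ebump n) (- n%:R * ebump n.+1 x + ebump n.+2 x).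
Proof.
have [x0|x0|->] := ltgtP x 0.
- rewrite !ebump_le0 ?ltW// mulr0 addr0.
  apply: (@near_eq_is_derive _ _ _ (cst 0)).
  by near=> y; rewrite ebump_le0//; apply: ltW; near: y; exact: lt_nbhsl.
- have xN0 : x != 0 by rewrite gt_eqF.
  have d1 : is_derive x 1 (fun y : R => y^-1) (- x^-1 ^+ 2).
    apply: DeriveDef; first exact: derivableV.
    by rewrite deriveV// derive_id scaleNr/= [_%:A]mulr1 exprVn.
  pose F : R -> R := ((fun y : R => y^-1) ^+ n) * (expR \o (fun y : R => - y^-1)).
  have FE y : F y = y^-1 ^+ n * expR (- y^-1).
    by rewrite /F [LHS]/= exprfctE.
  apply: (@near_eq_is_derive _ _ _ F).
    by near=> y; rewrite FE /ebump ifT//; near: y; exact: lt_nbhsr.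
  have d2 : is_derive x 1 (expR \o (fun y : R => - y^-1)) (expR (- x^-1) * x^-1 ^+ 2).
    have := @is_derive1_comp _ expR (fun y : R => - y^-1) x _ _
     (is_derive_expR (- x^-1)) (is_deriveN d1).
    by rewrite opprK.
  apply: is_derive_eq (is_deriveM (is_deriveX n d1) d2) _.
  rewrite /ebump x0 /= /GRing.scale/= exprfctE.
  set e := expR _; set y := x^-1; move: e y => e y.
  clear; case: n => [|n]; rewrite ?mul0r ?oppr0 ?mul0r /= !exprS; ring.
- rewrite !ebump_le0// mulr0 addr0.
  have H : h^-1 *: (ebump n (h + 0) - ebump n 0) @[h --> 0^'] --> (0 : R).
    apply/cvgrPdist_lt => e e0.
    have f0 : (0 : R) < n.+2`!%:R by rewrite ltr0n fact_gt0.
    near=> h.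
    have h0 : h != 0 by near: h; exact: nbhs_dnbhs_neq.
    rewrite sub0r normrN addr0 (ebump_le0 _ (lexx 0)) subr0.
    (* The difference quotient at 0 is the next member [ebump n.+1 h] of the family, hence of size
       at most a constant times |h|. *)
    rewrite -[_ *: _]ebumpS// ger0_norm ?ebump_ge0//.
    apply: (le_lt_trans (ebump_le _ _)).
    rewrite mulrC -ltr_pdivlMr//.
    by near: h; apply: dnbhs0_lt; rewrite divr_gt0.
  have HE : (fun h : R => h^-1 *: (ebump n (h + 0) - ebump n 0)) =
    (fun h : R => h^-1 *: ((ebump n \o shift 0) (h *: 1) - ebump n 0)).
    by apply/funext => h /=; rewrite [_%:A]mulr1.
  rewrite HE in H.
  by apply: DeriveDef; [apply/cvg_ex; exists 0|exact: cvg_lim].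
Unshelve. all: by end_near. Qed.

(* The derivative of [fun x => x * ebump 0 x]. *)
Definition ebump_ramp' x : R := ebump 0 x + ebump 1 x.

Lemma ebump_ramp'_ge0 x : 0 <= ebump_ramp' x.
Proof. by rewrite addr_ge0// ebump_ge0. Qed.

(** This is (1 + z) exp(-z) <= 1 at z = 1/x. The bound survives rescaling of the argument, so it can
    serve for dominated convergence. *)
Lemma ebump_ramp'_le1 x : ebump_ramp' x <= 1.
Proof.
rewrite /ebump_ramp'; have [x0|x0] := leP x 0.
  by rewrite !ebump_le0// addr0.
rewrite /ebump x0 expr0 mul1r expr1 -[X in X + _]mul1r -mulrDl.
by rewrite expRN ler_pdivrMr ?expR_gt0// mul1r expR_ge1Dx.
Qed.

Lemma cvg_ebump n (z : nat -> R) : z m @[m --> \oo] --> +oo ->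
  ebump n (z m) @[m --> \oo] --> ((n == 0%N)%:R : R).
Proof.
move=> zoo.
have cV : (z m)^-1 @[m --> \oo] --> (0 : R).
  apply/cvgrPdist_lt => e e0; near=> m.
  have z0 : 0 < z m by near: m; move/cvgryPgt : zoo; exact.
  rewrite sub0r normrN gtr0_norm ?invr_gt0// -[ltRHS]invrK ltf_pV2 ?posrE ?invr_gt0//.
  by near: m; move/cvgryPgt : zoo; exact.
have cE : (z m)^-1 ^+ n * expR (- (z m)^-1) @[m --> \oo] -->
    (0 : R) ^+ n * expR (- 0).
  apply: cvgM; first exact: (cvg_comp _ _ cV (@exprn_continuous _ n 0)).
  exact: (cvg_comp _ _ (cvgN cV) (@continuous_expR R _)).
rewrite oppr0 expR0 mulr1 expr0n in cE.
apply: cvg_trans cE; apply: near_eq_cvg; near=> m.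
by rewrite /ebump ifT//; near: m; move/cvgryPgt : zoo; exact.
Unshelve. all: by end_near. Qed.

Lemma cvg_natM (x : R) : 0 < x -> m%:R * x @[m --> \oo] --> +oo.
Proof.
move=> x0; apply/cvgryPge => A; near=> m.
by rewrite -ler_pdivrMr//; near: m; exact: nbhs_infty_ger.
Unshelve. all: by end_near. Qed.

Lemma cvg_addn (x : R) : x + m%:R @[m --> \oo] --> +oo.
Proof.
apply/cvgryPge => A; near=> m.
by rewrite -lerBlDl; near: m; exact: nbhs_infty_ger.
Unshelve. all: by end_near. Qed.

End exponential_bump.

(** * Elementary smooth functions on R and R^d *)

Section smooth_functions_on_R.
Context {R : realType}.
Implicit Types (x : R) (h : R -> R).

(** The inverse of [phi_cot] on (0,1), since -cot(pi t) = tan(pi t - pi/2). *)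
Definition psi_cot x : R := 2^-1 + atan x / pi.

(** The derivative of [psi_cot], which is the density of the Cauchy distribution. *)
Definition jac x : R := (pi * (1 + x ^+ 2))^-1.

Lemma sqrD1_gt0 x : 0 < 1 + x ^+ 2.
Proof. by rewrite ltr_pwDl// sqr_ge0. Qed.

Lemma jac_gt0 x : 0 < jac x.
Proof. by rewrite invr_gt0 mulr_gt0 ?pi_gt0 ?sqrD1_gt0. Qed.

Lemma is_derive_psi_cot x : is_derive x 1 psi_cot (jac x).
Proof.
have -> : psi_cot = cst 2^-1 + pi^-1 *: (@atan R).
  by apply/funext => y; rewrite /psi_cot mulrC.
have da : is_derive x 1 (@atan R) (1 + x ^+ 2)^-1.
  by apply: DeriveDef; [exact: derivable_atan|rewrite -derive1E derive1_atan].
apply: is_derive_eq (is_deriveD (is_derive_cst _ _ _) (is_deriveZ _ da)) _.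
by rewrite add0r /jac invfM.
Qed.

Lemma is_derive_jac x : is_derive x 1 jac (- (2 * pi * x * jac x ^+ 2)).
Proof.
pose q : R -> R := pi *: (cst 1 + (id : R -> R) ^+ 2).
have qE : jac = (fun y => (q y)^-1) by apply/funext => y; rewrite /jac /q /= exprfctE.
have q0 : q x != 0.
  by rewrite /q [X in X != _]/= exprfctE gt_eqF ?mulr_gt0 ?pi_gt0 ?sqrD1_gt0.
have dq : is_derive x 1 q (pi * (2 * x)).
  apply: is_derive_eq (is_deriveZ _ (is_deriveD (is_derive_cst _ _ _)
    (is_deriveX 2 (is_derive_id _ _)))) _.
  by rewrite /GRing.scale/= expr1 add0r mulr1.
rewrite qE; apply: DeriveDef; first exact: derivableV.
rewrite deriveV//; have [_ ->] := dq; rewrite /GRing.scale/= exprVn; ring.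
Qed.

(** The generators are chosen so that the derivative of each is again in the class; one
    differentiation step then gives smoothness of every order. The affine argument in [Elem1_ebump]
    allows shifted, reflected and rescaled cut-offs. *)
Inductive elem1 : (R -> R) -> Prop :=
| Elem1_cst c : elem1 (fun=> c)
| Elem1_id : elem1 id
| Elem1_jac : elem1 jac
| Elem1_gauss : elem1 (fun x => expR (- (x ^+ 2 / 2)))
| Elem1_ebump n a b : elem1 (fun x => ebump n (a * x + b))
| Elem1_add f g : elem1 f -> elem1 g -> elem1 (fun x => f x + g x)
| Elem1_mul f g : elem1 f -> elem1 g -> elem1 (fun x => f x * g x).

Lemma is_derive_gauss1 x :
  is_derive x 1 (fun x : R => expR (- (x ^+ 2 / 2))) (- x * expR (- (x ^+ 2 / 2))).
Proof.
pose q : R -> R := - (2^-1 *: (id : R -> R) ^+ 2).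
have qE y : q y = - (y ^+ 2 / 2) by rewrite /q [LHS]/= exprfctE mulrC.
have dq : is_derive x 1 q (- x).
  apply: is_derive_eq (is_deriveN (is_deriveZ _ (is_deriveX 2 (is_derive_id _ _)))) _.
  by rewrite /GRing.scale/= expr1 mulr1 mulrA mulVf ?mul1r.
rewrite (_ : (fun _ => _) = expR \o q); last first.
  by apply/funext => y; rewrite /= qE.
by have := @is_derive1_comp _ expR q x _ _ (is_derive_expR _) dq; rewrite qE mulrC.
Qed.

Lemma is_derive_ebump_affine n a b x : is_derive x 1 (fun x => ebump n (a * x + b))
   (a * (- n%:R * ebump n.+1 (a * x + b) + ebump n.+2 (a * x + b))).
Proof.
pose q : R -> R := a *: (id : R -> R) + cst b.
have dq : is_derive x 1 q a.
  apply: is_derive_eq (is_deriveD (is_deriveZ _ (is_derive_id _ _)) (is_derive_cst _ _ _)) _.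
  by rewrite /GRing.scale/= mulr1 addr0.
have := @is_derive1_comp _ (ebump n) q x _ _ (is_derive_ebump n (q x)) dq.
by rewrite mulrC.
Qed.

Lemma elem1_derive1 h : elem1 h -> (forall x, derivable h x 1) /\ elem1 (derive1 h).
Proof.
have H f g : (forall x, is_derive x 1 f (g x)) -> elem1 g ->
    (forall x, derivable f x 1) /\ elem1 (derive1 f).
  move=> fg eg; split=> [x|]; first by have [] := fg x.
  rewrite (_ : derive1 f = g)//; apply/funext => x; rewrite derive1E.
  by have [] := fg x.
elim=> {h} [c||| |n a b|f g _ [df ef] _ [dg eg]|f g ef0 [df ef] eg0 [dg eg]].
- exact/(H _ (fun=> 0))/Elem1_cst.
- exact/(H _ (fun=> 1))/Elem1_cst.
- apply: (H _ _ is_derive_jac).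
  have -> : (fun x => - (2 * pi * x * jac x ^+ 2)) =
     (fun x => (- (2 * pi)) * (x * (jac x * jac x))).
    by apply/funext => x; rewrite expr2; ring.
  apply: Elem1_mul; first exact: Elem1_cst.
  apply: Elem1_mul; first exact: Elem1_id.
  by apply: Elem1_mul; exact: Elem1_jac.
- apply: (H _ _ is_derive_gauss1).
  apply: (@Elem1_mul -%R); last exact: Elem1_gauss.
  have -> : -%R = (fun x : R => (-1) * x) by apply/funext => x; rewrite mulN1r.
  by apply: Elem1_mul; [exact: Elem1_cst|exact: Elem1_id].
- apply: (H _ _ (is_derive_ebump_affine n a b)).
  apply: Elem1_mul; first exact: Elem1_cst.
  apply: Elem1_add; last exact: Elem1_ebump.
  by apply: Elem1_mul; [exact: Elem1_cst|exact: Elem1_ebump].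
- apply: (H _ (fun x => derive1 f x + derive1 g x)); last exact: Elem1_add.
  move=> x; have := is_deriveD (derivableP (df x)) (derivableP (dg x)).
  by rewrite -!derive1E.
- apply: (H _ (fun x => f x * derive1 g x + g x * derive1 f x)).
    move=> x; have := is_deriveM (derivableP (df x)) (derivableP (dg x)).
    by rewrite -!derive1E.
  by apply: Elem1_add; exact: Elem1_mul.
Qed.

Lemma elem1_derivable h x : elem1 h -> derivable h x 1.
Proof. by move=> /elem1_derive1[]. Qed.

Lemma elem1_continuous h : elem1 h -> continuous h.
Proof.
move=> eh x; apply/differentiable_continuous/derivable1_diffP.
exact: elem1_derivable.
Qed.

Lemma elem1_horner (p : {poly R}) : elem1 (horner p).
Proof.
elim/poly_ind: p => [|p c IH].
  by rewrite (_ : horner 0 = fun=> 0); [exact: Elem1_cst|apply/funext => x; rewrite horner0].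
rewrite (_ : horner _ = fun x => p.[x] * x + c); last first.
  by apply/funext => x; rewrite hornerMXaddC.
apply: (@Elem1_add (fun x => p.[x] * x)); last exact: Elem1_cst.
by apply: Elem1_mul => //; exact: Elem1_id.
Qed.

End smooth_functions_on_R.

Section smooth_functions.
Context {R : realType} {d : nat}.
Local Notation V := 'rV[R]_d.
Implicit Types (x : V) (f g : V -> R) (l k : 'I_d).

Definition Psi_inv x : V := \row_i psi_cot (x 0 i).

Definition prodf (h : 'I_d -> R -> R) x : R := \prod_k h k (x 0 k).

Lemma partial_line l f x :
  partial l f x = 'D_1 (fun t : R => f (t *: delta_mx 0 l + x)) 0.
Proof.
rewrite /partial /derive; set g1 := fun h => h^-1 *: _; set g2 := fun h => h^-1 *: _.
suff -> : g1 = g2 by [].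
by apply/funext => t; rewrite /g1 /g2/= addr0 scale0r add0r [_%:A]mulr1.
Qed.

Lemma partialD l f g x : differentiable f x -> differentiable g x ->
  partial l (fun y => f y + g y) x = partial l f x + partial l g x.
Proof. by move=> df dg; apply: deriveD; exact: diff_derivable. Qed.

Lemma partialM l f g x : differentiable f x -> differentiable g x ->
  partial l (fun y => f y * g y) x = f x * partial l g x + g x * partial l f x.
Proof. by move=> df dg; apply: deriveM; exact: diff_derivable. Qed.

Lemma differentiable_coordf k (h : R -> R) x : derivable h (x 0 k) 1 ->
  differentiable (fun y : V => h (y 0 k)) x.
Proof.
move=> dh; apply: (@differentiable_comp _ _ _ _ (fun y : V => y 0 k) h).
  exact: differentiable_coord.
exact/derivable1_diffP.
Qed.

Lemma differentiable_prod (I : Type) (r : seq I) (F : I -> V -> R) x :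
  (forall i, differentiable (F i) x) ->
  differentiable (fun y => \prod_(i <- r) F i y) x.
Proof.
move=> dF; elim: r => [|i r IH].
  by under eq_fun do rewrite big_nil; exact: differentiable_cst.
by under eq_fun do rewrite big_cons; exact: differentiableM.
Qed.

Lemma differentiable_prodf (h : 'I_d -> R -> R) x :
  (forall k, derivable (h k) (x 0 k) 1) -> differentiable (prodf h) x.
Proof. by move=> dh; apply: differentiable_prod => k; exact: differentiable_coordf. Qed.

Lemma line_coordE l k (t : R) x :
  (t *: delta_mx 0 l + x) 0 k = if k == l then t + x 0 k else x 0 k.
Proof. by rewrite !mxE/=; case: eqVneq => _; rewrite ?mulr1// mulr0 add0r. Qed.

Lemma derive_line (h : R -> R) a : 'D_1 (fun t : R => h (t + a)) 0 = derive1 h a.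
Proof.
rewrite derive1E /derive; set g1 := fun h => h^-1 *: _; set g2 := fun h => h^-1 *: _.
suff -> : g1 = g2 by [].
by apply/funext => t; rewrite /g1 /g2/= addr0 add0r.
Qed.

Lemma partial_prodf l (h : 'I_d -> R -> R) x : derivable (h l) (x 0 l) 1 ->
  partial l (prodf h) x = prodf (fun k => if k == l then derive1 (h k) else h k) x.
Proof.
move=> dh; rewrite partial_line /prodf [RHS](bigD1 l)//= eqxx.
rewrite (_ : (fun _ => _) = (\prod_(k | k != l) h k (x 0 k)) *:
  (fun t => h l (t + x 0 l))); last first.
  apply/funext => t /=; rewrite (bigD1 l)//= line_coordE eqxx mulrC; congr (_ * _).
  by apply: eq_bigr => k kl; rewrite line_coordE (negbTE kl).
rewrite deriveZ/=.
  rewrite derive_line [_ *: _]mulrC; congr (_ * _).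
  by apply: eq_bigr => k /negbTE ->.
apply/derivable1P.
rewrite (_ : (fun _ => _) = (fun t => h l (t + x 0 l))); last first.
  by apply/funext => t /=; rewrite addr0 [_%:A]mulr1.
apply/derivable1_diffP; apply: (@differentiable_comp _ _ _ _ (fun t => t + x 0 l)).
  exact: differentiableD.
by rewrite add0r; apply/derivable1_diffP.
Qed.

Lemma differentiable_Psi_inv x : differentiable Psi_inv x.
Proof.
have -> : Psi_inv = \sum_(i < d) (fun y : V => psi_cot (y 0 i) *: delta_mx 0 i).
  apply/funext => y; rewrite fct_sumE; apply/rowP => j; rewrite summxE mxE.
  rewrite (bigD1 j)//= !mxE !eqxx mulr1 big1 ?addr0// => i ij.
  by rewrite !mxE [j == i]eq_sym (negbTE ij) andbF mulr0.
apply: differentiable_sum => i; apply: differentiableZl.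
apply: differentiable_coordf; by have [] := is_derive_psi_cot (x 0 i).
Qed.

(** [Psi_inv] acts on each coordinate separately, so its Jacobian matrix is diagonal and the chain
    rule keeps a single term. *)
Lemma partial_Psi_inv l f x : differentiable f (Psi_inv x) ->
  partial l (f \o Psi_inv) x = partial l f (Psi_inv x) * jac (x 0 l).
Proof.
move=> df; have dP := differentiable_Psi_inv x.
rewrite /partial deriveE; last exact: differentiable_comp.
rewrite diff_comp//= -(deriveE _ dP) derive_mx; last exact: diff_derivable.
rewrite deriveE// -[RHS]mulrC -[RHS]linearZ/=; congr ('d f _ _).
apply/rowP => j; rewrite !mxE eqxx/=.
under eq_fun do rewrite mxE.
have := partial_line l (fun y : V => psi_cot (y 0 j)) x; rewrite /partial => ->.
under eq_fun do rewrite line_coordE.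
case: eqVneq => [->|_]; last by rewrite mulr0 derive_cst.
by rewrite mulr1 derive_line derive1E; have [] := is_derive_psi_cot (x 0 l).
Qed.

Variable phi : V -> R.
Hypothesis sphi : smooth phi.

(** The pull-backs of all iterated partial derivatives of [phi] are generators, because
    differentiating one of them gives another one times a factor [jac], which is a [prodf]. *)
Inductive elem : (V -> R) -> Prop :=
| Elem_pull s : elem (fun x => foldr partial phi s (Psi_inv x))
| Elem_orig s : elem (foldr partial phi s)
| Elem_prodf h : (forall k, elem1 (h k)) -> elem (prodf h)
| Elem_add f g : elem f -> elem g -> elem (fun x => f x + g x)
| Elem_mul f g : elem f -> elem g -> elem (fun x => f x * g x).

Lemma elem_partial f : elem f ->
  (forall x, differentiable f x) /\ forall l, elem (partial l f).
Proof.
elim=> {f} [s|s|h eh|f g ef [df pf] eg [dg pg]|f g ef [df pf] eg [dg pg]].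
- split=> [x|l].
    by apply: differentiable_comp; [exact: differentiable_Psi_inv|exact: sphi].
  rewrite (_ : partial l _ = fun x => foldr partial phi (l :: s) (Psi_inv x) *
      prodf (fun k => if k == l then jac else fun=> 1) x).
    apply: Elem_mul; first exact: Elem_pull.
    by apply: Elem_prodf => k; case: ifP => _; [exact: Elem1_jac|exact: Elem1_cst].
  apply/funext => x; rewrite (partial_Psi_inv l (sphi _ _))/=; congr (_ * _).
  rewrite /prodf (bigD1 l)//= eqxx big1 ?mulr1// => k /negbTE -> //.
- by split=> [x|l]; [exact: sphi|exact: (Elem_orig (l :: s))].
- split=> [x|l]; first by apply: differentiable_prodf => k; exact: elem1_derivable.
  have -> : partial l (prodf h) = prodf (fun k => if k == l then derive1 (h k) else h k).
    by apply/funext => x; apply: partial_prodf; exact: elem1_derivable.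
  by apply: Elem_prodf => k; case: ifP => // _; have [] := elem1_derive1 (eh k).
- split=> [x|l]; first exact: differentiableD.
  rewrite (_ : partial _ _ = fun x => partial l f x + partial l g x).
    exact: Elem_add.
  by apply/funext => x; exact: partialD.
- split=> [x|l]; first exact: differentiableM.
  rewrite (_ : partial _ _ = fun x => f x * partial l g x + g x * partial l f x).
    by apply: Elem_add; exact: Elem_mul.
  by apply/funext => x; exact: partialM.
Qed.

Lemma elem_smooth f : elem f -> smooth f.
Proof.
move=> ef s x; suff : elem (foldr partial f s) by move=> /elem_partial[].
by elim: s => //= l s /elem_partial[_]; exact.
Qed.

End smooth_functions.

Section smooth_products.
Context {R : realType} {d : nat}.
Implicit Types (h : 'I_d -> R -> R) (f : 'rV[R]_d -> R).

Lemma smooth_differentiable f x : smooth f -> differentiable f x.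
Proof. by move=> /(_ [::] x). Qed.

Lemma smooth_partial l f : smooth f -> smooth (partial l f).
Proof. by move=> sf s x; have := sf (rcons s l) x; rewrite foldr_rcons. Qed.

Lemma smooth_continuous f : smooth f -> continuous f.
Proof. by move=> sf x; apply: differentiable_continuous; exact: smooth_differentiable. Qed.

Lemma partial_cst l (c : R) : partial l (fun _ : 'rV[R]_d => c) = fun=> 0.
Proof. by apply/funext => x; exact: derive_cst. Qed.

Lemma smooth_cst (c : R) : smooth (fun _ : 'rV[R]_d => c).
Proof.
move=> s x; have [c' ->] : exists c', foldr partial (fun _ : 'rV[R]_d => c) s = fun=> c'.
  elim: s => [|l s [c' IH]]/=; first by exists c.
  by exists 0; rewrite IH partial_cst.
exact: differentiable_cst.
Qed.

Lemma smooth_prodf h : (forall k, elem1 (h k)) -> smooth (prodf h).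
Proof. by move=> eh; apply: (elem_smooth (smooth_cst 0)); exact: Elem_prodf. Qed.

End smooth_products.

(** * Symmetry of mixed partial derivatives *)

Section schwarz.
Context {R : realType} {d : nat}.
Local Notation V := 'rV[R]_d.
Implicit Types (x y : V) (f : V -> R) (i j l : 'I_d).

Lemma is_derive_line i f y (t : R) : smooth f ->
  is_derive t 1 (fun u : R => f (u *: delta_mx 0 i + y))
    (partial i f (t *: delta_mx 0 i + y)).
Proof.
move=> sf; apply: DeriveDef.
  apply/derivable1_diffP.
  apply: (@differentiable_comp _ _ _ _ (fun u : R => u *: delta_mx 0 i + y) f);
    last exact: smooth_differentiable.
  by apply: (@differentiableD _ _ _ (fun u : R => u *: delta_mx 0 i) (cst y)).
rewrite /partial /derive; set g1 := fun h => h^-1 *: _; set g2 := fun h => h^-1 *: _.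
suff -> : g1 = g2 by [].
by apply/funext => h; rewrite /g1 /g2/= [_%:A]mulr1 scalerDl addrA.
Qed.

(** The second mixed difference over a square of side s. It is symmetric in the two directions. *)
Let box_increment i j f x (s : R) : R :=
  f (s *: delta_mx 0 i + (s *: delta_mx 0 j + x)) - f (s *: delta_mx 0 i + x) -
  f (s *: delta_mx 0 j + x) + f x.

(** The mean value theorem is applied twice: in direction i to the difference of f in direction j,
    then in direction j to the resulting partial derivative. *)
Let box_incrementE i j f x (s : R) : smooth f -> 0 < s ->
  exists t u : R, [/\ 0 < t < s, 0 < u < s & box_increment i j f x s =
    s ^+ 2 * partial j (partial i f) (t *: delta_mx 0 i + (u *: delta_mx 0 j + x))].
Proof.
move=> sf s0.
pose ei : V := delta_mx 0 i; pose ej : V := delta_mx 0 j.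
pose g (t : R) : R := f (t *: ei + (s *: ej + x)) - f (t *: ei + x).
have dg (t : R) : is_derive t (1 : R) g
    (partial i f (t *: ei + (s *: ej + x)) - partial i f (t *: ei + x)).
  exact: is_deriveB (is_derive_line _ _ _ _) (is_derive_line _ _ _ _).
have cont (k : R -> R) dk (a b : R) : (forall t : R, is_derive t (1 : R) k (dk t)) ->
    {within `[a, b], continuous k}.
  by move=> dkt; apply: derivable_within_continuous => t _; have [] := dkt t.
have [|t] := @MVT _ g _ 0 s s0 (fun t _ => dg t); first exact: (cont _ _ _ _ dg).
rewrite in_itv/= => ts gt.
pose k (u : R) : R := partial i f (u *: ej + (t *: ei + x)).
have dk (u : R) : is_derive u (1 : R) k (partial j (partial i f) (u *: ej + (t *: ei + x))).
  by apply: is_derive_line; exact: smooth_partial.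
have [|u] := @MVT _ k _ 0 s s0 (fun t _ => dk t); first exact: (cont _ _ _ _ dk).
rewrite in_itv/= => us ku; exists t, u; split=> //.
rewrite /box_increment; move: gt ku.
rewrite /g /k !scale0r !add0r !subr0 => gt ku.
rewrite -/ei -/ej [t *: ei + (u *: ej + x)]addrCA.
rewrite expr2 -mulrA [s * (_ * _)]mulrC [s * partial _ _ _]mulrC -ku.
rewrite [s *: ej + (_ + _)]addrCA -gt; ring.
Qed.

(** The second difference divided by s^2 is a value of either mixed derivative near x, and both are
    continuous at x. *)
Lemma partialC i j f : smooth f -> partial i (partial j f) = partial j (partial i f).
Proof.
move=> sf; apply/funext => x; apply/eqP; rewrite -subr_eq0 -normr_le0.
apply/ler_addgt0Pl => e e0; rewrite addr0.
have c1 := @smooth_continuous _ _ _ (smooth_partial i (smooth_partial j sf)) x.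
have c2 := @smooth_continuous _ _ _ (smooth_partial j (smooth_partial i sf)) x.
have e20 : 0 < e / 2 by rewrite divr_gt0.
move/cvgrPdist_lt : c1 => /(_ _ e20)/nbhs_ballP[r1/= r10 H1].
move/cvgrPdist_lt : c2 => /(_ _ e20)/nbhs_ballP[r2/= r20 H2].
pose r := Num.min r1 r2; have r0 : 0 < r by rewrite lt_min r10.
(* With s = r / M, every point t e_i + u e_j + x with t, u < s lies within r of x; the summand 1
   makes M positive and the inequality strict. *)
pose M := `|delta_mx 0 i : V| + `|delta_mx 0 j : V| + 1.
have M0 : 0 < M by rewrite ltr_wpDl// addr_ge0.
pose s := r / M; have s0 : 0 < s by rewrite divr_gt0.
have near_x t u (k1 k2 : V) : 0 < t < s -> 0 < u < s ->
    `|k1| + `|k2| + 1 = M -> `|x - (t *: k1 + (u *: k2 + x))| < r.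
  move=> /andP[t0 ts] /andP[u0 us] ME.
  rewrite addrA opprD addrCA subrr addr0 normrN.
  rewrite (le_lt_trans (ler_normD _ _))// !normrZ !gtr0_norm//.
  have -> : r = s * M by rewrite /s divfK// gt_eqF.
  rewrite -ME !mulrDr mulr1 ltr_pwDr// lerD// ler_wpM2r//; exact: ltW.
have [t1 [u1 [t1s u1s E1]]] := box_incrementE i j x sf s0.
have [t2 [u2 [t2s u2s E2]]] := box_incrementE j i x sf s0.
have E : box_increment i j f x s = box_increment j i f x s.
  rewrite /box_increment [s *: _ + (_ + _)]addrCA; ring.
move: E; rewrite E1 E2 => /mulfI E.
have {}E := E (lt0r_neq0 (exprn_gt0 2 s0)).
have := H2 (t1 *: delta_mx 0 i + (u1 *: delta_mx 0 j + x)).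
have := H1 (t2 *: delta_mx 0 j + (u2 *: delta_mx 0 i + x)).
rewrite -!ball_normE/= !E => K1 K2.
have rr1 : r <= r1 by rewrite ge_min lexx.
have rr2 : r <= r2 by rewrite ge_min lexx orbT.
have ME : `|delta_mx 0 j : V| + `|delta_mx 0 i : V| + 1 = M by rewrite /M (addrC `|_|).
have {}K1 := K1 (lt_le_trans (near_x _ _ _ _ t2s u2s ME) rr1).
have {}K2 := K2 (lt_le_trans (near_x _ _ _ _ t1s u1s erefl) rr2).
rewrite [e]splitr; apply: ltW; apply: le_lt_trans (ltrD K1 K2).
rewrite [X in _ <= _ + X]distrC; apply: le_trans (ler_normD _ _).
by rewrite subrKA.
Qed.

Definition incr_multi (j : 'I_d -> nat) l : 'I_d -> nat := fun k => (j k + (k == l))%N.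

Lemma smooth_iter_partial i n f : smooth f -> smooth (iter n (partial i) f).
Proof. by move=> sf; elim: n => //= n IH; exact: smooth_partial. Qed.

Lemma iter_partialC i l n f : smooth f ->
  iter n (partial i) (partial l f) = partial l (iter n (partial i) f).
Proof.
by move=> sf; elim: n => //= n ->; rewrite partialC//; exact: smooth_iter_partial.
Qed.

(** [partialn] composes the derivatives in the fixed order of the enumeration, so the additional
    derivative stands in the middle of the composition and has to be commuted to the innermost
    place. *)
Lemma partialn_incr (j : 'I_d -> nat) l f : smooth f ->
  partialn (incr_multi j l) f = partialn j (partial l f).
Proof.
move=> sf; rewrite /partialn.
have H s : uniq s ->
    foldr (fun i => iter (incr_multi j l i) (partial i)) f s =
    (if l \in s then foldr (fun i => iter (j i) (partial i)) (partial l f) s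
     else foldr (fun i => iter (j i) (partial i)) f s) /\
    foldr (fun i => iter (j i) (partial i)) (partial l f) s =
    partial l (foldr (fun i => iter (j i) (partial i)) f s) /\
    smooth (foldr (fun i => iter (j i) (partial i)) f s).
  elim: s => [//|i s IH]/= /andP[iNs us]; have [-> [E sm]] := IH us.
  split; last first.
    split; last exact: smooth_iter_partial.
    by rewrite E iter_partialC.
  rewrite inE /incr_multi; have [il|li] := eqVneq l i => /=.
    rewrite -il in iNs *; rewrite (negbTE iNs) addn1 /= E.
    by rewrite iter_partialC.
  by rewrite addn0; case: ifP.
by have [-> _] := H _ (enum_uniq 'I_d); rewrite mem_enum.
Qed.

(* The word listing the derivatives of [partialn r] from the outside in. *)
Definition multi_word (r : 'I_d -> nat) : seq 'I_d :=
  flatten [seq nseq (r i) i | i <- enum 'I_d].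

Lemma partialn_word r f : partialn r f = foldr partial f (multi_word r).
Proof.
rewrite /partialn /multi_word; elim: (enum _) => //= i s ->.
by rewrite foldr_cat; elim: (r i) => //= n ->.
Qed.

Lemma count_multi_word r l : count_mem l (multi_word r) = r l.
Proof.
rewrite /multi_word count_flatten -map_comp.
rewrite (eq_map (g := fun i => (i == l) * r i)%N); last first.
  by move=> i /=; rewrite count_nseq.
rewrite sumnE big_map big_enum/= (bigD1 l)//= eqxx mul1n big1 ?addn0//.
by move=> i /negbTE ->.
Qed.

Lemma size_multi_word r : size (multi_word r) = (\sum_i r i)%N.
Proof.
rewrite /multi_word size_flatten /shape -map_comp.
rewrite (eq_map (g := r)); last by move=> i /=; rewrite size_nseq.
by rewrite sumnE big_map big_enum.
Qed.

End schwarz.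

(** * Lebesgue measure on R^d *)

Section borel_sets_of_rV.
Context {R : realType} {n : nat}.
Local Notation V := 'rV[R]_n.

Definition rect (A : 'I_n -> set R) : set V := [set v | forall i, A i (v 0 i)].

Definition orthant (c : V) : set V := [set v | forall i, c 0 i < v 0 i].

Lemma rectE (A : 'I_n -> set R) :
  rect A = \bigcap_(i in [set: 'I_n]) ((fun v : V => v 0 i) @^-1` A i).
Proof. by apply/seteqP; split => v /= Av i => [_|]; [exact: Av|exact: (Av i I)]. Qed.

Lemma measurable_rect (A : 'I_n -> set R) :
  (forall i, measurable (A i)) -> measurable (rect A).
Proof.
move=> mA; rewrite rectE; apply: fin_bigcap_measurable; first exact: finite_finset.
move=> i _; rewrite -[X in measurable X]setTI.
by apply: measurable_coord => //; exact: mA.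
Qed.

Lemma orthantE (c : V) : orthant c = rect (fun i => `]c 0 i, +oo[%classic).
Proof. by apply/seteqP; split => v cv i; have := cv i; rewrite /= in_itv/= andbT. Qed.

Lemma measurable_orthant (c : V) : measurable (orthant c).
Proof. by rewrite orthantE; apply: measurable_rect. Qed.

Lemma ball_rectE (x : V) (e : R) : 0 < e ->
  ball x e = rect (fun i => ball (x 0 i) e).
Proof.
move=> e0; apply/seteqP; split=> v /=.
  by move=> [_ xv] i; exact: xv.
by move=> xv; split=> // i j; rewrite (ord1 i); exact: xv.
Qed.

(** The sigma-algebra is generated by the coordinates, not by the topology. An open set is the union
    of the countably many balls with rational centre and radius 1/(m+1) that it contains, and balls
    for this norm are boxes. *)
Lemma open_measurable_rV (U : set V) : open U -> measurable U.
Proof.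
move=> oU.
pose F (q : 'rV[rat]_n * nat) : set V :=
  let B := ball (map_mx (@ratr R) q.1 : V) (q.2.+1%:R^-1) in if `[< B `<=` U >] then B else set0.
have -> : U = \bigcup_q F q.
  apply/seteqP; split=> x; last first.
    by move=> [q _]; rewrite /F; case: ifPn => // /asboolP BU; exact: BU.
  move=> Ux; have /nbhs_ballP[e /= e0 xeU] := open_nbhs_nbhs (conj oU Ux).
  have [m me] : exists m : nat, (m.+1%:R^-1 : R) < e / 2.
    have e20 : 0 < e / 2 by rewrite divr_gt0.
    have [m _ mP] := near_infty_natSinv_lt (PosNum e20).
    by exists m; apply: (mP m) => /=.
  have m0 : (0 : R) < m.+1%:R^-1 by rewrite invr_gt0.
  have Hq (i : 'I_n) : exists q : rat, x 0 i - m.+1%:R^-1 < ratr q < x 0 i + m.+1%:R^-1.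
    have [|q] := @rat_in_itvoo R (x 0 i - m.+1%:R^-1) (x 0 i + m.+1%:R^-1).
      by rewrite ltrBlDr -addrA ltrDl addr_gt0.
    by rewrite in_itv/= => qP; exists q.
  have [q qP] := choice Hq.
  have bq : ball (map_mx (@ratr R) (\row_i q i) : V) (m.+1%:R^-1) x.
    rewrite ball_rectE// => i; rewrite !mxE -ball_normE/= ltr_distl.
    exact: qP.
  exists (\row_i q i, m) => //; rewrite /F/= ifT//; apply/asboolP => y By.
  apply: xeU; rewrite [e]splitr.
  apply: (ball_triangle (ball_sym (le_ball (ltW me) bq))).
  exact: (le_ball (ltW me)).
apply: countable_bigcupT_measurable; first exact: countableP.
move=> q; rewrite /F; case: ifP => // _.
rewrite ball_rectE ?invr_gt0//; apply: measurable_rect => i.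
by rewrite ball_itv; exact: measurable_itv.
Qed.

Lemma continuous_measurable_rV (f : V -> R) : continuous f -> measurable_fun setT f.
Proof.
move=> /continuousP cf.
apply: measurability (@RGenOpens.measurableE R) _.
move=> _ [_ [a [b ->]] <-]; rewrite setTI; apply: open_measurable_rV.
by apply: cf; exact: interval_open.
Qed.

Lemma measurable_rV_rect :
  @measurable _ V = <<s [set rect A | A in [set A | forall i, measurable (A i)]] >>.
Proof.
apply/seteqP; split; last first.
  apply: smallest_sub; first exact: sigma_algebra_measurable.
  by move=> _ [A mA <-]; exact: measurable_rect.
apply: smallest_sub; first exact: smallest_sigma_algebra.
move=> B; rewrite -bigcup_seq/= => -[i _ [Y mY <-]].
apply: sub_gen_smallest; exists (fun j => if j == i then Y else setT).
  by move=> j; case: ifP => // _; exact: measurableT.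
rewrite setTI; apply/seteqP; split => v /=; first by move=> /(_ i); rewrite eqxx.
by move=> Yv j; case: eqVneq => // ->.
Qed.

Lemma measurable_rV_orthant :
  @measurable _ V = <<s range orthant `|` [set setT] >>.
Proof.
apply/seteqP; split; last first.
  apply: smallest_sub; first exact: sigma_algebra_measurable.
  by move=> _ [[c _ <-]|->]; [exact: measurable_orthant|exact: measurableT].
apply: smallest_sub; first exact: smallest_sigma_algebra.
move=> B; rewrite -bigcup_seq/= => -[i _ [Y mY <-]].
pose T' := g_sigma_algebraType (range orthant `|` [set setT]).
have : measurable_fun setT (fun v : T' => (v : V) 0 i).
  apply: measurability (@RGenOInfty.measurableE R) _.
  move=> _ [_ [a ->] <-]; rewrite setTI.
  (* A half-space is the union of orthants whose remaining corner coordinates are -m. *)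
  have -> : (fun v : T' => (v : V) 0 i) @^-1` `]a, +oo[%classic =
      \bigcup_(m : nat) orthant (\row_j if j == i then a else - m%:R).
    apply/seteqP; split=> v /=; last first.
      by move=> [m _ /(_ i)]; rewrite mxE eqxx in_itv/= andbT.
    rewrite in_itv/= andbT => av.
    pose m := \max_(j < n) Num.bound `|(v : V) ord0 j|.
    exists m => // j; rewrite mxE; case: eqVneq => [->//|_].
    rewrite ltrNl; apply: (le_lt_trans (ler_norm _)); rewrite normrN.
    apply: (lt_le_trans (archi_boundP (normr_ge0 _))).
    by rewrite ler_nat; exact: (leq_bigmax_cond (F := fun j : 'I_n => Num.bound `|(v : V) ord0 j|)).
  apply: bigcupT_measurable => m; apply: sub_sigma_algebra; left.
  by exists (\row_j if j == i then a else - m%:R).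
by move=> /(_ measurableT Y mY).
Qed.

End borel_sets_of_rV.

(** * Orthants determine integrable functions *)

Section determination_by_orthants.
Context {R : realType} {n : nat}.
Local Notation V := 'rV[R]_n.
Local Notation mu := (lebesgue_rV n).
Implicit Types (u : V -> R) (c : V).

(** The sets over which [u] has integral 0 form a Dynkin class. Since [u] vanishes off the orthant
    [c0], the class contains the whole space and is therefore stable under complements. *)
Lemma integral_orthants_eq0 u (c0 : V) :
  mu.-integrable setT (EFin \o u) ->
  (forall x, ~ orthant c0 x -> u x = 0) ->
  (forall c, \int[mu]_(x in orthant c) u x = 0) ->
  {ae mu, forall x, u x = 0}.
Proof.
move=> iu u0 H.
pose P (A : set V) := (\int[mu]_(x in A) (u x)%:E = 0)%E.
have H' c : P (orthant c).
  have := H c; rewrite /Rintegral /P => Hc.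
  rewrite -[LHS]fineK ?Hc//; apply: integrable_fin_num => //; first exact: measurable_orthant.
  by apply: integrableS iu => //; exact: measurable_orthant.
have HT : P setT.
  rewrite /P -(H' c0) [RHS]integral_mkcond; apply: eq_integral => x _.
  by rewrite patchE; case: ifPn => // /negP cx; rewrite u0// => /mem_set.
have HA A : measurable A -> P A.
  rewrite measurable_rV_orthant; apply: dynkin_induction => //.
  - exact: measurable_rV_orthant.
  - move=> _ _ [[a _ <-]|->] [[b _ <-]|->]; rewrite ?setTI ?setIT;
      [|by left; exists a|by left; exists b|by right].
    left; exists (\row_i Num.max (a 0 i) (b 0 i)) => //.
    apply/seteqP; split=> x /=.
      by move=> h; split=> i; have := h i; rewrite mxE gt_max => /andP[].
    by move=> [ha hb] i; rewrite mxE gt_max ha hb.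
  - by move=> _ [[c _ <-]|->].
  - move=> S mS PS; rewrite /P.
    have := HT; rewrite /P -(setUv S) integral_setU_EFin ?PS ?add0e//.
    + exact: measurableC.
    + by rewrite setUv; apply/measurable_EFinP; exact: measurable_int iu.
    + by apply/disj_setPS => x [].
  - move=> F mF tF PF; rewrite /P integral_bigcup//.
      by under eq_eseriesr do rewrite PF; rewrite eseries0.
    by apply: integrableS iu => //; exact: bigcupT_measurable.
have := @integral_ae_eq _ _ _ mu setT measurableT (cst 0%E) (EFin \o u) iu
  (measurable_cst _).
case=> [E _ mE|N [mN N0 sN]]; first by rewrite HA// integral0.
exists N; split => // x /= h; apply: sN => /= /(_ I) [].
by move=> ?; apply: h.
Qed.

End determination_by_orthants.

Section insert_coord.
Context {R : realType} {n : nat}.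
Local Notation insert l := (@insert_coord R n.+1 l).

Lemma insert_coord_same (l : 'I_n.+1) (s : 'rV[R]_n) x : insert l s x 0 l = x.
Proof. by rewrite mxE unlift_none. Qed.

Lemma insert_coord_lift (l : 'I_n.+1) (s : 'rV[R]_n) x k :
  insert l s x 0 (lift l k) = s 0 k.
Proof. by rewrite mxE liftK. Qed.

Lemma rect_insert (l : 'I_n.+1) (A : 'I_n.+1 -> set R) s x :
  rect A (insert l s x) <-> A l x /\ rect (fun k => A (lift l k)) s.
Proof.
split=> [H|[Hl H] i].
  split; first by have := H l; rewrite insert_coord_same.
  by move=> k; have := H (lift l k); rewrite insert_coord_lift.
have [k ->|->] := unliftP l i; first by rewrite insert_coord_lift.
by rewrite insert_coord_same.
Qed.

Definition insert_pair l (p : measurableTypeR R * 'rV[R]_n) : 'rV[R]_n.+1 :=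
  insert l p.2 p.1.

Lemma measurable_insert_pair l : measurable_fun setT (insert_pair l).
Proof.
apply: measurable_fun_rV => i; have [k ->|->] := unliftP l i.
  under eq_fun do rewrite /insert_pair insert_coord_lift.
  by apply: (measurableT_comp (measurable_coord k)); exact: measurable_snd.
under eq_fun do rewrite /insert_pair insert_coord_same.
exact: measurable_fst.
Qed.

(** Boxes form a pi-system that generates the sigma-algebra, and the cubes with sides [-k, k[
    exhaust the space with finite measure. *)
Lemma lebesgue_rV_unique m (nu : {measure set 'rV[R]_m -> \bar R}) :
  (forall A : 'I_m -> set R, (forall i, measurable (A i)) ->
    nu (rect A) = (\prod_(i < m) lebesgue_measure (A i))%E) ->
  forall X, measurable X -> nu X = lebesgue_rV m X.
Proof.
move=> H X mX.
apply: (measure_unique [set rect A | A in [set A | forall i, measurable (A i)]]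
  (fun k : nat => rect (fun _ => `]- k%:R, k%:R[%classic))) => //.
- exact: measurable_rV_rect.
- move=> _ _ [A mA <-] [B mB <-]; exists (fun i => A i `&` B i).
    by move=> i; apply: measurableI.
  by apply/seteqP; split=> x /=; [move=> h; split=> i; have [] := h i|
    move=> [hA hB] i; split].
- by move=> k; exists (fun _ => `]- k%:R, k%:R[%classic) => //.
- apply/seteqP; split=> // v _.
  exists (\max_(j < m) Num.bound `|v ord0 j|) => // j; rewrite /= in_itv/=.
  rewrite -ltr_norml; apply: (lt_le_trans (archi_boundP (normr_ge0 _))).
  by rewrite ler_nat; exact: (leq_bigmax_cond (F := fun j : 'I_m => Num.bound `|v ord0 j|)).
- by move=> _ [A mA <-]; rewrite H// -lebesgue_rV_box.
- move=> k; rewrite H//.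
  rewrite ltey_eq (_ : (_ \is a fin_num) = true)//.
  elim/big_ind : _ => //; first by move=> x y; exact: fin_numM.
  by move=> i _; rewrite lebesgue_measure_itv/=; case: ifP.
Qed.

(** The recursive construction singles out coordinate 0. As the measure of a box does not depend on
    the order of its sides, any coordinate [l] may be split off instead. *)
Lemma lebesgue_rV_insert l X : measurable X ->
  pushforward (@lebesgue_measure R \x lebesgue_rV n)%E (insert_pair l) X =
  lebesgue_rV n.+1 X.
Proof.
pose nu : {measure set 'rV[R]_n.+1 -> \bar R} :=
  measure_function_pushforward__canonical__measure_function_Measure
    (@lebesgue_measure R \x lebesgue_rV n)%E (measurable_insert_pair l).
move=> mX; apply: (@lebesgue_rV_unique _ nu) => // A mA.
rewrite /nu/= /pushforward (_ : _ @^-1` _ = A l `*` rect (fun k => A (lift l k))).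
  rewrite product_measure1E; [|exact: mA|by apply: measurable_rect => k; exact: mA].
  rewrite [X in (_ * X)%E]lebesgue_rV_box; last by move=> i; exact: mA.
  by rewrite (@bigD1_ord _ (mule : Monoid.com_law _) _ _ l xpredT
    (fun i => lebesgue_measure (A i)) isT).
by apply/seteqP; split=> -[x s] /rect_insert.
Qed.

Local Open Scope ereal_scope.

Lemma eq_integral_insert l (D : set 'rV[R]_n.+1) (f : 'rV[R]_n.+1 -> \bar R) :
  \int[lebesgue_rV n.+1]_(x in D) f x =
  \int[pushforward (@lebesgue_measure R \x lebesgue_rV n) (insert_pair l)]_(x in D) f x.
Proof.
pose nu : {measure set 'rV[R]_n.+1 -> \bar R} :=
  measure_function_pushforward__canonical__measure_function_Measure
    (@lebesgue_measure R \x lebesgue_rV n)%E (measurable_insert_pair l).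
apply: (@eq_measure_integral _ _ _ D nu (lebesgue_rV n.+1)).
by move=> A mA _; exact: esym (lebesgue_rV_insert l mA).
Qed.

Lemma ge0_integral_insert l (f : 'rV[R]_n.+1 -> \bar R) :
  measurable_fun setT f -> (forall x, 0 <= f x) ->
  \int[lebesgue_rV n.+1]_x f x =
  \int[lebesgue_rV n]_s \int[@lebesgue_measure R]_x f (insert l s x).
Proof.
move=> mf f0; rewrite (eq_integral_insert l).
rewrite ge0_integral_pushforward//; last exact: measurable_insert_pair.
rewrite preimage_setT.
rewrite fubini_tonelli2//.
  by apply: measurableT_comp => //; exact: measurable_insert_pair.
by move=> p /=.
Qed.

Lemma integrable_insert l (f : 'rV[R]_n.+1 -> \bar R) :
  (lebesgue_rV n.+1).-integrable setT f ->
  (@lebesgue_measure R \x lebesgue_rV n).-integrable setT (f \o insert_pair l).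
Proof.
move=> /integrableP[mf foo]; apply/integrableP; split.
  by apply: measurableT_comp => //; exact: measurable_insert_pair.
move: foo; rewrite (eq_integral_insert l) ge0_integral_pushforward//.
  exact: measurable_insert_pair.
exact: measurableT_comp.
Qed.

End insert_coord.

(** * The cotangent change of variables *)

Section integral_density.
Local Open Scope ereal_scope.
Context d (T : measurableType d) (R : realType).
Variables (mu nu : {measure set T -> \bar R}) (w : T -> R).
Hypotheses (mw : measurable_fun setT w) (w0 : forall x, (0 <= w x)%R).
Hypothesis nuE : forall A, measurable A -> nu A = \int[mu]_(x in A) (w x)%:E.

Import HBNNSimple.

(** The hypothesis [nuE] is the formula for indicators; it passes to simple functions by linearity
    and to [f] by monotone convergence. *)
Lemma ge0_integral_density (f : T -> \bar R) :
  measurable_fun setT f -> (forall x, 0 <= f x) ->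
  \int[nu]_x f x = \int[mu]_x (f x * (w x)%:E).
Proof.
move=> mf f0; pose h := nnsfun_approx measurableT mf.
have fE x : f x = lim ((EFin \o h n) x @[n --> \oo]).
  by apply/esym/cvg_lim => //; exact: cvg_nnsfun_approx.
have -> : \int[nu]_x f x = lim (\int[nu]_x (EFin \o h n) x @[n --> \oo]).
  under eq_integral do rewrite fE.
  apply: monotone_convergence => //.
  - by move=> n; exact/measurable_EFinP/measurable_funP.
  - by move=> n x _ /=; rewrite lee_fin.
  - by move=> x _ a b ab; rewrite lee_fin; exact/lefP/nd_nnsfun_approx.
have -> : \int[mu]_x (f x * (w x)%:E) =
    lim (\int[mu]_x ((EFin \o h n) x * (w x)%:E) @[n --> \oo]).
  have fg x : f x * (w x)%:E = lim (((EFin \o h n) x * (w x)%:E) @[n --> \oo]).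
    by apply/esym/cvg_lim => //; apply: cvgeZr => //; exact: cvg_nnsfun_approx.
  under eq_integral do rewrite fg.
  apply: monotone_convergence => //.
  - by move=> n; apply: emeasurable_funM; [exact/measurable_EFinP/measurable_funP|exact/measurable_EFinP].
  - by move=> n x _ /=; rewrite mule_ge0 ?lee_fin.
  - by move=> x _ a b ab/=; rewrite lee_wpmul2r ?lee_fin//; exact/lefP/nd_nnsfun_approx.
apply/congr_lim/funext => n.
transitivity (\int[nu]_x
   (\sum_(y \in range (h n)) (y * \1_(h n @^-1` [set y]) x)%:E)).
  by apply: eq_integral => t _; rewrite /= fimfunE -fsumEFin.
have indich r : measurable_fun setT (fun x => (r * \1_(h n @^-1` [set r]) x)%:E).
  by apply: (measurable_comp measurableT) => //; exact: measurable_funM.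
rewrite ge0_integral_fsum//; last by move=> y x _; exact: nnfun_muleindic_ge0.
transitivity (\int[mu]_x (\sum_(y \in range (h n))
    (y * \1_(h n @^-1` [set y]) x)%:E * (w x)%:E)); last first.
  under [RHS]eq_integral.
    move=> x _; rewrite /= (fimfunE (h n)) -fsumEFin// ge0_mule_fsuml; last first.
      by move=> y; exact: nnfun_muleindic_ge0.
    over.
  by [].
rewrite ge0_integral_fsum//; last 2 first.
- by move=> y; by apply: emeasurable_funM => //; exact/measurable_EFinP.
- move=> y x _; rewrite mule_ge0 ?lee_fin// -lee_fin EFinM.
  exact: nnfun_muleindic_ge0.
apply: eq_fsbigr => r; rewrite inE => -[x0 _ rE].
have r0 : (0 <= r)%R by rewrite -rE.
under eq_integral do rewrite EFinM.
under [in RHS]eq_integral do rewrite EFinM -muleA.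
have mA : measurable (h n @^-1` [set r]) by exact: measurable_funPTI.
rewrite ge0_integralZl//; last by apply/measurable_EFinP.
rewrite ge0_integralZl//; last 2 first.
- by apply: emeasurable_funM => //; apply/measurable_EFinP.
- by move=> x _; rewrite mule_ge0// lee_fin.
congr (_ * _); rewrite integral_indic// setIT nuE// [LHS]integral_mkcond.
apply: eq_integral => x _; rewrite epatch_indic.
by rewrite muleC.
Qed.

End integral_density.

Section cotangent.
Context {R : realType}.
Implicit Types (x t : R).

Lemma phi_cot_tan t : phi_cot t = tan (pi * t - pi / 2).
Proof. by rewrite /tan sinBpihalf cosBpihalf /phi_cot mulNr. Qed.

Lemma half_shift_itv t : 0 < t < 1 -> - (pi / 2) < pi * t - pi / 2 < pi / 2.
Proof.
move=> /andP[t0 t1]; have p := pi_gt0 R.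
rewrite ltrBrDr addrC subrr mulr_gt0//= ltrBlDr -splitr.
by rewrite gtr_pMr.
Qed.

Lemma phi_cotK t : 0 < t < 1 -> psi_cot (phi_cot t) = t.
Proof.
move=> t01; rewrite phi_cot_tan /psi_cot tanK ?in_itv/= ?half_shift_itv//.
have p : (pi : R) != 0 by rewrite gt_eqF ?pi_gt0.
rewrite mulrBl [pi * t]mulrC mulfK// mulrAC divff// mul1r; ring.
Qed.

Lemma psi_cot_itv x : 0 < psi_cot x < 1.
Proof.
have p := pi_gt0 R; have h1 := atan_gtNpi2 x; have h2 := atan_ltpi2 x.
have y1 : - 2^-1 < atan x / pi by rewrite ltr_pdivlMr// mulNr mulrC.
have y2 : atan x / pi < 2^-1 by rewrite ltr_pdivrMr// mulrC.
by rewrite /psi_cot; lra.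
Qed.

Lemma psi_cot_lt x y : (psi_cot x < psi_cot y) = (x < y).
Proof.
have homo : {homo psi_cot : x y / x < y :> R}.
  by move=> a b ab; rewrite ltrD2l ltr_pM2r ?invr_gt0 ?pi_gt0// lt_atan.
by rewrite (leW_mono (le_mono homo)).
Qed.

Lemma phi_cot_gt x t : 0 < t < 1 -> (x < phi_cot t) = (psi_cot x < t).
Proof. by move=> t01; rewrite -psi_cot_lt phi_cotK. Qed.

Lemma is_derive_phi_cot t : 0 < t < 1 -> is_derive t 1 phi_cot (jac (phi_cot t))^-1.
Proof.
move=> t01.
have c0 : cos (pi * t - pi / 2) != 0.
  by rewrite gt_eqF// cos_gt0_pihalf// half_shift_itv.
have -> : phi_cot = tan \o (pi *: (id : R -> R) + cst (- (pi / 2))).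
  by apply/funext => y; rewrite phi_cot_tan.
apply: is_derive_eq (is_derive1_comp (is_derive_tan _)
   (is_deriveD (is_deriveZ _ (is_derive_id _ _)) (is_derive_cst _ _ _))) _.
  exact: c0.
rewrite /jac invrK -[in LHS]exprVn [(_ ^-1) ^+ 2]exprVn cos2_tan2//=.
by rewrite addr0 /GRing.scale/= mulr1 mulrC.
Qed.

Lemma derive1_phi_cot t : 0 < t < 1 -> derive1 phi_cot t = (jac (phi_cot t))^-1.
Proof. by move=> /is_derive_phi_cot[_]; rewrite derive1E. Qed.

(* [phi_cot] extended by 0, so as to be measurable on the whole line. *)
Definition phi_cot0 : R -> R := phi_cot \_ `]0, 1[.

Lemma phi_cot0E t : 0 < t < 1 -> phi_cot0 t = phi_cot t.
Proof. by move=> t01; rewrite /phi_cot0 patchT// inE/= in_itv. Qed.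

Lemma measurable_phi_cot0 : measurable_fun setT (phi_cot0 : measurableTypeR R -> measurableTypeR R).
Proof.
apply/(measurable_restrictT _ _).1 => //.
apply: open_continuous_measurable_fun; first exact: interval_open.
move=> t; rewrite inE/= in_itv/= => t01.
apply/differentiable_continuous/derivable1_diffP.
by have [] := is_derive_phi_cot t01.
Qed.

Local Open Scope ereal_scope.

Lemma integral_jac_itvy (c : R) :
  \int[@lebesgue_measure R]_(x in `]c, +oo[) (jac x)%:E = (1 - psi_cot c)%:E.
Proof.
rewrite integral_itv_obnd_cbnd; last first.
  apply/measurable_EFinP/measurable_funTS.
  by apply: continuous_measurable_fun; exact: elem1_continuous Elem1_jac.
rewrite (@ge0_continuous_FTC2y _ _ psi_cot c 1%R).
- by rewrite EFinB.
- by move=> x _; rewrite ltW// jac_gt0.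
- by apply: continuous_subspaceT; exact: elem1_continuous Elem1_jac.
- have -> : (1 = 2^-1 + (pi : R) / 2 / pi)%R.
    have p : ((pi : R) != 0)%R by rewrite gt_eqF ?pi_gt0.
    by rewrite mulrAC divff// mul1r; lra.
  apply: cvgD; first exact: cvg_cst.
  by apply: cvgMl; exact: cvgy_atan.
- by move=> x _; have [] := is_derive_psi_cot x.
- apply: cvg_at_right_filter; apply/differentiable_continuous/derivable1_diffP.
  by have [] := is_derive_psi_cot c.
- by move=> x _; rewrite derive1E; have [] := is_derive_psi_cot x.
Qed.

Let dens (A : set (measurableTypeR R)) : \bar R := \int[@lebesgue_measure R]_(x in A) (jac x)%:E.

Let measurable_jac : measurable_fun setT (@jac R).
Proof. by apply: continuous_measurable_fun; exact: elem1_continuous Elem1_jac. Qed.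

Let dens0 : dens set0 = 0. Proof. exact: integral_set0. Qed.

Let dens_ge0 A : 0 <= dens A.
Proof. by apply: integral_ge0 => x _; rewrite lee_fin ltW// jac_gt0. Qed.

Let dens_sigma_additive : semi_sigma_additive dens.
Proof.
apply: (@semi_sigma_additive_nng_induced _ _ R (@lebesgue_measure R)
    (fun x => (jac x)%:E)); first exact/measurable_EFinP.
by move=> x; rewrite lee_fin ltW// jac_gt0.
Qed.

HB.instance Definition _ := isMeasure.Build _ _ _ dens dens0 dens_ge0
  dens_sigma_additive.

Let oitv : set (measurableTypeR R) := `]0%R, 1%R[%classic.

Let moitv : measurable oitv. Proof. exact: measurable_itv. Qed.

Let nu : {measure set (measurableTypeR R) -> \bar R} :=
  measure_function_pushforward__canonical__measure_function_Measure
    (mrestr (@lebesgue_measure R) moitv) measurable_phi_cot0.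

(** Both measures give mass 1 - [psi_cot c] to the half-line above c, and these half-lines form a
    pi-system that generates the Borel sets. *)
Let nuE (A : set (measurableTypeR R)) : measurable A -> nu A = dens A.
Proof.
move=> mA; apply: (@measure_unique _ R (measurableTypeR R) (@RGenOInfty.G R)
  (fun k : nat => `](- k%:R)%R, +oo[%classic) _ _ _ _ nu dens _ _ A mA).
- exact: RGenOInfty.measurableE.
- move=> _ _ [a ->] [b ->]; exists (Num.max a b); apply/seteqP; split=> x /=;
    rewrite !in_itv/= !andbT gt_max; first by move=> [-> ->].
  by move=> /andP[].
- by move=> k; exists (- k%:R)%R.
- apply/seteqP; split=> // x _; exists (Num.bound `|x|) => //.
  rewrite /= in_itv/= andbT ltrNl; apply: (le_lt_trans (ler_norm _)).
  by rewrite normrN; exact: archi_boundP.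
- move=> _ [c ->]; rewrite [RHS](integral_jac_itvy c).
  rewrite /nu/= /pushforward /mrestr.
  rewrite (_ : _ `&` _ = `]psi_cot c, 1%R[%classic); last first.
    have /andP[p0 _] := psi_cot_itv c.
    apply/seteqP; split=> t /=; rewrite !in_itv/= andbT.
      by move=> [+ t01]; rewrite phi_cot0E// phi_cot_gt// => ->; case/andP: t01.
    move=> /andP[ct t1]; have t01 : (0 < t < 1)%R by rewrite t1 (lt_trans p0 ct).
    by rewrite phi_cot0E// phi_cot_gt.
  have /andP[_ p1] := psi_cot_itv c.
  by rewrite lebesgue_measure_itv/= lte_fin p1 EFinB.
- move=> k; rewrite /nu/= /pushforward /mrestr.
  apply: (@le_lt_trans _ _ (lebesgue_measure oitv)).
    apply: le_measure; rewrite ?inE//.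
    apply: measurableI => //; rewrite -[X in measurable X]setTI.
    exact: measurable_phi_cot0.
  by rewrite lebesgue_measure_itv/= lte_fin ltr01 -EFinB ltry.
Qed.

(** Both sides are the integral of [G] against [nu], which is at once the measure with density [jac]
    and the image under [phi_cot0] of Lebesgue measure on the unit interval. *)
Lemma ge0_integral_cot (G : R -> \bar R) :
  measurable_fun setT G -> (forall x, 0 <= G x) ->
  \int[@lebesgue_measure R]_x (G x * (jac x)%:E) =
  \int[@lebesgue_measure R]_t (G (phi_cot0 t) * (\1_(`]0%R, 1%R[%classic) t)%:E).
Proof.
move=> mG G0; have jac0 (x : R) : (0 <= jac x)%R by rewrite ltW// jac_gt0.
rewrite -(ge0_integral_density (nu := nu) measurable_jac jac0 nuE mG G0).
rewrite ge0_integral_pushforward//; last exact: measurable_phi_cot0.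
rewrite preimage_setT.
rewrite (ge0_integral_density (mu := @lebesgue_measure R) (w := \1_oitv))//.
- by move=> A mA; rewrite /mrestr integral_indic// setIC.
- by apply: measurableT_comp => //; exact: measurable_phi_cot0.
- by move=> t /=.
Qed.

End cotangent.

(** * Products of one-dimensional changes of variables *)

Section product_change_of_variables.
Context {R : realType}.
Local Open Scope ereal_scope.
Variables (w1 w2 theta : R -> R).
Hypotheses (mw1 : measurable_fun setT w1) (w1_ge0 : forall x, (0 <= w1 x)%R).
Hypotheses (mw2 : measurable_fun setT w2) (w2_ge0 : forall x, (0 <= w2 x)%R).
Hypothesis mtheta : measurable_fun setT theta.
Hypothesis H1 : forall G : R -> \bar R,
  measurable_fun setT G -> (forall x, 0 <= G x) ->
  \int[@lebesgue_measure R]_x (G x * (w1 x)%:E) =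
  \int[@lebesgue_measure R]_t (G (theta t) * (w2 t)%:E).

Lemma measurable_prodf n (w : R -> R) : measurable_fun setT w ->
  measurable_fun setT (fun x : 'rV[R]_n => \prod_k w (x ord0 k))%R.
Proof.
move=> mw; apply: measurable_prod => k _.
by apply: (measurableT_comp mw); exact: measurable_coord.
Qed.

Lemma measurable_map_row n : measurable_fun setT
  (fun x : 'rV[R]_n => \row_i theta (x ord0 i) : 'rV[R]_n).
Proof.
apply: measurable_fun_rV => i; under eq_fun do rewrite mxE.
by apply: (measurableT_comp mtheta); exact: measurable_coord.
Qed.

Lemma ge0_integral_product_change n (G : 'rV[R]_n -> \bar R) :
  measurable_fun setT G -> (forall x, 0 <= G x) ->
  \int[lebesgue_rV n]_x (G x * (\prod_k w1 (x ord0 k))%:E) =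
  \int[lebesgue_rV n]_t (G (\row_i theta (t ord0 i)) * (\prod_k w2 (t ord0 k))%:E).
Proof.
elim: n G => [|n IH] G mG G0.
  apply: eq_integral => x _; rewrite !big_ord0; congr (G _ * _).
  by apply/rowP => -[].
have prod_ge0 m (w : R -> R) (x : 'rV[R]_m) : (forall x, (0 <= w x)%R) ->
    (0 <= \prod_k w (x ord0 k))%R.
  by move=> w0; apply: prodr_ge0.
rewrite (ge0_integral_insert ord0); last 2 first.
- by apply: emeasurable_funM => //; apply/measurable_EFinP; exact: measurable_prodf.
- by move=> x; rewrite mule_ge0// lee_fin prod_ge0.
rewrite (ge0_integral_insert ord0); last 2 first.
- apply: emeasurable_funM; last by apply/measurable_EFinP; exact: measurable_prodf.
  by apply: (measurableT_comp mG); exact: measurable_map_row.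
- by move=> x; rewrite mule_ge0// lee_fin prod_ge0.
have mI s (h : R -> R) : measurable_fun setT h ->
    measurable_fun setT (fun x => G (insert_coord (d := n.+1) ord0 s (h x))).
  move=> mh; apply: (measurableT_comp mG).
  exact: (measurableT_comp
    (measurable_fun_pair1 s (@measurable_insert_pair R n ord0)) mh).
have stepE (w h : R -> R) (s : 'rV[R]_n) (c : R) : measurable_fun setT w ->
    (forall x, (0 <= w x)%R) -> measurable_fun setT h -> (0 <= c)%R ->
    \int[@lebesgue_measure R]_x
      (G (insert_coord (d := n.+1) ord0 s (h x)) * (w x * c)%:E) =
    \int[@lebesgue_measure R]_x
      (G (insert_coord (d := n.+1) ord0 s (h x)) * (w x)%:E) * c%:E.
  move=> mw w0 mh c0; under eq_integral do rewrite EFinM muleA.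
  rewrite ge0_integralZr//.
  - by apply: emeasurable_funM; [exact: mI|exact/measurable_EFinP].
  - by move=> x _; rewrite mule_ge0// lee_fin.
(* The inner integral after the change of the first variable. The induction hypothesis is applied to
   it in the remaining variables. *)
pose K (s : 'rV[R]_n) := \int[@lebesgue_measure R]_x
  (G (insert_coord (d := n.+1) ord0 s (theta x)) * (w2 x)%:E).
have K0 s : 0 <= K s.
  by apply: integral_ge0 => x _; rewrite mule_ge0// lee_fin.
have mK : measurable_fun setT K.
  pose F (p : measurableTypeR R * 'rV[R]_n) :=
    G (insert_coord (d := n.+1) ord0 p.2 (theta p.1)) * (w2 p.1)%:E.
  apply: (@measurable_fun_fubini_tonelli_G _ _ _ _ _ (@lebesgue_measure R) F).
    apply: emeasurable_funM; last first.
      by apply/measurable_EFinP; apply: (measurableT_comp mw2); exact: measurable_fst.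
    apply: (measurableT_comp mG).
    apply: (measurableT_comp (@measurable_insert_pair R n ord0)
      (_ : measurable_fun setT (fun p : measurableTypeR R * 'rV[R]_n =>
        (theta p.1 : measurableTypeR R, p.2)))).
    apply: measurable_fun_pair; last exact: measurable_snd.
    by apply: (measurableT_comp mtheta); exact: measurable_fst.
  by move=> p; rewrite mule_ge0// lee_fin.
have prodE (w : R -> R) (s : 'rV[R]_n) x :
    (\prod_k w (insert_coord (d := n.+1) ord0 s x ord0 k) =
    w x * \prod_k w (s ord0 k))%R.
  rewrite big_ord_recl insert_coord_same; congr (_ * _)%R.
  by apply: eq_bigr => k _; rewrite insert_coord_lift.
transitivity (\int[lebesgue_rV n]_s (K s * (\prod_k w1 (s ord0 k))%:E)).
  apply: eq_integral => s _; under eq_integral do rewrite prodE.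
  rewrite (@stepE w1 id)//; last exact: prod_ge0.
  by rewrite (H1 (mI s id _)).
rewrite IH//; apply: eq_integral => s _.
under [RHS]eq_integral do rewrite prodE.
have rowE x : \row_i theta (insert_coord (d := n.+1) ord0 s x ord0 i) =
    insert_coord (d := n.+1) ord0 (\row_i theta (s ord0 i)) (theta x).
  apply/rowP => i; have [k ->|->] := unliftP ord0 i.
    by rewrite insert_coord_lift mxE insert_coord_lift mxE.
  by rewrite insert_coord_same mxE insert_coord_same.
under [RHS]eq_integral do rewrite rowE.
by rewrite (@stepE w2 theta)//; exact: prod_ge0.
Qed.

End product_change_of_variables.

Section cube.
Context {R : realType} {d : nat}.
Local Notation V := 'rV[R]_d.
Local Notation mu := (lebesgue_rV d).
Local Notation cube := (open_cube d : set V).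

Definition jacp : V -> R := prodf (fun=> jac).

Lemma open_cube_rect : cube = rect (fun=> `]0, 1[%classic).
Proof. by apply/seteqP; split=> t h i; have := h i; rewrite /= in_itv. Qed.

Lemma measurable_open_cube : measurable cube.
Proof. by rewrite open_cube_rect; apply: measurable_rect. Qed.

Lemma open_open_cube : open cube.
Proof.
rewrite openE => t ct.
apply: (@filter_forall V _ (fun i v => 0 < v 0 i < 1 : Prop) (nbhs t) (nbhs_filter t)) => i.
have oi : open (`]0, 1[%classic : set R) by exact: interval_open.
have ti : (`]0, 1[%classic : set R) (t 0 i) by rewrite /= in_itv/=; exact: ct.
have := open_nbhs_nbhs (conj oi ti).
move=> /(@coord_continuous R 1 d 0 i t) h.
apply: (@filterS _ (nbhs t) (nbhs_filter t) _ _ _ h) => v.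
by rewrite /= in_itv.
Qed.

Lemma jacp_gt0 x : 0 < jacp x.
Proof. by apply: prodr_gt0 => k _; exact: jac_gt0. Qed.

Lemma Psi_cotK t : cube t -> Psi_inv (Psi_cot t) = t.
Proof. by move=> ct; apply/rowP => i; rewrite !mxE phi_cotK. Qed.

Lemma Psi_inv_cube x : cube (Psi_inv x).
Proof. by move=> i; rewrite mxE psi_cot_itv. Qed.

(** The extension by 0 is what allows integrals over orthants that stick out of the cube. *)
Definition cube_pull (U : V -> R) : V -> R := (U \o Psi_cot) \_ cube.

Let Psi0 (t : V) : V := \row_i phi_cot0 (t 0 i).

Let Psi0E t : cube t -> Psi0 t = Psi_cot t.
Proof. by move=> ct; apply/rowP => i; rewrite !mxE phi_cot0E. Qed.

Let mPsi0 : measurable_fun setT Psi0.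
Proof. by apply: measurable_map_row; exact: measurable_phi_cot0. Qed.

Let indicE_prod (t : V) : \1_cube t = \prod_k \1_(`]0, 1[%classic) (t 0 k) :> R.
Proof.
rewrite indicE; have [ct|ct] := pselect (cube t).
  rewrite mem_set// big1// => k _; rewrite indicE mem_set//=.
  by rewrite in_itv; exact: ct.
rewrite memNset//; apply/esym/eqP; rewrite prodf_seq_eq0.
have /existsNP[k ck] := ct; apply/hasP; exists k; first by rewrite mem_index_enum.
by rewrite indicE memNset//= in_itv/=.
Qed.

Lemma measurable_cube_pull U : measurable_fun setT U -> measurable_fun setT (cube_pull U).
Proof.
move=> mU; rewrite (_ : cube_pull U = (U \o Psi0) \_ cube).
  apply: (iffLR (measurable_restrictT (U \o Psi0) measurable_open_cube)).
  by apply: measurable_funTS; exact: measurableT_comp.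
apply/funext => t; rewrite /cube_pull !patchE; case: ifPn => //.
by rewrite inE => ct; rewrite /= Psi0E.
Qed.

Lemma ge0_integral_cube_pull (U : V -> R) : measurable_fun setT U -> (forall x, 0 <= U x) ->
  (\int[mu]_t (cube_pull U t)%:E = \int[mu]_x (U x * jacp x)%:E)%E.
Proof.
move=> mU U0; under [RHS]eq_integral do rewrite EFinM.
rewrite (@ge0_integral_product_change _ _ (\1_(`]0, 1[%classic)) phi_cot0)//.
- apply: eq_integral => t _; rewrite -[in RHS]indicE_prod /cube_pull patchE indicE.
  case: ifPn => [|_]; last by rewrite mule0.
  by rewrite inE => ct; rewrite mule1 /= -Psi0E.
- by apply: continuous_measurable_fun; exact: elem1_continuous Elem1_jac.
- by move=> x; rewrite ltW// jac_gt0.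
- exact: measurable_phi_cot0.
- by move=> G mG G0; exact: ge0_integral_cot.
- exact/measurable_EFinP.
Qed.

Lemma measurable_jacp : measurable_fun setT jacp.
Proof.
apply: continuous_measurable_rV; apply: smooth_continuous.
by apply: smooth_prodf => k; exact: Elem1_jac.
Qed.

Lemma integral_cube_pull (U : V -> R) : measurable_fun setT U ->
  (\int[mu]_t (cube_pull U t)%:E = \int[mu]_x (U x * jacp x)%:E)%E.
Proof.
move=> mU; rewrite integralE [RHS]integralE.
have pE (F : V -> R) : (fun x => (F x)%:E)^\+%E = (fun x => (Num.max (F x) 0)%:E).
  by apply/funext => x; rewrite funeposE EFin_max.
have nE (F : V -> R) : (fun x => (F x)%:E)^\-%E = (fun x => (Num.max (- F x) 0)%:E).
  by apply/funext => x; rewrite funenegE -EFinN EFin_max.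
rewrite !pE !nE.
(* The condition k 0 = 0 accounts for the points outside of the cube, where the pull-back is 0. *)
have pullE (k : R -> R) : k 0 = 0 ->
    (fun x => (k (cube_pull U x))%:E) = (fun x => (cube_pull (k \o U) x)%:E).
  by move=> k0; apply/funext => x; rewrite /cube_pull !patchE; case: ifPn => // _; rewrite k0.
rewrite (pullE (Num.max ^~ 0) (maxxx _)).
rewrite (pullE (fun y => Num.max (- y) 0)); last by rewrite /= oppr0 maxxx.
have j0 x : 0 <= jacp x by rewrite ltW// jacp_gt0.
rewrite !ge0_integral_cube_pull; last 4 first.
- by apply: measurable_maxr => //; exact: measurableT_comp.
- by move=> x /=; rewrite le_max lexx orbT.
- exact: measurable_maxr.
- by move=> x /=; rewrite le_max lexx orbT.
by congr (_ - _)%E; apply: eq_integral => x _; rewrite maxr_pMl// ?mul0r// mulNr.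
Qed.

Lemma integrable_cube_pull (U : V -> R) : measurable_fun setT U ->
  mu.-integrable setT (fun x => (U x * jacp x)%:E) <->
  mu.-integrable setT (EFin \o cube_pull U).
Proof.
move=> mU.
have mUj : measurable_fun setT (fun x => U x * jacp x).
  by apply: measurable_funM => //; exact: measurable_jacp.
have E : (\int[mu]_x `|(cube_pull U x)%:E| = \int[mu]_x `|(U x * jacp x)%:E|)%E.
  have -> : (fun x => `|(cube_pull U x)%:E|)%E = (fun x => (cube_pull (Num.norm \o U) x)%:E).
    by apply/funext => x; rewrite /cube_pull !patchE; case: ifPn => // _; rewrite /= normr0.
  rewrite integral_cube_pull; last exact: measurableT_comp.
  by apply: eq_integral => x _ /=; rewrite normrM (ger0_norm (ltW (jacp_gt0 _))).
split=> /integrableP[_ h]; apply/integrableP; split.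
- by apply/measurable_EFinP; exact: measurable_cube_pull.
- by rewrite /= E.
- exact/measurable_EFinP.
- by rewrite -E.
Qed.

Lemma Rintegral_cube_pull (U : V -> R) : measurable_fun setT U ->
  \int[mu]_t cube_pull U t = \int[mu]_x (U x * jacp x).
Proof. by move=> mU; rewrite /Rintegral integral_cube_pull. Qed.

End cube.

Section dominated_convergence.
Context d (T : measurableType d) (R : realType) (mu : {measure set T -> \bar R}).

Lemma Rintegral_dominated_cvg (f_ : nat -> T -> R) (f g : T -> R) :
  (forall n, measurable_fun setT (f_ n)) -> measurable_fun setT f ->
  mu.-integrable setT (EFin \o g) ->
  (forall n x, `|f_ n x| <= g x) -> (forall x, f_ n x @[n --> \oo] --> f x) ->
  mu.-integrable setT (EFin \o f) /\
  \int[mu]_x f_ n x @[n --> \oo] --> \int[mu]_x f x.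
Proof.
move=> mf_ mf ig le_g cvf.
have [] := @dominated_convergence _ _ _ mu setT measurableT
  (fun n => EFin \o f_ n) (EFin \o f) (EFin \o g) _ _ _ ig _.
- by move=> n; exact/measurable_EFinP.
- exact/measurable_EFinP.
- apply/aeW => x _; apply: cvg_EFin; [exact: nearW|exact: cvf].
- by apply/aeW => x n _ /=; rewrite lee_fin.
move=> if_ _ cv; split=> //.
apply: fine_cvg; rewrite fineK ?integrable_fin_num//.
Qed.

End dominated_convergence.

Section test_functions.
Context {R : realType} {d : nat}.
Local Notation V := 'rV[R]_d.
Local Notation mu := (lebesgue_rV d).
Implicit Types (phi chi : V -> R) (a b : V).

Definition cbox a b : set V := [set x | forall i, `[a 0 i, b 0 i]%classic (x 0 i)].

Lemma compact_cbox a b : compact (cbox a b).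
Proof.
by apply: (rV_compact (A := fun i => `[a 0 i, b 0 i]%classic)) => i; exact: segment_compact.
Qed.

Lemma test_function_cbox (U : set V) a b chi : smooth chi ->
  (forall x, chi x != 0 -> cbox a b x) -> cbox a b `<=` U -> test_function U chi.
Proof.
move=> sc chi0 abU.
have sub : closure [set x | chi x != 0] `<=` cbox a b.
  have cl : closed (cbox a b) by apply: compact_closed; [exact: norm_hausdorff|exact: compact_cbox].
  by have := iffLR (closure_id (cbox a b)) cl => ->; exact: closureS.
split=> //; last exact: subset_trans abU.
by apply: subclosed_compact sub; [exact: closed_closure|exact: compact_cbox].
Qed.

Lemma continuous_bounded_cbox a b phi : continuous phi ->
  exists M, forall x, cbox a b x -> `|phi x| <= M.
Proof.
move=> cphi; have : bounded_set (phi @` cbox a b).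
  apply: compact_bounded; apply: continuous_compact; last exact: compact_cbox.
  exact: continuous_subspaceT.
case=> M [_ HM]; exists (M + 1) => x abx.
by apply: (HM (M + 1)); [rewrite ltrDl|exists x].
Qed.

(** [phi] is smooth across the boundary and the closed cube is compact. This bound takes the place
    of compact support in the open cube. *)
Lemma smooth_bounded_cube phi : smooth phi ->
  exists M, forall t, open_cube d t -> `|phi t| <= M.
Proof.
move=> /smooth_continuous/(continuous_bounded_cbox 0 (const_mx 1))[M HM].
exists M => t ct; apply: HM => i; rewrite !mxE/= in_itv/=.
by have /andP[/ltW -> /ltW ->] := ct i.
Qed.

End test_functions.

(** * Gaussian weights with polynomial factors *)

Section gaussian_weights.
Context {R : realType} {d : nat}.
Local Notation V := 'rV[R]_d.
Local Notation mu := (lebesgue_rV d).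
Implicit Types (q : 'I_d -> {poly R}) (p : {poly R}).

Lemma pow_gauss_bounded n : exists C : R, forall x : R,
  `|x| ^+ n * expR (- (x ^+ 2 / 2)) <= C.
Proof.
(* The summand 1 covers |x| <= 1. For |x| > 1 the power |x|^n is at most |x|^(2(n+1)), which
   exp(x^2/2) dominates through its Taylor term of order n+1. *)
exists (1 + 2 ^+ n.+1 * n.+1`!%:R) => x.
have y0 : 0 <= x ^+ 2 / 2 by rewrite divr_ge0// sqr_ge0.
have H := expR_ge1Dxn n y0.
have f0 : (0 : R) < n.+1`!%:R by rewrite ltr0n fact_gt0.
have p0 : (0 : R) < 2 ^+ n.+1 by rewrite exprn_gt0.
have E1 : `|x| ^+ (2 * n.+1) <= 2 ^+ n.+1 * n.+1`!%:R * expR (x ^+ 2 / 2).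
  have -> : `|x| ^+ (2 * n.+1) = 2 ^+ n.+1 * n.+1`!%:R * ((x ^+ 2 / 2) ^+ n.+1 / n.+1`!%:R).
    rewrite exprM real_normK ?num_real// expr_div_n; field.
    by rewrite !gt_eqF.
  rewrite ler_pM2l ?mulr_gt0//; apply: le_trans H.
  by rewrite lerDr.
rewrite expRN ler_pdivrMr ?expR_gt0// mulrDl mul1r.
have [x1|x1] := leP `|x| 1.
  apply: (@le_trans _ _ 1); first by rewrite exprn_ile1.
  rewrite -[leLHS]addr0 lerD//; first by apply: le_trans (expR_ge1Dx _); rewrite lerDl.
apply: (@le_trans _ _ (`|x| ^+ (2 * n.+1))).
  by rewrite ler_weXn2l ?ltW//; lia.
by rewrite (le_trans E1)// lerDr expR_ge0.
Qed.

Lemma poly_gauss_bounded p : exists C : R, forall x : R,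
  `|p.[x]| * expR (- (x ^+ 2 / 2)) <= C.
Proof.
have [C HC] := choice pow_gauss_bounded.
exists (\sum_(i < size p) `|p`_i| * C i) => x.
rewrite horner_coef; apply: (@le_trans _ _
  (\sum_(i < size p) (`|p`_i| * `|x| ^+ i) * expR (- (x ^+ 2 / 2)))).
  rewrite -mulr_suml ler_wpM2r ?expR_ge0//; apply: (le_trans (ler_norm_sum _ _ _)).
  by apply: ler_sum => i _; rewrite normrM normrX.
by apply: ler_sum => i _; rewrite -mulrA; apply: ler_wpM2l; [|exact: HC].
Qed.

Definition gauss_const : R := (2 * pi) `^ (- (d%:R / 2)).

Lemma gauss_const_gt0 : 0 < gauss_const.
Proof. by rewrite powR_gt0// mulr_gt0// pi_gt0. Qed.

Lemma gauss_densityE (x : V) :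
  gauss_density x = gauss_const * prodf (fun _ y => expR (- (y ^+ 2 / 2))) x.
Proof.
rewrite /gauss_density /prodf -expR_sum; congr (_ * expR _).
by rewrite mulr_suml -sumrN.
Qed.

Lemma gauss_density_gt0 (x : V) : 0 < gauss_density x.
Proof. by rewrite mulr_gt0 ?gauss_const_gt0 ?expR_gt0. Qed.

Definition wt q (x : V) : R := gauss_density x * \prod_k (q k).[x 0 k].

Lemma wtE q (x : V) : wt q x =
  gauss_const * prodf (fun k y => expR (- (y ^+ 2 / 2)) * (q k).[y]) x.
Proof. by rewrite /wt gauss_densityE -mulrA /prodf -big_split. Qed.

Lemma measurable_wt q : measurable_fun setT (wt q).
Proof.
rewrite (_ : wt q = fun x => gauss_const *
  prodf (fun k y => expR (- (y ^+ 2 / 2)) * (q k).[y]) x); last first.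
  by apply/funext => x; rewrite wtE.
apply: measurable_funM => //; apply: continuous_measurable_rV.
apply: smooth_continuous; apply: smooth_prodf => k.
by apply: Elem1_mul; [exact: Elem1_gauss|exact: elem1_horner].
Qed.

Lemma measurable_gauss_density : measurable_fun setT (@gauss_density R d).
Proof.
rewrite (_ : gauss_density = wt (fun=> 1)); first exact: measurable_wt.
apply/funext => x; rewrite /wt big1 ?mulr1// => k _; by rewrite hornerE.
Qed.

Lemma jac_le1 (x : R) : jac x <= 1.
Proof.
rewrite /jac invf_le1 ?mulr_gt0 ?pi_gt0 ?sqrD1_gt0//.
apply: (@le_trans _ _ (1 * 1)); first by rewrite mulr1.
apply: ler_pM => //; last by rewrite lerDl sqr_ge0.
by have := pi_ge2 R; lra.
Qed.

(** One of the two factors rho in the square absorbs the polynomials, the other remains as the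
    weight of the Gaussian norm. The factor [jacp], from dt = [jacp] dx, has all its one-dimensional
    factors at most 1. *)
Lemma wt_sqr_bounded q : exists2 C : R, 0 <= C &
  forall x, wt q x ^+ 2 * jacp x <= C * gauss_density x.
Proof.
have HC k : exists C : R, forall x : R, `|(q k ^+ 2).[x]| * expR (- (x ^+ 2 / 2)) <= C.
  exact: poly_gauss_bounded.
have [C {}HC] := choice HC.
have C0 k : 0 <= C k.
  by apply: le_trans (HC k 0); rewrite mulr_ge0 ?expR_ge0.
exists (gauss_const * \prod_k C k).
  by rewrite mulr_ge0 ?(ltW gauss_const_gt0)// prodr_ge0.
move=> x; pose e : R := \prod_k (`|(q k ^+ 2).[x 0 k]| * expR (- (x 0 k ^+ 2 / 2)) * jac (x 0 k)).
have -> : wt q x ^+ 2 * jacp x = gauss_density x * gauss_const * e.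
  rewrite /wt -mulrA; set g := gauss_density x; set P := \prod_k _.
  transitivity (g * (g * P ^+ 2 * jacp x)); first by ring.
  congr (_ * _); rewrite /g gauss_densityE -!mulrA; congr (_ * _).
  rewrite /P.
  rewrite /e /jacp /prodf -!big_split/=; apply: eq_bigr => k _.
  by rewrite horner_exp ger0_norm ?sqr_ge0//; ring.
rewrite -mulrA mulrC; apply: ler_wpM2r; first exact/ltW/gauss_density_gt0.
apply: ler_wpM2l; first exact/ltW/gauss_const_gt0.
apply: ler_prod => k _; rewrite mulr_ge0 ?mulr_ge0 ?expR_ge0 ?(ltW (jac_gt0 _))//=.
rewrite -[leRHS]mulr1 ler_pM ?mulr_ge0 ?expR_ge0 ?(ltW (jac_gt0 _))//.
exact: jac_le1.
Qed.

End gaussian_weights.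

(** * Integration by parts on the cube *)

Section weighted_pull_back.
Context {R : realType} {d : nat}.
Local Notation V := 'rV[R]_d.
Local Notation mu := (lebesgue_rV d).
Local Notation cube := (@open_cube R d).
Implicit Types (u : V -> R) (q : 'I_d -> {poly R}).

Lemma cube_pullE u t : cube t -> cube_pull u t = u (Psi_cot t).
Proof. by move=> ct; rewrite /cube_pull patchT// inE. Qed.

Lemma cube_pull_out u t : ~ cube t -> cube_pull u t = 0.
Proof. by move=> ct; rewrite /cube_pull patchC// inE. Qed.

Lemma lebesgue_open_cube : mu cube = 1%E.
Proof.
rewrite open_cube_rect lebesgue_rV_box; last by move=> i; exact: measurable_itv.
rewrite big1// => i _; rewrite lebesgue_measure_itv/= lte_fin ltr01.
by rewrite -EFinB subr0.
Qed.

(** On the cube, which has measure 1, |v| <= 1 + v^2. *)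
Lemma integrable_of_sqr (v : V -> R) : measurable_fun setT v ->
  (forall t, ~ cube t -> v t = 0) -> (\int[mu]_t (v t ^+ 2)%:E < +oo)%E ->
  mu.-integrable setT (EFin \o v).
Proof.
move=> mv v0 v2; apply/integrableP; split; first exact/measurable_EFinP.
have m2 : measurable_fun setT (fun t => (v t ^+ 2)%:E).
  by apply/measurable_EFinP; exact: measurable_funX.
have mc : measurable_fun setT (fun t => (\1_cube t)%:E : \bar R).
  by apply/measurable_EFinP; apply: measurable_indic; exact: measurable_open_cube.
have c1 : (\int[mu]_t (\1_cube t)%:E = 1)%E.
  rewrite integral_indic; [|exact: measurableT|exact: measurable_open_cube].
  by rewrite setIT; exact: lebesgue_open_cube.
apply: (@le_lt_trans _ _ (\int[mu]_t ((\1_cube t)%:E + (v t ^+ 2)%:E))%E).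
  apply: ge0_le_integral => //.
  - by apply: measurableT_comp => //; exact/measurable_EFinP.
  - by apply: emeasurable_funD.
  - move=> t _; rewrite /= lee_fin indicE; have [ct|ct] := pselect (cube t).
      rewrite mem_set// -[X in _ <= _ + X]real_normK ?num_real//.
      rewrite mulr1n; have := normr_ge0 (v t); set z := `|v t|; nra.
    by rewrite v0// normr0 addr_ge0// sqr_ge0.
rewrite ge0_integralD//; last by move=> t _; rewrite lee_fin sqr_ge0.
by rewrite c1 lte_add_pinfty// ltry.
Qed.

(** The constant is fixed before [u]; the independence of f in (i) starts here. *)
Lemma cube_pull_wt_sqr q : exists2 C : R, 0 <= C & forall u, measurable_fun setT u ->
  (\int[mu]_t (cube_pull (fun x => u x * wt q x) t ^+ 2)%:E <=
   C%:E * \int[mu]_x (u x ^+ 2 * gauss_density x)%:E)%E.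
Proof.
have [C C0 HC] := wt_sqr_bounded q; exists C => // u mu_.
have muw : measurable_fun setT (fun x => u x * wt q x).
  by apply: measurable_funM => //; exact: measurable_wt.
have -> : (fun t => (cube_pull (fun x => u x * wt q x) t ^+ 2)%:E) =
    (fun t => (cube_pull (fun x => (u x * wt q x) ^+ 2) t)%:E).
  apply/funext => t; have [ct|ct] := pselect (cube t).
    by rewrite !cube_pullE.
  by rewrite !cube_pull_out// expr0n.
have m2 : measurable_fun setT (fun x => (u x * wt q x) ^+ 2).
  exact: measurable_funX.
rewrite ge0_integral_cube_pull//; last by move=> x; rewrite sqr_ge0.
have mg : measurable_fun setT (fun x => u x ^+ 2 * gauss_density x).
  by apply: measurable_funM; [exact: measurable_funX|exact: measurable_gauss_density].
have g0 x : 0 <= u x ^+ 2 * gauss_density x.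
  by rewrite mulr_ge0 ?sqr_ge0// ltW// gauss_density_gt0.
rewrite -ge0_integralZl//.
- apply: ge0_le_integral => //.
  + by move=> x _; rewrite lee_fin mulr_ge0 ?sqr_ge0// ltW// jacp_gt0.
  + apply/measurable_EFinP; apply: measurable_funM => //; exact: measurable_jacp.
  + by apply/measurable_EFinP; exact: measurable_funM.
  + move=> x _; rewrite -EFinM lee_fin exprMn -mulrA [leRHS]mulrCA.
    by apply: ler_wpM2l; [exact: sqr_ge0|exact: HC].
- exact/measurable_EFinP.
- by move=> x _; rewrite lee_fin.
Qed.

Definition gauss_L2 u :=
  measurable_fun setT u /\ (\int[mu]_x (u x ^+ 2 * gauss_density x)%:E < +oo)%E.

Lemma gauss_L2_integrable q u : gauss_L2 u ->
  mu.-integrable setT (EFin \o cube_pull (fun x => u x * wt q x)).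
Proof.
move=> [mu_ u2]; apply: integrable_of_sqr.
- apply: measurable_cube_pull; apply: measurable_funM => //; exact: measurable_wt.
- by move=> t; exact: cube_pull_out.
- have [C C0 HC] := cube_pull_wt_sqr q.
  apply: le_lt_trans (HC u mu_) _; rewrite lte_mul_pinfty ?lee_fin//.
Qed.

Lemma gauss_L2_integrable_jacp q u : gauss_L2 u ->
  mu.-integrable setT (fun x => (u x * wt q x * jacp x)%:E).
Proof.
move=> gu; have [mu_ _] := gu.
have H := gauss_L2_integrable q gu; apply/integrable_cube_pull => //.
by apply: measurable_funM => //; exact: measurable_wt.
Qed.

End weighted_pull_back.

Section one_step.
Context {R : realType} {d : nat}.
Local Notation V := 'rV[R]_d.
Local Notation mu := (lebesgue_rV d).
Local Notation cube := (@open_cube R d).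
Implicit Types (u v : V -> R) (q : 'I_d -> {poly R}) (l : 'I_d).

Definition setq q l (p : {poly R}) : 'I_d -> {poly R} :=
  fun k => if k == l then p else q k.

(* The polynomial whose value at [phi_cot t] is the derivative of [phi_cot] at [t]. *)
Definition poly_jacV : {poly R} := pi *: (1 + 'X^2).

Lemma poly_jacVE (y : R) : poly_jacV.[y] * jac y = 1.
Proof.
rewrite /poly_jacV hornerZ hornerD hornerC hornerXn /jac divff// mulf_neq0//.
  by rewrite gt_eqF ?pi_gt0.
by rewrite gt_eqF ?sqrD1_gt0.
Qed.

(** By the chain rule, d/dt_l is [poly_jacV] times d/dx_l. [q_shift] is the weight when this
    derivative falls on D^j f, [q_deriv] when it falls on rho times q_l, because (exp(-x^2/2) q)' =
    exp(-x^2/2) (q' - x q). *)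
Definition q_shift q l := setq q l (poly_jacV * q l).
Definition q_deriv q l := setq q l (poly_jacV * ((q l)^`() - 'X * q l)).

(** It is supported in [-m, m] and tends to 1 pointwise, which suffices for dominated convergence
    although it equals 1 nowhere. The profile is shifted and not rescaled as m grows, so its
    derivative is bounded uniformly in m and tends to 0. *)
Let cutoff (m : nat) (y : R) : R := ebump 0 (1 * y + m%:R) * ebump 0 (-1 * y + m%:R).

Let cutoff' (m : nat) (y : R) : R :=
  ebump 2 (1 * y + m%:R) * ebump 0 (-1 * y + m%:R) -
  ebump 0 (1 * y + m%:R) * ebump 2 (-1 * y + m%:R).

Let elem1_cutoff m : elem1 (cutoff m).
Proof. by apply: Elem1_mul; exact: Elem1_ebump. Qed.

Let is_derive_cutoff m (y : R) : is_derive y 1 (cutoff m) (cutoff' m y).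
Proof.
have H1 := is_derive_ebump_affine 0 1 m%:R y.
have H2 := is_derive_ebump_affine 0 (-1) m%:R y.
apply: is_derive_eq (is_deriveM H1 H2) _.
rewrite /cutoff' /GRing.scale/=; ring.
Qed.

Let cutoff_out m y : cutoff m y != 0 -> - m%:R <= y <= m%:R.
Proof.
apply: contraNT; rewrite negb_and -!ltNge /cutoff => /orP[h|h].
  by rewrite ebump_le0 ?mul0r// mul1r; lra.
by rewrite [X in _ * X]ebump_le0 ?mulr0// mulN1r; lra.
Qed.

(** From z^2 / 2! <= exp z at z = 1/y. *)
Let ebump2_le y : ebump 2 y <= 2 :> R.
Proof.
rewrite /ebump; case: ifPn => // y0.
have z0 : 0 <= y^-1 by rewrite invr_ge0 ltW.
rewrite expRN ler_pdivrMr ?expR_gt0//.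
have := expR_ge1Dxn 1 z0; rewrite (_ : 2`! = 2)%N//; set e := expR _; set z := y^-1 ^+ 2; lra.
Qed.

Let cutoff_ge0 m y : 0 <= cutoff m y.
Proof. by rewrite mulr_ge0 ?ebump_ge0. Qed.

Let cutoff_le1 m y : cutoff m y <= 1.
Proof. by rewrite -[leRHS]mulr1 ler_pM ?ebump_ge0 ?ebump0_le1. Qed.

Let cutoff'_le m y : `|cutoff' m y| <= 4.
Proof.
have H (a b : R) : 0 <= ebump 2 a * ebump 0 b <= 2.
  rewrite mulr_ge0 ?ebump_ge0//= -[leRHS]mulr1 ler_pM ?ebump_ge0 ?ebump2_le ?ebump0_le1//.
rewrite /cutoff' [ebump 0 (1 * y + m%:R) * _]mulrC ler_norml.
have /andP[] := H (1 * y + m%:R) (-1 * y + m%:R).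
have /andP[] := H (-1 * y + m%:R) (1 * y + m%:R).
set A := ebump 2 _ * _; set B := ebump 2 _ * _ => B0 B2 A0 A2.
by apply/andP; split; lra.
Qed.

Let cvg_cutoff y : cutoff m y @[m --> \oo] --> (1 : R).
Proof.
rewrite -[X in _ --> X]mulr1; apply: cvgM.
  by apply: (@cvg_ebump _ 0); exact: cvg_addn.
by apply: (@cvg_ebump _ 0); exact: cvg_addn.
Qed.

Let cvg_cutoff' y : cutoff' m y @[m --> \oo] --> (0 : R).
Proof.
have H n a : ebump n (a * y + m%:R) @[m --> \oo] --> ((n == 0%N)%:R : R).
  by apply: cvg_ebump; exact: cvg_addn.
have -> : (0 : R) = 0 * 1 - 1 * 0 by rewrite mulr0 mul0r subrr.
by apply: cvgB; apply: cvgM; exact: (H 2%N) || exact: (H 0%N).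
Qed.

Let gq q k (y : R) : R := expR (- (y ^+ 2 / 2)) * (q k).[y].

Let gq' q k (y : R) : R := expR (- (y ^+ 2 / 2)) * ((q k)^`() - 'X * q k).[y].

Let elem1_gq q k : elem1 (gq q k).
Proof. by apply: Elem1_mul; [exact: Elem1_gauss|exact: elem1_horner]. Qed.

Let is_derive_gq q k (y : R) : is_derive y 1 (gq q k) (gq' q k y).
Proof.
apply: is_derive_eq (is_deriveM (is_derive_gauss1 y) (is_derive_poly (q k) y)) _.
rewrite /gq' /GRing.scale/= hornerD hornerN hornerM hornerX; ring.
Qed.

(** The Jacobian is taken without its factor in direction [l], since differentiating the pull-back
    of phi in x_l supplies that factor; in the weights [q_shift] and [q_deriv] it is cancelled by
    [poly_jacV]. *)
Let jac_but l k : R -> R := if k == l then fun=> 1 else jac.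

Let elem1_jac_but l k : elem1 (jac_but l k).
Proof. by rewrite /jac_but; case: ifP => _; [exact: Elem1_cst|exact: Elem1_jac]. Qed.

(* The test function on R^d that produces [phi] on the cube, cut off at [m]. *)
Let chi q l m (phi : V -> R) (x : V) : R :=
  prodf (fun k y => gq q k y * jac_but l k y * cutoff m y) x * phi (Psi_inv x).

Let Am m (x : V) : R := prodf (fun=> cutoff m) x.

Let Fm l m (x : V) : R := prodf (fun k => if k == l then cutoff' m else cutoff m) x.

Let chi_smooth q l m phi : smooth phi -> smooth (chi q l m phi).
Proof.
move=> sphi; apply: (elem_smooth sphi); apply: Elem_mul.
  apply: Elem_prodf => k; apply: Elem1_mul => //.
  by apply: Elem1_mul.
exact: (Elem_pull _ [::]).
Qed.

Let chi_test q l m phi : smooth phi -> test_function setT (chi q l m phi).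
Proof.
move=> sphi; apply: (@test_function_cbox _ _ _ (const_mx (- m%:R)) (const_mx m%:R)).
- exact: chi_smooth.
- move=> x; rewrite /chi /prodf mulf_eq0 negb_or => /andP[+ _] i.
  rewrite prodf_seq_neq0 => /allP/(_ i (mem_index_enum _))/=.
  rewrite !mxE in_itv/= mulf_eq0 negb_or => /andP[_]; exact: cutoff_out.
- by [].
Qed.

Let wt_shiftE q l x : wt (q_shift q l) x * jacp x =
  (@gauss_const R d) * prodf (fun k y => gq q k y * jac_but l k y) x.
Proof.
rewrite wtE -mulrA; congr (_ * _); rewrite /jacp /prodf -big_split; apply: eq_bigr => k _ /=.
rewrite /q_shift /setq /jac_but /gq; case: eqVneq => [->|//].
by rewrite hornerM /= -[X in _ = _ * X](poly_jacVE (x 0 l)); ring.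
Qed.

Let wt_derivE q l x : wt (q_deriv q l) x * jacp x =
  (@gauss_const R d) * prodf (fun k y => (if k == l then gq' q k y else gq q k y) * jac_but l k y) x.
Proof.
rewrite wtE -mulrA; congr (_ * _); rewrite /jacp /prodf -big_split; apply: eq_bigr => k _ /=.
rewrite /q_deriv /setq /jac_but /gq /gq'; case: eqVneq => [->|//].
by rewrite hornerM /= -[X in _ = _ * X](poly_jacVE (x 0 l)); ring.
Qed.

Let wt_plainE q l x : wt q x * jacp x =
  (@gauss_const R d) * prodf (fun k y => gq q k y * jac_but l k y) x * jac (x 0 l).
Proof.
rewrite wtE -!mulrA; congr (_ * _); rewrite /jacp /prodf -big_split/=.
rewrite (bigD1 l)//= [in RHS](bigD1 l)//= /jac_but eqxx mulr1 mulrAC; congr (_ * _ * _).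
by apply: eq_bigr => k /negbTE ->.
Qed.

(** In the product rule the derivative falls on phi, on the Gaussian weight or on the cut-off. Only
    the last term carries [Fm], which tends to 0. *)
Let partial_chi q l m phi x : smooth phi ->
  (@gauss_const R d) * partial l (chi q l m phi) x =
  wt q x * jacp x * (Am m x * partial l phi (Psi_inv x)) +
  wt (q_deriv q l) x * jacp x * (Am m x * phi (Psi_inv x)) +
  wt (q_shift q l) x * jacp x * (Fm l m x * phi (Psi_inv x)).
Proof.
move=> sphi; pose h k (y : R) : R := gq q k y * jac_but l k y * cutoff m y.
have eh k : elem1 (h k) by apply: Elem1_mul => //; exact: Elem1_mul.
have dh : differentiable (prodf h) x.
  by apply: differentiable_prodf => k; exact: elem1_derivable.
have dphi : differentiable phi (Psi_inv x) by exact: smooth_differentiable.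
have dphiP : differentiable (phi \o Psi_inv) x.
  by apply: differentiable_comp => //; exact: differentiable_Psi_inv.
have -> : partial l (chi q l m phi) x =
  prodf h x * (partial l phi (Psi_inv x) * jac (x 0 l)) +
  phi (Psi_inv x) * prodf (fun k => if k == l then derive1 (h k) else h k) x.
  have := partialM l dh dphiP; rewrite partial_Psi_inv//= partial_prodf//.
  exact: elem1_derivable.
have dhE y : derive1 (h l) y = gq' q l y * cutoff m y + gq q l y * cutoff' m y.
  rewrite derive1E.
  have -> : h l = gq q l * cutoff m.
    by apply/funext => z; rewrite /h /jac_but eqxx mulr1.
  have [_ ->] := is_deriveM (is_derive_gq q l y) (is_derive_cutoff m y).
  by rewrite /GRing.scale/=; ring.
rewrite (wt_plainE q l) wt_derivE wt_shiftE -!mulrA -!mulrDr; congr (_ * _).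
have hE : prodf h x = prodf (fun k y => gq q k y * jac_but l k y) x * Am m x.
  by rewrite /prodf /Am /prodf -big_split.
have h'E : prodf (fun k => if k == l then derive1 (h k) else h k) x =
  prodf (fun k y => (if k == l then gq' q k y else gq q k y) * jac_but l k y) x * Am m x +
  prodf (fun k y => gq q k y * jac_but l k y) x * Fm l m x.
  rewrite /Am /Fm /prodf -!big_split/=.
  rewrite (bigD1 l)//= [in RHS](bigD1 l)//= [X in _ = _ + X](bigD1 l)//= !eqxx.
  rewrite dhE /jac_but eqxx !mulr1.
  rewrite mulrDl; congr (_ * _ + _ * _); apply: eq_bigr => k /negbTE kl;
    by rewrite /h /jac_but kl.
by rewrite hE h'E; ring.
Qed.

Let prod_le1 (F : 'I_d -> R) : (forall k, 0 <= F k <= 1) -> 0 <= \prod_k F k <= 1.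
Proof.
move=> F01; elim/big_ind : _ => [|a b /andP[a0 a1] /andP[b0 b1]|k _]; last exact: F01.
  by rewrite ler01 lexx.
by rewrite mulr_ge0//= -[leRHS]mulr1 ler_pM.
Qed.

Let Am_le1 m (x : V) : `|Am m x| <= 1.
Proof.
have /andP[h0 h1] := @prod_le1 (fun k => cutoff m (x 0 k))
  (fun k => introT andP (conj (cutoff_ge0 m (x 0 k)) (cutoff_le1 m (x 0 k)))).
by rewrite ger0_norm.
Qed.

Let Fm_le4 l m (x : V) : `|Fm l m x| <= 4.
Proof.
rewrite /Fm /prodf (bigD1 l)//= eqxx /= normrM -[leRHS]mulr1 ler_pM//.
rewrite (eq_bigr (fun k => cutoff m (x 0 k))); last by move=> k /negbTE ->.
rewrite big_mkcond/=.
have H k : 0 <= (if k != l then cutoff m (x 0 k) else 1) <= 1.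
  by case: ifP => _; rewrite ?cutoff_ge0 ?cutoff_le1// ler01 lexx.
by have /andP[h0 h1] := prod_le1 H; rewrite ger0_norm.
Qed.

Let cvg_prod (F : nat -> 'I_d -> R) (f : 'I_d -> R) :
  (forall k, F m k @[m --> \oo] --> f k) ->
  \prod_k F m k @[m --> \oo] --> \prod_k f k.
Proof.
move=> Ff; elim: (index_enum _) => [|k s IH].
  under eq_fun do rewrite big_nil; rewrite big_nil; exact: cvg_cst.
under eq_fun do rewrite big_cons; rewrite big_cons; exact: cvgM.
Qed.

Let cvg_Am (x : V) : Am m x @[m --> \oo] --> (1 : R).
Proof.
have := @cvg_prod (fun m k => cutoff m (x 0 k)) (fun=> 1) (fun k => cvg_cutoff _).
by rewrite big1.
Qed.

Let cvg_Fm l (x : V) : Fm l m x @[m --> \oo] --> (0 : R).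
Proof.
have := @cvg_prod (fun m k => (if k == l then cutoff' m else cutoff m) (x 0 k))
  (fun k => if k == l then 0 else 1).
rewrite (bigD1 l (F := fun k => if k == l then 0 else 1))//= eqxx mul0r; apply => k.
by case: eqVneq => _; [exact: cvg_cutoff'|exact: cvg_cutoff].
Qed.

Let smooth_Am m : smooth (Am m).
Proof. by apply: smooth_prodf => k. Qed.

Let smooth_Fm l m : smooth (Fm l m).
Proof.
apply: smooth_prodf => k; case: eqVneq => // _.
rewrite (_ : cutoff' m = derive1 (cutoff m)); first by have [] := elem1_derive1 (elem1_cutoff m).
by apply/funext => y; rewrite derive1E; have [_ ->] := is_derive_cutoff m y.
Qed.

Lemma Rintegral_bounded_cvg (W : V -> R) (M : R) (b_ : nat -> V -> R) (b : V -> R) :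
  mu.-integrable setT (EFin \o W) ->
  (forall m, measurable_fun setT (b_ m)) -> measurable_fun setT b ->
  (forall m x, `|b_ m x| <= M) -> (forall x, b_ m x @[m --> \oo] --> b x) ->
  [/\ mu.-integrable setT (EFin \o (fun x => W x * b x)),
      (forall m, mu.-integrable setT (EFin \o (fun x => W x * b_ m x))) &
      \int[mu]_x (W x * b_ m x) @[m --> \oo] --> \int[mu]_x (W x * b x)].
Proof.
move=> iW mb_ mb bM cb.
have mW : measurable_fun setT W by apply/measurable_EFinP; exact: measurable_int iW.
have iM : mu.-integrable setT (EFin \o (fun x => `|W x| * M)).
  apply: (@eq_integrable _ _ _ mu setT measurableT (fun x => (M%:E * `|(W x)%:E|)%E)).
    by move=> x _ /=; rewrite mulrC EFinM.
  by apply: integrableZl => //; exact: integrable_abse.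
have [||||i_ c_] := @Rintegral_dominated_cvg _ _ _ mu (fun m x => W x * b_ m x)
  (fun x => W x * b x) (fun x => `|W x| * M) _ _ iM.
- by move=> m; exact: measurable_funM.
- exact: measurable_funM.
- by move=> m x; rewrite normrM ler_wpM2l.
- by move=> x; apply: cvgMr; exact: cb.
split=> // m; apply: le_integrable iM => //.
  by apply/measurable_EFinP; exact: measurable_funM.
move=> x _ /=; rewrite lee_fin normrM normrM normr_id ler_wpM2l// (le_trans (bM m x))//.
exact: ler_norm.
Qed.

Lemma cvg_seq_unique (f g : nat -> R) (a b : R) : f =1 g ->
  f m @[m --> \oo] --> a -> g m @[m --> \oo] --> b -> a = b.
Proof.
move=> /funext -> ca cb.
by rewrite -(cvg_lim (@norm_hausdorff _ _) ca) -(cvg_lim (@norm_hausdorff _ _) cb).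
Qed.

(** The hypothesis is applied to the test functions [chi q l m phi]. Each of the four integrands is
    a fixed integrable weight times a factor bounded uniformly in m, and the one with [Fm]
    disappears in the limit. *)
Lemma one_step_by_parts u u' q l phi : gauss_L2 u -> gauss_L2 u' ->
  (forall chi, test_function setT chi ->
    \int[mu]_x (u x * partial l chi x) = - \int[mu]_x (u' x * chi x)) ->
  smooth phi ->
  \int[mu]_t (cube_pull (fun x => u x * wt q x) t * partial l phi t) =
  - (\int[mu]_t (cube_pull (fun x => u x * wt (q_deriv q l) x) t * phi t) +
     \int[mu]_t (cube_pull (fun x => u' x * wt (q_shift q l) x) t * phi t)).
Proof.
move=> gu gu' ibp sphi.
have [M HM] := smooth_bounded_cube sphi.
have [M' HM'] := smooth_bounded_cube (smooth_partial l sphi).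
have spull (f : V -> R) : smooth f -> smooth (f \o Psi_inv).
  by move=> sf; apply: (elem_smooth sf); exact: (Elem_pull _ [::]).
have mcont (f : V -> R) : smooth f -> measurable_fun setT f.
  by move=> sf; apply: continuous_measurable_rV; exact: smooth_continuous.
have bnd (f F : V -> R) (A B : R) x : `|f x| <= A -> (forall t, cube t -> `|F t| <= B) ->
    `|f x * F (Psi_inv x)| <= A * B.
  by move=> fA FB; rewrite normrM ler_pM// FB//; exact: Psi_inv_cube.
have W1 := gauss_L2_integrable_jacp q gu.
have W2 := gauss_L2_integrable_jacp (q_deriv q l) gu.
have W3 := gauss_L2_integrable_jacp (q_shift q l) gu.
have W4 := gauss_L2_integrable_jacp (q_shift q l) gu'.
have mcst (c : R) : measurable_fun setT (fun _ : V => c) by exact: measurable_cst.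
have mphi := mcont _ (spull _ sphi).
have mphi' := mcont _ (spull _ (smooth_partial l sphi)).
have cv (f : nat -> V -> R) (c : R) (F : V -> R) x : f m x @[m --> \oo] --> c ->
    f m x * F (Psi_inv x) @[m --> \oo] --> c * F (Psi_inv x).
  by move=> fc; apply: cvgMl.
have [i1 i1_ c1] := @Rintegral_bounded_cvg _ (1 * M')
  (fun m x => Am m x * partial l phi (Psi_inv x)) (fun x => 1 * partial l phi (Psi_inv x)) W1
  (fun m => measurable_funM (mcont _ (smooth_Am m)) mphi')
  (measurable_funM (mcst 1) mphi')
  (fun m x => bnd _ _ _ _ x (Am_le1 m x) HM') (fun x => cv _ _ _ x (cvg_Am x)).
have [i2 i2_ c2] := @Rintegral_bounded_cvg _ (1 * M)
  (fun m x => Am m x * phi (Psi_inv x)) (fun x => 1 * phi (Psi_inv x)) W2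
  (fun m => measurable_funM (mcont _ (smooth_Am m)) mphi)
  (measurable_funM (mcst 1) mphi)
  (fun m x => bnd _ _ _ _ x (Am_le1 m x) HM) (fun x => cv _ _ _ x (cvg_Am x)).
have [i3 i3_ c3] := @Rintegral_bounded_cvg _ (4 * M)
  (fun m x => Fm l m x * phi (Psi_inv x)) (fun x => 0 * phi (Psi_inv x)) W3
  (fun m => measurable_funM (mcont _ (smooth_Fm l m)) mphi)
  (measurable_funM (mcst 0) mphi)
  (fun m x => bnd _ _ _ _ x (Fm_le4 l m x) HM) (fun x => cv _ _ _ x (cvg_Fm l x)).
have [i4 i4_ c4] := @Rintegral_bounded_cvg _ (1 * M)
  (fun m x => Am m x * phi (Psi_inv x)) (fun x => 1 * phi (Psi_inv x)) W4
  (fun m => measurable_funM (mcont _ (smooth_Am m)) mphi)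
  (measurable_funM (mcst 1) mphi)
  (fun m x => bnd _ _ _ _ x (Am_le1 m x) HM) (fun x => cv _ _ _ x (cvg_Am x)).
have gc0 : (@gauss_const R d) != 0 by rewrite gt_eqF// gauss_const_gt0.
have step m :
  \int[mu]_x (u x * wt q x * jacp x * (Am m x * partial l phi (Psi_inv x))) +
  \int[mu]_x (u x * wt (q_deriv q l) x * jacp x * (Am m x * phi (Psi_inv x))) +
  \int[mu]_x (u x * wt (q_shift q l) x * jacp x * (Fm l m x * phi (Psi_inv x))) =
  - \int[mu]_x (u' x * wt (q_shift q l) x * jacp x * (Am m x * phi (Psi_inv x))).
  have := ibp _ (chi_test q l m sphi).
  (* [chi] is built without the normalising constant of rho, which the weights [wt] contain. *)
  move=> /(congr1 (fun z => (@gauss_const R d) * z)); rewrite mulrN.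
  have iD := integrableD measurableT (i1_ m) (i2_ m).
  have iDD := integrableD measurableT iD (i3_ m).
  rewrite -!RintegralD//.
  set S := \int[mu]_x (_ + _ + _).
  have -> : \int[mu]_x (u x * partial l (chi q l m phi) x) = (@gauss_const R d)^-1 * S.
    rewrite /S -RintegralZl//; apply: eq_Rintegral => x _.
    apply: (mulfI gc0); rewrite mulVKf// mulrCA partial_chi//; ring.
  rewrite mulVKf// => ->; congr (- _).
  have -> : \int[mu]_x (u' x * chi q l m phi x) = (@gauss_const R d)^-1 *
      \int[mu]_x (u' x * wt (q_shift q l) x * jacp x * (Am m x * phi (Psi_inv x))).
    rewrite -RintegralZl//; apply: eq_Rintegral => x _.
    apply: (mulfI gc0); rewrite mulVKf//.
    rewrite -[u' x * _ * _]mulrA wt_shiftE /chi.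
    have -> : prodf (fun k y => gq q k y * jac_but l k y * cutoff m y) x =
      prodf (fun k y => gq q k y * jac_but l k y) x * Am m x.
      by rewrite /prodf /Am /prodf -big_split.
    ring.
  by rewrite mulVKf.
have L : \int[mu]_x (u x * wt q x * jacp x * (1 * partial l phi (Psi_inv x))) +
  \int[mu]_x (u x * wt (q_deriv q l) x * jacp x * (1 * phi (Psi_inv x))) +
  \int[mu]_x (u x * wt (q_shift q l) x * jacp x * (0 * phi (Psi_inv x))) =
  - \int[mu]_x (u' x * wt (q_shift q l) x * jacp x * (1 * phi (Psi_inv x))).
  apply: (cvg_seq_unique _ (cvgD (cvgD c1 c2) c3) (cvgN c4)).
  by move=> m; rewrite /= step.
have pullE (v f : V -> R) (p : 'I_d -> {poly R}) : measurable_fun setT v -> smooth f ->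
    \int[mu]_t (cube_pull (fun x => v x * wt p x) t * f t) =
    \int[mu]_x (v x * wt p x * jacp x * (1 * f (Psi_inv x))).
  move=> mv sf.
  have := @Rintegral_cube_pull R d (fun x => v x * wt p x * f (Psi_inv x)).
  rewrite (_ : cube_pull _ = fun t => cube_pull (fun x => v x * wt p x) t * f t).
    move=> -> ; first by apply: eq_Rintegral => x _; ring.
    apply: measurable_funM; last exact: mcont _ (spull _ sf).
    by apply: measurable_funM => //; exact: measurable_wt.
  apply/funext => t; have [ct|ct] := pselect (cube t).
    by rewrite !cube_pullE// Psi_cotK.
  by rewrite !cube_pull_out// mul0r.
have [mu_ _] := gu; have [mu'_ _] := gu'.
move: L; rewrite !pullE//; last exact: smooth_partial.
rewrite (_ : \int[mu]_x (u x * wt (q_shift q l) x * jacp x * (0 * phi (Psi_inv x))) = 0).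
  by rewrite addr0 => E; apply/eqP; rewrite -subr_eq0 opprK addrA E addNr.
under eq_Rintegral do rewrite mul0r mulr0.
by rewrite Rintegral_cst// mul0r.
Qed.

End one_step.

(** * Formal derivatives of the transformed function *)

Section leibniz_terms.
Context {R : realType} {d : nat}.
Local Notation V := 'rV[R]_d.
Local Notation mu := (lebesgue_rV d).
Local Notation cube := (@open_cube R d).

(* The pair [(j, q)] stands for the function [D^j f * rho * prod_k q_k(x_k)];
   one derivative in [t_l] turns it into the two terms of [dterm l (j, q)]. *)
Definition term : Type := ('I_d -> nat) * ('I_d -> {poly R}).

Definition dterm (l : 'I_d) (T : term) : seq term :=
  [:: (T.1, q_deriv T.2 l); (incr_multi T.1 l, q_shift T.2 l)].

Definition dterms (l : 'I_d) (L : seq term) : seq term := flatten (map (dterm l) L).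

(** A left fold, because integration by parts first moves the outermost derivative of
    [foldr partial phi s], which is the head of [s]. *)
Definition dterms_word (s : seq 'I_d) (L : seq term) : seq term :=
  foldl (fun L l => dterms l L) L s.

(** This stands for g itself: the factor phi'(t_k) is the value of [poly_jacV] at phi(t_k). *)
Definition term0 : term := (fun=> 0%N, fun=> poly_jacV).

Fixpoint order_le (b : 'I_d -> nat) (L : seq term) : Prop :=
  if L is T :: L' then (forall i, T.1 i <= b i)%N /\ order_le b L' else True.

Lemma order_le_trans b c L : (forall i, b i <= c i)%N -> order_le b L -> order_le c L.
Proof.
by move=> bc; elim: L => //= T L IH [h /IH ?]; split=> // i; exact: leq_trans (h i) (bc i).
Qed.

Lemma order_le_dterms l b L : order_le b L -> order_le (incr_multi b l) (dterms l L).
Proof.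
elim: L => //= T L IH [h /IH ?]; split; last split => //.
  by move=> i; rewrite (leq_trans (h i))// leq_addr.
by move=> i; rewrite leq_add2r.
Qed.

Lemma order_le_dterms_word s b L : order_le b L ->
  order_le (fun i => b i + count_mem i s)%N (dterms_word s L).
Proof.
elim: s b L => [|l s IH] b L bL /=.
  by apply: order_le_trans bL => i; rewrite addn0.
apply: order_le_trans (IH _ _ (order_le_dterms l bL)) => i.
by rewrite /incr_multi -addnA leq_add2l leq_add2r eq_sym.
Qed.

Variable U : ('I_d -> nat) -> V -> R.

Definition term_val (T : term) (x : V) : R := U T.1 x * wt T.2 x.

Definition terms_val (L : seq term) (x : V) : R := \sum_(T <- L) term_val T x.

Definition terms_pull (L : seq term) : V -> R := cube_pull (terms_val L).

Lemma terms_pull_nil t : terms_pull [::] t = 0.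
Proof.
have [ct|ct] := pselect (cube t).
  by rewrite /terms_pull cube_pullE// /terms_val big_nil.
by rewrite /terms_pull cube_pull_out.
Qed.

Lemma terms_pull_cons T L t :
  terms_pull (T :: L) t = cube_pull (term_val T) t + terms_pull L t.
Proof.
have [ct|ct] := pselect (cube t).
  by rewrite /terms_pull !cube_pullE// /terms_val big_cons.
by rewrite /terms_pull !cube_pull_out// addr0.
Qed.

Lemma terms_pull_out L t : ~ cube t -> terms_pull L t = 0.
Proof. exact: cube_pull_out. Qed.

Lemma integrable_mul_smooth (W phi : V -> R) : (forall t, ~ cube t -> W t = 0) ->
  mu.-integrable setT (EFin \o W) -> smooth phi ->
  mu.-integrable setT (EFin \o (fun t => W t * phi t)).
Proof.
move=> W0 iW sphi; have [M HM] := smooth_bounded_cube sphi.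
have mW : measurable_fun setT W by apply/measurable_EFinP; exact: measurable_int iW.
have iM : mu.-integrable setT (EFin \o (fun x => `|W x| * M)).
  apply: (@eq_integrable _ _ _ mu setT measurableT (fun x => (M%:E * `|(W x)%:E|)%E)).
    by move=> x _ /=; rewrite mulrC EFinM.
  by apply: integrableZl => //; exact: integrable_abse.
apply: le_integrable iM => //.
  apply/measurable_EFinP; apply: measurable_funM => //.
  by apply: continuous_measurable_rV; exact: smooth_continuous.
move=> x _ /=; rewrite lee_fin !normrM normr_id.
have [cx|cx] := pselect (cube x); last by rewrite W0// normr0 !mul0r.
by rewrite ler_wpM2l// (le_trans (HM x cx))// ler_norm.
Qed.

Variable alpha : nat.
Hypothesis UL2 : forall j, (forall i, j i <= alpha)%N -> gauss_L2 (U j).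
Hypothesis Uibp : forall j l, (forall i, incr_multi j l i <= alpha)%N ->
  forall chi, test_function setT chi ->
  \int[mu]_x (U j x * partial l chi x) = - \int[mu]_x (U (incr_multi j l) x * chi x).

Lemma integrable_terms_pull L : order_le (fun=> alpha) L ->
  mu.-integrable setT (EFin \o terms_pull L).
Proof.
elim: L => [_|T L IH [hT /IH iL]].
  rewrite (_ : _ \o _ = cst 0%E); first exact: integrable0.
  by apply/funext => t; rewrite /= terms_pull_nil.
rewrite (_ : _ \o _ = (EFin \o cube_pull (term_val T)) \+ (EFin \o terms_pull L))%E.
  by apply: integrableD => //; exact: gauss_L2_integrable (UL2 hT).
by apply/funext => t; rewrite /= terms_pull_cons EFinD.
Qed.

Lemma terms_by_parts l b L phi : (forall i, incr_multi b l i <= alpha)%N ->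
  order_le b L -> smooth phi ->
  \int[mu]_t (terms_pull L t * partial l phi t) =
  - \int[mu]_t (terms_pull (dterms l L) t * phi t).
Proof.
move=> bl + sphi; have ba i : (b i <= alpha)%N.
  by rewrite (leq_trans _ (bl i))// leq_addr.
elim: L => [_|T L IH [hT bL]].
  under eq_Rintegral do rewrite terms_pull_nil mul0r.
  under [in RHS]eq_Rintegral do rewrite terms_pull_nil mul0r.
  by rewrite Rintegral_cst// mul0r oppr0.
have hl i : (incr_multi T.1 l i <= alpha)%N.
  by rewrite (leq_trans _ (bl i))// leq_add2r.
have ha i : (T.1 i <= alpha)%N by exact: leq_trans (hT i) (ba i).
have aL : order_le (fun=> alpha) L by exact: order_le_trans bL.
have adL : order_le (fun=> alpha) (dterms l L).
  by apply: order_le_trans (order_le_dterms l bL).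
have iT (T' : term) (psi : V -> R) : (forall i, T'.1 i <= alpha)%N -> smooth psi ->
    mu.-integrable setT (EFin \o (fun t => cube_pull (term_val T') t * psi t)).
  move=> hT' spsi; apply: integrable_mul_smooth => //; first exact: cube_pull_out.
  exact: gauss_L2_integrable (UL2 hT').
have iL L' (psi : V -> R) : order_le (fun=> alpha) L' -> smooth psi ->
    mu.-integrable setT (EFin \o (fun t => terms_pull L' t * psi t)).
  move=> hL spsi; apply: integrable_mul_smooth => //; first exact: terms_pull_out.
  exact: integrable_terms_pull.
have spl : smooth (partial l phi) by exact: smooth_partial.
under eq_Rintegral do rewrite terms_pull_cons mulrDl.
rewrite RintegralD//; [|exact: iT|exact: iL].
rewrite (IH bL).
have -> : \int[mu]_t (terms_pull (dterms l (T :: L)) t * phi t) =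
  \int[mu]_t (cube_pull (term_val (T.1, q_deriv T.2 l)) t * phi t) +
  (\int[mu]_t (cube_pull (term_val (incr_multi T.1 l, q_shift T.2 l)) t * phi t) +
   \int[mu]_t (terms_pull (dterms l L) t * phi t)).
  under eq_Rintegral do rewrite /= 2!terms_pull_cons 2!mulrDl.
  rewrite RintegralD//; first by rewrite RintegralD//; [exact: iT|exact: iL].
    exact: iT.
  exact: (integrableD measurableT (iT (incr_multi T.1 l, q_shift T.2 l) _ hl sphi) (iL _ _ adL sphi)).
rewrite (one_step_by_parts T.2 (UL2 ha) (UL2 hl) (Uibp hl) sphi).
by rewrite !opprD addrA.
Qed.

Lemma terms_word_by_parts s b L phi : (forall i, b i + count_mem i s <= alpha)%N ->
  order_le b L -> smooth phi ->
  \int[mu]_t (terms_pull L t * foldr partial phi s t) =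
  (-1) ^+ size s * \int[mu]_t (terms_pull (dterms_word s L) t * phi t).
Proof.
elim: s b L => [|l s IH] b L bs bL sphi.
  by rewrite expr0 mul1r.
have bl i : (incr_multi b l i <= alpha)%N.
  rewrite (leq_trans _ (bs i))// leq_add2l /= eq_sym; exact: leq_addr.
have ss : smooth (foldr partial phi s).
  by move=> s' x; rewrite -foldr_cat.
rewrite [LHS](terms_by_parts bl bL ss).
rewrite (IH (incr_multi b l))//; last exact: order_le_dterms.
  by rewrite exprS -mulrA mulN1r.
move=> i; apply: leq_trans (bs i); rewrite /incr_multi -addnA leq_add2l /=.
by rewrite eq_sym.
Qed.

End leibniz_terms.

Section leibniz_terms_bound.
Context {R : realType} {d : nat}.
Local Notation V := 'rV[R]_d.
Local Notation mu := (lebesgue_rV d).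

(** [C] depends on the formal list alone, not on the family [U] that interprets the derivatives of
    f. *)
Lemma terms_pull_sqr alpha (L : seq (@term R d)) : order_le (fun=> alpha) L ->
  exists2 C : R, 0 <= C & forall (U : ('I_d -> nat) -> V -> R) (N : \bar R),
    (forall j, (forall i, j i <= alpha)%N -> gauss_L2 (U j)) ->
    (forall j, (forall i, j i <= alpha)%N ->
      (\int[mu]_x (U j x ^+ 2 * gauss_density x)%:E <= N)%E) ->
    (\int[mu]_t (terms_pull U L t ^+ 2)%:E <= C%:E * N)%E.
Proof.
elim: L => [_|T L IH [hT aL]].
  exists 0 => // U N UL2 UN; under eq_integral do rewrite terms_pull_nil expr0n.
  by rewrite integral0 mul0e.
have [C C0 HC] := IH aL; have [D D0 HD] := cube_pull_wt_sqr T.2.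
(* From (a + b)^2 <= 2 a^2 + 2 b^2, applied to the head and the tail of the list. *)
exists (2 * D + 2 * C); first by rewrite addr_ge0// mulr_ge0.
move=> U N UL2 UN; have [mU _] := UL2 _ hT.
have N0 : (0 <= N)%E.
  apply: le_trans (UN T.1 hT); apply: integral_ge0 => x _.
  by rewrite lee_fin mulr_ge0 ?sqr_ge0// ltW// gauss_density_gt0.
have mT : measurable_fun setT (cube_pull (term_val U T)).
  apply: measurable_cube_pull; apply: measurable_funM => //; exact: measurable_wt.
have mL : measurable_fun setT (terms_pull U L).
  by apply/measurable_EFinP; apply: measurable_int (integrable_terms_pull UL2 aL).
have m2 (f : V -> R) : measurable_fun setT f ->
    measurable_fun setT (fun x => (2%:E * (f x ^+ 2)%:E)%E).
  move=> mf; apply: measurable_funeM; apply/measurable_EFinP; exact: measurable_funX.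
apply: (@le_trans _ _ (\int[mu]_t (2%:E * (cube_pull (term_val U T) t ^+ 2)%:E +
    2%:E * (terms_pull U L t ^+ 2)%:E))%E).
  apply: ge0_le_integral => //.
  - by move=> x _; rewrite lee_fin sqr_ge0.
  - apply/measurable_EFinP; apply: measurable_funX.
    rewrite (_ : terms_pull _ _ = fun t => cube_pull (term_val U T) t + terms_pull U L t).
      exact: measurable_funD.
    by apply/funext => t; rewrite terms_pull_cons.
  - by apply: emeasurable_funD; exact: m2.
  - move=> x _; rewrite terms_pull_cons -!EFinM -EFinD lee_fin.
    set a := cube_pull _ _; set b := terms_pull _ _ _.
    by have := sqr_ge0 (a - b); rewrite !expr2; nra.
rewrite ge0_integralD//; [|by move=> x _; rewrite mule_ge0// lee_fin sqr_ge0|exact: m2|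
  by move=> x _; rewrite mule_ge0// lee_fin sqr_ge0|exact: m2].
rewrite !ge0_integralZl//; [|by apply/measurable_EFinP; exact: measurable_funX|
  by move=> x _; rewrite lee_fin sqr_ge0|by apply/measurable_EFinP; exact: measurable_funX|
  by move=> x _; rewrite lee_fin sqr_ge0].
rewrite (EFinD (2 * D)) ge0_muleDl ?lee_fin ?mulr_ge0// !(EFinM 2) -!muleA.
apply: leeD; apply: lee_wpmul2l => //; last exact: HC.
apply: le_trans (HD _ mU) _; apply: lee_wpmul2l; first by rewrite lee_fin.
exact: UN.
Qed.

End leibniz_terms_bound.

(** * Uniqueness of weak derivatives *)

Section du_bois_reymond.
Context {R : realType} {d : nat}.
Local Notation V := 'rV[R]_d.
Local Notation mu := (lebesgue_rV d).
Implicit Types (a b c x : V) (U : set V) (v w : V -> R).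

Definition obox a b : set V := rect (fun i => `]a 0 i, b 0 i[%classic).

Lemma measurable_obox a b : measurable (obox a b).
Proof. by apply: measurable_rect. Qed.

Lemma measurable_cbox a b : measurable (cbox a b).
Proof. by apply: (@measurable_rect _ _ (fun i => `[a 0 i, b 0 i]%classic)). Qed.

Lemma obox_cbox a b : obox a b `<=` cbox a b.
Proof.
move=> x abx i; have := abx i; rewrite /= !in_itv/= => /andP[h1 h2].
by rewrite !ltW.
Qed.

(** The lower corner of the part of the box that lies in the orthant of [c]. The functions [bump]
    below tend to the indicator of this part and vanish off the box for every m, so they are test
    functions on any open set that contains the closed box. *)
Let a' a c : V := \row_i Num.max (a 0 i) (c 0 i).

Let bump a b c m : V -> R :=
  prodf (fun k y => ebump 0 (m%:R * y + - (m%:R * a' a c 0 k)) *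
                    ebump 0 (- m%:R * y + m%:R * b 0 k)).

Let elem1_bump a b c m k : elem1 (fun y => ebump 0 (m%:R * y + - (m%:R * a' a c 0 k)) *
                    ebump 0 (- m%:R * y + m%:R * b 0 k)).
Proof. by apply: Elem1_mul; exact: Elem1_ebump. Qed.

Let bump_neq0 a b c m x : bump a b c m x != 0 -> obox (a' a c) b x.
Proof.
rewrite /bump /prodf prodf_seq_neq0 => /allP h i.
have := h i (mem_index_enum _); apply: contraNT => /=.
have m0 : (0 : R) <= m%:R by [].
rewrite in_itv/= negb_and -!leNgt => /orP[hi|hi].
  by rewrite ebump_le0 ?mul0r// subr_le0 ler_wpM2l.
by rewrite [X in _ * X]ebump_le0 ?mulr0// mulNr addrC subr_le0 ler_wpM2l.
Qed.

Let bump_le1 a b c m x : `|bump a b c m x| <= 1.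
Proof.
rewrite /bump /prodf; elim/big_ind : _ => [|y z y1 z1|k _]; first by rewrite normr1.
  by rewrite normrM -[leRHS]mulr1 ler_pM.
rewrite ger0_norm ?mulr_ge0 ?ebump_ge0// -[leRHS]mulr1.
by rewrite ler_pM ?ebump_ge0 ?ebump0_le1.
Qed.

Let cvg_bump a b c x :
  bump a b c m x @[m --> \oo] --> (\1_(obox (a' a c) b) x : R).
Proof.
have cv (y z : R) : ebump 0 (m%:R * (y - z)) @[m --> \oo] --> ((z < y)%R%:R : R).
  have [zy|yz] := ltP z y.
    by apply: (@cvg_ebump _ 0); apply: cvg_natM; rewrite subr_gt0.
  under eq_fun do rewrite ebump_le0 ?mulr_ge0_le0// ?subr_le0//.
  exact: cvg_cst.
have H : bump a b c m x @[m --> \oo] -->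
    (\prod_(k < d) ((a' a c 0 k < x 0 k)%R%:R * (x 0 k < b 0 k)%R%:R) : R).
  rewrite /bump /prodf; elim: (index_enum _) => [|k s IH].
    under eq_fun do rewrite big_nil; rewrite big_nil; exact: cvg_cst.
  under eq_fun do rewrite big_cons; rewrite big_cons; apply: cvgM => //.
  apply: cvgM.
    under eq_fun do rewrite -mulrBr; exact: cv.
  under eq_fun do rewrite mulNr addrC -mulrBr; exact: cv.
suff <- : \prod_(k < d) ((a' a c 0 k < x 0 k)%R%:R * (x 0 k < b 0 k)%R%:R) =
    \1_(obox (a' a c) b) x :> R by [].
rewrite indicE; have [xab|xab] := pselect (obox (a' a c) b x).
  rewrite mem_set// big1// => k _; have := xab k; rewrite /= in_itv/= => /andP[-> ->].
  by rewrite mulr1.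
rewrite memNset//; have /existsNP[k kab] := xab.
rewrite (bigD1 k)//=; move: kab; rewrite /= in_itv/=.
by case: (_ < _) => /=; rewrite ?mul0r// mul1r; case: (_ < _); rewrite ?mul0r.
Qed.

Let bump_test U a b c m : cbox a b `<=` U -> test_function U (bump a b c m).
Proof.
move=> abU; apply: (@test_function_cbox _ _ _ (a' a c) b).
- by apply: smooth_prodf => k; exact: elem1_bump.
- by move=> x /bump_neq0/obox_cbox.
- move=> x xab; apply: abU => i; have := xab i; rewrite /= !in_itv/= mxE ge_max.
  by move=> /andP[/andP[-> _] ->].
Qed.

Let integrable_obox U a b w : locally_integrable_rV U w -> cbox a b `<=` U ->
  mu.-integrable setT (EFin \o (w \_ (obox a b))).
Proof.
move=> [mw oU iw] abU; have abU' : obox a b `<=` U.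
  by apply: subset_trans abU; exact: obox_cbox.
have mw' : measurable_fun (cbox a b) w.
  exact: measurable_funS (open_measurable_rV oU) abU mw.
apply/integrableP; split.
  rewrite -restrict_EFin.
  apply: (iffLR (measurable_restrictT (EFin \o w) (measurable_obox a b))).
  apply/measurable_EFinP; apply: measurable_funS mw' => //; first exact: measurable_cbox.
  exact: obox_cbox.
apply: le_lt_trans (iw _ abU (@compact_cbox _ _ a b)).
rewrite [leRHS]integral_mkcond; apply: ge0_le_integral => //.
- rewrite /= -/(abse \o (EFin \o (w \_ (obox a b)))).
  apply: measurableT_comp => //; rewrite -restrict_EFin.
  apply: (iffLR (measurable_restrictT (EFin \o w) (measurable_obox a b))).
  apply/measurable_EFinP; apply: measurable_funS mw' => //; first exact: measurable_cbox.
  exact: obox_cbox.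
- apply: (iffLR (measurable_restrictT _ (measurable_cbox a b))).
  by apply/measurable_EFinP; exact: measurableT_comp.
- move=> x _; rewrite /= !patchE; case: ifPn => [|_].
    by rewrite inE => /obox_cbox xab; rewrite mem_set.
  by rewrite /= normr0; case: ifPn => // _; rewrite lee_fin.
Qed.

Let cvg_integral_bump U a b c w : locally_integrable_rV U w -> cbox a b `<=` U ->
  \int[mu]_(x in U) (w x * bump a b c m x) @[m --> \oo] -->
  \int[mu]_(x in orthant c) (w \_ (obox a b)) x.
Proof.
move=> lw abU; have iW := integrable_obox lw abU.
have mbump m : measurable_fun setT (bump a b c m).
  apply: continuous_measurable_rV; apply: smooth_continuous.
  by apply: smooth_prodf => k; exact: elem1_bump.
have mO := measurable_obox (a' a c) b.
have [_ _] := @Rintegral_bounded_cvg _ _ (w \_ (obox a b)) 1 (bump a b c)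
  (\1_(obox (a' a c) b)) iW mbump (measurable_indic mO)
  (@bump_le1 a b c) (@cvg_bump a b c).
have sub : obox (a' a c) b `<=` obox a b.
  move=> x xab i; have := xab i; rewrite /= !in_itv/= mxE gt_max.
  by move=> /andP[/andP[-> _] ->].
have UE m : \int[mu]_(x in U) (w x * bump a b c m x) =
    \int[mu]_x ((w \_ (obox a b)) x * bump a b c m x).
  rewrite Rintegral_mkcond; apply: eq_Rintegral => x _.
  have [b0|/bump_neq0 bx] := eqVneq (bump a b c m x) 0.
    by rewrite patchE; case: ifPn; rewrite b0 !mulr0.
  have abx := sub _ bx; have Ux : U x by apply: abU; exact: obox_cbox.
  by rewrite !patchE !mem_set.
under eq_fun do rewrite -UE.
rewrite [X in _ --> X -> _](_ : _ = \int[mu]_(x in orthant c) (w \_ (obox a b)) x) //.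
rewrite [RHS]Rintegral_mkcond; apply: eq_Rintegral => x _.
rewrite indicE [in RHS]patchE; have [abx|abx] := pselect (obox a b x); last first.
  by rewrite patchC ?inE// mul0r; case: ifP.
have -> : (x \in obox (a' a c) b) = (x \in orthant c).
  apply/idP/idP; rewrite !inE => H i; have := abx i; have := H i;
    rewrite /= !in_itv/= mxE gt_max; first by move=> /andP[/andP[]].
  by move=> -> /andP[-> ->].
by case: ifP => _; rewrite ?mulr1 ?mulr0.
Qed.

(** As m grows, [bump] turns the hypothesis into equality of the integrals of [v] and [w] over the
    box cut by an arbitrary orthant; the orthants then determine the difference. *)
Lemma ae_eq_of_test_functions U a b v w :
  locally_integrable_rV U v -> locally_integrable_rV U w -> cbox a b `<=` U ->
  (forall chi, test_function U chi ->
    \int[mu]_(x in U) (v x * chi x) = \int[mu]_(x in U) (w x * chi x)) ->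
  {ae mu, forall x, obox a b x -> v x = w x}.
Proof.
move=> lv lw abU vw.
have iv := integrable_obox lv abU; have iw := integrable_obox lw abU.
have H : {ae mu, forall x, (v \_ (obox a b)) x - (w \_ (obox a b)) x = 0}.
  apply: (@integral_orthants_eq0 _ _ _ a).
  - exact: (integrableB measurableT iv iw).
  - move=> x ax; have abx : ~ obox a b x.
      move=> h; apply: ax => i; have := h i; rewrite /= in_itv/= => /andP[//].
    by rewrite !patchC ?inE// subrr.
  - move=> c; have mc := measurable_orthant c.
    rewrite RintegralB//; [|exact: integrableS iv|exact: integrableS iw].
    apply/eqP; rewrite subr_eq0; apply/eqP.
    apply: (@cvg_seq_unique R _ _ _ _ _ (@cvg_integral_bump _ _ _ c _ lv abU) (@cvg_integral_bump _ _ _ c _ lw abU)).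
    by move=> m; apply: vw; exact: bump_test.
apply: filterS H => x /= + abx; rewrite !patchT ?inE// => /eqP.
by rewrite subr_eq0 => /eqP.
Qed.

Lemma ae_eq_of_test_functions_cover U (a_ b_ : nat -> V) v w :
  locally_integrable_rV U v -> locally_integrable_rV U w ->
  (forall n, cbox (a_ n) (b_ n) `<=` U) -> U `<=` \bigcup_n obox (a_ n) (b_ n) ->
  (forall chi, test_function U chi ->
    \int[mu]_(x in U) (v x * chi x) = \int[mu]_(x in U) (w x * chi x)) ->
  {ae mu, forall x, U x -> v x = w x}.
Proof.
move=> lv lw abU Uab vw.
have H : {ae mu, forall x, forall n, obox (a_ n) (b_ n) x -> v x = w x}.
  by apply: ae_foralln => n; exact: ae_eq_of_test_functions vw.
by apply: filterS H => x /= h /Uab[n _]; exact: h.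
Qed.

(** Null sets add up over countably many boxes, so uniqueness on each open box gives uniqueness on
    [U]. The closed boxes must lie in [U] because local integrability speaks of its compact
    subsets. *)
Definition exhaustible U := exists a_ b_ : nat -> V,
  (forall n, cbox (a_ n) (b_ n) `<=` U) /\ U `<=` \bigcup_n obox (a_ n) (b_ n).

Lemma wderiv_unique U r f v w : exhaustible U -> is_wderiv U r f v -> is_wderiv U r f w ->
  {ae mu, forall x, U x -> v x = w x}.
Proof.
move=> [a_ [b_ [abU Uab]]] [_ lv fv] [_ lw fw].
apply: (ae_eq_of_test_functions_cover lv lw abU Uab) => chi tchi.
have := fw _ tchi; rewrite fv// => /mulfI; apply.
by rewrite signr_eq0.
Qed.

Lemma exhaustible_setT : exhaustible setT.
Proof.
exists (fun n => const_mx (- n%:R)), (fun n => const_mx n%:R); split=> // x _.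
exists (\max_j Num.bound `|x ord0 j|) => // i.
rewrite /= !mxE in_itv/= -ltr_norml.
apply: (lt_le_trans (archi_boundP (normr_ge0 _))).
by rewrite ler_nat; exact: (leq_bigmax_cond (F := fun j : 'I_d => Num.bound `|x ord0 j|)).
Qed.

Lemma exhaustible_cube : exhaustible (@open_cube R d).
Proof.
exists (fun n => const_mx n.+2%:R^-1), (fun n => const_mx (1 - n.+2%:R^-1)); split.
  move=> n x abx i; have := abx i; rewrite /= !mxE in_itv/= => /andP[h1 h2].
  have n0 : (0 : R) < n.+2%:R^-1 by rewrite invr_gt0.
  by rewrite (lt_le_trans n0 h1)/= (le_lt_trans h2)// ltrBlDr ltrDl.
move=> x cx.
have near_i (i : 'I_d) : \forall n \near \oo, (n.+2%:R^-1 : R) < x 0 i /\ (n.+2%:R^-1 : R) < 1 - x 0 i.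
  have /andP[x0 x1] := cx i; have x1' : 0 < 1 - x 0 i by rewrite subr_gt0.
  have H (e : R) : 0 < e -> \forall n \near \oo, (n.+2%:R^-1 : R) < e.
    move=> e0; near=> n; apply: (@lt_trans _ _ n.+1%:R^-1).
      by rewrite ltf_pV2 ?posrE// ltr_nat.
    by near: n; exact: (near_infty_natSinv_lt (PosNum e0)).
  by near=> n; split; near: n; exact: H.
have [n _ nP] : \forall n \near \oo, forall i : 'I_d,
    (n.+2%:R^-1 : R) < x 0 i /\ (n.+2%:R^-1 : R) < 1 - x 0 i.
  exact: filter_forall.
exists n => // i; have [h1 h2] := nP n (leqnn n) i.
by rewrite /= !mxE in_itv/= h1/= ltrBrDr addrC -ltrBrDr.
Unshelve. all: by end_near. Qed.

(** The chosen version is altered only outside of [U], where neither local integrability on [U] nor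
    the integrals over [U] see it. *)
Lemma is_wderiv_wderiv U r f : weakly_derivable U r f -> is_wderiv U r f (wderiv U r f).
Proof.
move=> wd; have [lf lv fv] := getPex wd.
have E x : U x -> wderiv U r f x = get (is_wderiv U r f) x.
  by move=> Ux; rewrite /wderiv patchT// inE.
have [mv oU iv] := lv; have mU := open_measurable_rV oU.
split=> //.
  split=> //; first by apply: eq_measurable_fun mv => x; rewrite inE => /E.
  move=> K KU cK; rewrite (eq_integral (fun x => `|get (is_wderiv U r f) x|%:E)).
    exact: iv.
  by move=> x; rewrite inE => /KU/E ->.
move=> phi tphi; rewrite fv//; congr (_ * _); apply: eq_Rintegral => x.
by rewrite inE => /E ->.
Qed.

End du_bois_reymond.

(** * Weak derivatives of the transformed function *)

Section sobolev_derivatives.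
Context {R : realType} {d : nat}.
Local Notation V := 'rV[R]_d.
Local Notation mu := (lebesgue_rV d).
Local Notation cube := (@open_cube R d).
Implicit Types (U : set V) (f v w : V -> R) (r j : 'I_d -> nat) (l : 'I_d).

Lemma Rintegral_zero_ext (A : set V) (F G : V -> R) :
  (forall x, A x -> F x = G x) -> (forall x, ~ A x -> G x = 0) ->
  \int[mu]_(x in A) F x = \int[mu]_x G x.
Proof.
move=> FG G0; rewrite Rintegral_mkcond; apply: eq_Rintegral => x _.
rewrite patchE; case: ifPn; first by rewrite inE => /FG.
by rewrite notin_setE => /G0.
Qed.

(** Off its closed support [chi] vanishes in a neighbourhood, so its derivative vanishes there as
    well. *)
Lemma test_function_partial U l chi :
  test_function U chi -> test_function U (partial l chi).
Proof.
move=> [schi cchi chiU].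
have sub : closure [set x | partial l chi x != 0] `<=` closure [set x | chi x != 0].
  have cc := iffLR (closure_id (closure [set x | chi x != 0])) (@closed_closure _ _).
  rewrite [X in _ `<=` X]cc.
  apply: closureS => x /=; apply: contraNP => xchi.
  have : nbhs x (~` closure [set x | chi x != 0]).
    by apply: open_nbhs_nbhs; split => //; exact/closed_openC/closed_closure.
  move=> H; have : \near x, chi x = (cst 0 : V -> R) x.
    apply: filterS H => y /= yc; apply/eqP; apply: contrapT => /negP y0.
    by apply: yc; exact: subset_closure.
  by rewrite /partial => /near_eq_derive ->; rewrite derive_cst.
split; [exact: smooth_partial| |exact: subset_trans chiU].
by apply: subclosed_compact sub => //; exact: closed_closure.
Qed.

Lemma locally_integrable_ext U v w : (forall x, U x -> v x = w x) ->
  locally_integrable_rV U v -> locally_integrable_rV U w.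
Proof.
move=> vw [mv oU iv]; split=> //.
  by apply: eq_measurable_fun mv => x; rewrite inE => /vw.
move=> K KU cK; rewrite (eq_integral (fun x => `|v x|%:E)); first exact: iv.
by move=> x; rewrite inE => /KU/vw ->.
Qed.

Lemma locally_integrable_integrable U v : open U ->
  mu.-integrable setT (EFin \o v) -> locally_integrable_rV U v.
Proof.
move=> oU /integrableP[mv iv].
have mv' : measurable_fun setT v by apply/measurable_EFinP.
split=> //; first exact: measurable_funTS.
move=> K KU cK; apply: le_lt_trans iv; apply: ge0_subset_integral => //.
  rewrite -[K]setCK; apply: measurableC; apply: open_measurable_rV.
  by apply: closed_openC; apply: compact_closed => //; exact: norm_hausdorff.
by apply/measurable_EFinP; exact: measurableT_comp.
Qed.

(** The relation of order j is tested with [partial l chi] and the one of higher order with [chi].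
    By [partialn_incr] both have the same integral of f on the left, and the signs differ by one
    factor -1. *)
Lemma wderiv_by_parts f j l v w : is_wderiv setT j f v ->
  is_wderiv setT (incr_multi j l) f w ->
  forall chi, test_function setT chi ->
  \int[mu]_x (v x * partial l chi x) = - \int[mu]_x (w x * chi x).
Proof.
move=> [_ _ fv] [_ _ fw] chi tchi.
have := fv _ (test_function_partial l tchi).
rewrite -partialn_incr; last by have [] := tchi.
rewrite fw// => /esym.
have -> : (\sum_i incr_multi j l i = (\sum_i j i).+1)%N.
  rewrite /incr_multi big_split/= (_ : \sum_i (i == l) = 1)%N ?addn1//.
  by rewrite (bigD1 l)//= eqxx big1// => i /negbTE ->.
rewrite exprS mulN1r mulNr -mulrN => /mulfI; apply.
by rewrite signr_eq0.
Qed.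

Variables (alpha : nat) (f : V -> R).
Hypothesis Hf : gauss_sobolev alpha f.

(* At order 0 this is [f] itself, not just a function that is a.e. equal to it. *)
Definition wderivs j : V -> R := if `[< j = fun=> 0%N >] then f else wderiv setT j f.

Lemma is_wderiv_wderivs j : (forall i, j i <= alpha)%N -> is_wderiv setT j f (wderivs j).
Proof.
move=> ja; have [/is_wderiv_wderiv H _] := Hf ja.
rewrite /wderivs; case: ifPn => // /asboolP j0.
have [lf _ _] := H; split=> // phi _; rewrite j0 big1// expr0 mul1r.
apply: eq_Rintegral => x _.
by congr (_ * _); rewrite /partialn; elim: (enum _).
Qed.

Lemma ae_eq_wderivs j : (forall i, j i <= alpha)%N ->
  {ae mu, forall x, setT x -> wderiv setT j f x = wderivs j x}.
Proof.
move=> ja; have [/is_wderiv_wderiv H _] := Hf ja.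
exact: (wderiv_unique exhaustible_setT H (is_wderiv_wderivs ja)).
Qed.

Lemma L2norm_sqr D (w u : V -> R) : (forall x, 0 <= w x) ->
  ((L2norm D w u) ^+ 2 = \int[mu]_(x in D) (`|u x| ^+ 2 * w x)%:E)%E.
Proof.
move=> w0; rewrite /L2norm poweR12_sqrt ?sqr_sqrte// integral_ge0// => x _;
  by rewrite lee_fin mulr_ge0// exprn_ge0.
Qed.

Lemma integral_wderivs j : (forall i, j i <= alpha)%N ->
  (\int[mu]_x (wderivs j x ^+ 2 * gauss_density x)%:E =
   L2norm setT gauss_density (wderiv setT j f) ^+ 2)%E.
Proof.
move=> ja; rewrite L2norm_sqr; last by move=> x; rewrite ltW// gauss_density_gt0.
have [/is_wderiv_wderiv H _] := Hf ja.
have [_ [m1 _ _] _] := H; have [_ [m2 _ _] _] := is_wderiv_wderivs ja.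
have mg := @measurable_gauss_density R d.
apply: ae_eq_integral => //.
- apply/measurable_EFinP; apply: measurable_funM => //; exact: measurable_funX.
- apply/measurable_EFinP; apply: measurable_funM => //; apply: measurable_funX.
  exact: measurableT_comp.
- apply: filterS (ae_eq_wderivs ja) => x h _; rewrite h//.
  by rewrite real_normK// num_real.
Qed.

Lemma gauss_L2_wderivs j : (forall i, j i <= alpha)%N -> gauss_L2 (wderivs j).
Proof.
move=> ja; split; first by have [_ [] ] := is_wderiv_wderivs ja.
rewrite integral_wderivs//; have [_ h] := Hf ja.
have h0 : (0 <= L2norm setT gauss_density (wderiv setT j f))%E by exact: poweR_ge0.
by rewrite expe2 lte_mul_pinfty// ge0_fin_numE.
Qed.

Lemma wderivs_le_norm j : (forall i, j i <= alpha)%N ->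
  (\int[mu]_x (wderivs j x ^+ 2 * gauss_density x)%:E <= gauss_sobolev_norm alpha f ^+ 2)%E.
Proof.
move=> ja; rewrite integral_wderivs//.
have ge0 r : (0 <= L2norm setT gauss_density (wderiv setT r f) ^+ 2)%E.
  by rewrite sqre_ge0.
rewrite /gauss_sobolev_norm poweR12_sqrt ?sqr_sqrte; last 2 first.
- by apply: sume_ge0 => r _.
- by apply: sume_ge0 => r _.
pose r : {ffun 'I_d -> 'I_alpha.+1} := [ffun i => inord (j i)].
rewrite (bigD1 r)//= (_ : (fun i => r i : nat) = j).
  by rewrite leeDl//; apply: sume_ge0 => i _; exact: ge0.
by apply/funext => i; rewrite ffunE inordK// ltnS.
Qed.

Lemma wderivs_by_parts j l : (forall i, incr_multi j l i <= alpha)%N ->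
  forall chi, test_function setT chi ->
  \int[mu]_x (wderivs j x * partial l chi x) =
  - \int[mu]_x (wderivs (incr_multi j l) x * chi x).
Proof.
move=> jla; apply: (@wderiv_by_parts f).
  by apply: is_wderiv_wderivs => i; apply: leq_trans (jla i); exact: leq_addr.
exact: is_wderiv_wderivs.
Qed.

Lemma cot_transformE t : cube t -> cot_transform f t = terms_pull wderivs [:: term0] t.
Proof.
move=> ct; rewrite /terms_pull cube_pullE// /terms_val big_seq1 /term_val /cot_transform.
rewrite /= /wderivs ifT ?asboolT// -mulrA; congr (_ * _); rewrite /wt; congr (_ * _).
apply: eq_bigr => k _; rewrite derive1_phi_cot; last exact: ct.
by rewrite -[LHS]mul1r -(poly_jacVE (phi_cot (t 0 k))) mulfK ?mxE// gt_eqF// jac_gt0.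
Qed.

(* A version of [D^r g], extended by 0 outside of the cube. *)
Definition cot_wderiv r : V -> R :=
  terms_pull wderivs (dterms_word (multi_word r) [:: term0]).

Lemma order_le_cot_wderiv r : order_le r (dterms_word (multi_word r) [:: @term0 R d]).
Proof.
have H : order_le (fun=> 0%N) [:: @term0 R d] by [].
apply: order_le_trans (order_le_dterms_word (multi_word r) H) => i.
by rewrite add0n count_multi_word.
Qed.

Lemma integrable_cot_wderiv r : (forall i, r i <= alpha)%N ->
  mu.-integrable setT (EFin \o cot_wderiv r).
Proof.
move=> ra; apply: (integrable_terms_pull gauss_L2_wderivs).
exact: order_le_trans (order_le_cot_wderiv r).
Qed.

Lemma is_wderiv_cot_transform r : (forall i, r i <= alpha)%N ->
  is_wderiv cube r (cot_transform f) (cot_wderiv r).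
Proof.
move=> ra; split.
- apply: (@locally_integrable_ext _ (terms_pull wderivs [:: term0])).
    by move=> t /cot_transformE.
  apply: locally_integrable_integrable; first exact: open_open_cube.
  by apply: (integrable_terms_pull gauss_L2_wderivs).
- apply: locally_integrable_integrable; first exact: open_open_cube.
  exact: integrable_cot_wderiv.
- move=> phi [sphi _ _]; rewrite partialn_word -size_multi_word.
  have H : order_le (fun=> 0%N) [:: @term0 R d] by [].
  have Hr i : (0 + count_mem i (multi_word r) <= alpha)%N.
    by rewrite add0n count_multi_word.
  have := terms_word_by_parts gauss_L2_wderivs wderivs_by_parts Hr H sphi.
  rewrite -(@Rintegral_zero_ext cube (fun t => cot_transform f t * foldr partial phi (multi_word r) t)); first last.
  - by move=> t ct; rewrite terms_pull_out// mul0r.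
  - by move=> t /cot_transformE ->.
  move=> ->; congr (_ * _); apply/esym/Rintegral_zero_ext => // t ct.
  by rewrite terms_pull_out// mul0r.
Qed.

Lemma ae_eq_cot_wderiv r : (forall i, r i <= alpha)%N ->
  {ae mu, forall t, cube t -> wderiv cube r (cot_transform f) t = cot_wderiv r t}.
Proof.
move=> ra; have H := is_wderiv_cot_transform ra.
apply: (wderiv_unique exhaustible_cube _ H).
by apply: is_wderiv_wderiv; exists (cot_wderiv r).
Qed.

End sobolev_derivatives.

Section norm_estimate.
Context {R : realType} {d : nat}.
Local Notation V := 'rV[R]_d.
Local Notation mu := (lebesgue_rV d).
Local Notation cube := (@open_cube R d).

Lemma L2norm_cot_wderiv alpha (r : 'I_d -> nat) : (forall i, r i <= alpha)%N ->
  exists2 C : R, 0 <= C & forall f : V -> R, gauss_sobolev alpha f ->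
    (L2norm (closed_cube d) (cst 1%R) (wderiv cube r (cot_transform f)) <=
     C%:E * gauss_sobolev_norm alpha f)%E.
Proof.
move=> ra.
have HL : order_le (fun=> alpha) (dterms_word (multi_word r) [:: @term0 R d]).
  exact: order_le_trans (order_le_cot_wderiv r).
have [C C0 HC] := terms_pull_sqr HL.
exists (Num.sqrt C); first exact: sqrtr_ge0.
move=> f Hf; have n0 : (0 <= gauss_sobolev_norm alpha f)%E by exact: poweR_ge0.
have := HC (wderivs f) (gauss_sobolev_norm alpha f ^+ 2)%E
  (gauss_L2_wderivs Hf) (wderivs_le_norm Hf).
rewrite -/(cot_wderiv f r) => H.
rewrite /L2norm poweR12_sqrt; last first.
  by apply: integral_ge0 => x _; rewrite lee_fin mulr_ge0// exprn_ge0.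
have -> : ((Num.sqrt C)%:E * gauss_sobolev_norm alpha f =
    sqrte (C%:E * gauss_sobolev_norm alpha f ^+ 2))%E.
  by rewrite sqrteM ?lee_fin// sqrte_sqr gee0_abs.
rewrite lee_sqrt; last by rewrite mule_ge0// sqre_ge0.
apply: le_trans H; rewrite integral_mkcond.
have wd := is_wderiv_wderiv (ex_intro _ _ (is_wderiv_cot_transform Hf ra)).
have mw : measurable_fun setT (wderiv cube r (cot_transform f)).
  have [_ [mw _ _] _] := wd.
  have := iffLR (measurable_restrictT _ measurable_open_cube) mw.
  rewrite (_ : _ \_ _ = wderiv cube r (cot_transform f))//.
  by apply/funext => x; rewrite /wderiv !patchE; case: (x \in _).
(* The integrands are equal almost everywhere: both versions of the derivative are 0 outside of the
   open cube, so passing to the closed cube changes nothing. *)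
rewrite le_eqVlt; apply/orP; left; apply/eqP.
rewrite (_ : _ \_ _ = fun x => (wderiv cube r (cot_transform f) x ^+ 2)%:E).
  apply: ae_eq_integral => //.
  - by apply/measurable_EFinP; exact: measurable_funX.
  - apply/measurable_EFinP; apply: measurable_funX; apply/measurable_EFinP.
    exact: measurable_int (integrable_cot_wderiv Hf ra).
  apply: filterS (ae_eq_cot_wderiv Hf ra) => x h _.
  have [cx|cx] := pselect (cube x); first by rewrite h.
  by rewrite /wderiv patchC ?inE// /cot_wderiv terms_pull_out.
apply/funext => x; rewrite patchE; case: ifPn => [_|].
  by rewrite mulr1 real_normK// num_real.
rewrite notin_setE => cx; rewrite /wderiv patchC ?expr0n// inE => cx'.
by apply: cx => i; have /andP[/ltW -> /ltW ->] := cx' i.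
Qed.

End norm_estimate.

(** * Traces *)

Section orthant_formula.
Context {R : realType} {d : nat}.
Local Notation V := 'rV[R]_d.
Local Notation mu := (lebesgue_rV d).
Local Notation cube := (@open_cube R d).
Implicit Types (c x y : V) (A : seq 'I_d).

Lemma orthant_indicE (c y : V) : \1_(orthant c) y = \prod_k (c 0 k < y 0 k)%R%:R :> R.
Proof.
rewrite indicE; have [cy|cy] := pselect (orthant c y).
  by rewrite mem_set// big1// => k _; rewrite cy.
rewrite memNset//; have /existsNP[k /negP/negbTE ck] := cy.
by rewrite (bigD1 k)//= ck mul0r.
Qed.

(** [step] smooths the indicator of y > c and [ramp] smooths the positive part of y - c. Defining
    [ramp] as a product keeps it within [elem1]; its derivative [step'] differs from [step], but it
    also lies between 0 and 1 and tends to the same indicator. *)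
Let step m (c y : R) : R := ebump 0 (m%:R * y + - (m%:R * c)).
Let ramp m (c y : R) : R := (y + - c) * step m c y.
Let step' m (c y : R) : R := ebump_ramp' (m%:R * y + - (m%:R * c)).

Let is_derive_ramp (m : nat) (c y : R) : is_derive (y : R) 1 (ramp m c) (step' m c y).
Proof.
have H1 := is_deriveD (is_derive_id y 1) (is_derive_cst (- c) y 1).
have H2 := is_derive_ebump_affine 0 m%:R (- (m%:R * c)) y.
have H3 := is_deriveM H1 H2.
apply: (is_derive_eq H3).
rewrite /step' /ebump_ramp' /GRing.scale/= /step mulr0n oppr0 mul0r add0r addr0 mulr1.
set z := m%:R * y + _.
have -> : (y - c) * (m%:R * ebump 2 z) = z * ebump 2 z.
  by rewrite /z; ring.
(* At z = 0 both sides are 0; elsewhere z cancels one inverse power. *)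
have [z0|z0] := eqVneq z 0; last by rewrite (ebumpS _ z0) mulrA divff// mul1r addrC.
by rewrite z0 !ebump_le0// mul0r addr0.
Qed.

Let elem1_step (m : nat) (c : R) : elem1 (step m c). Proof. exact: Elem1_ebump. Qed.

Let elem1_ramp (m : nat) (c : R) : elem1 (ramp m c).
Proof.
by apply: Elem1_mul => //; apply: Elem1_add; [exact: Elem1_id|exact: Elem1_cst].
Qed.

Let derive1_ramp (m : nat) (c : R) : derive1 (ramp m c) = step' m c.
Proof. by apply/funext => y; rewrite derive1E; have [_ ->] := is_derive_ramp m c y. Qed.

(** Ramps stand along the coordinates in [A], so that one derivative along each of them leaves a
    smoothed indicator of the orthant. *)
Let testf A c m : V -> R :=
  prodf (fun k => if k \in A then ramp m (c 0 k) else step m (c 0 k)).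

Let testf' A c m : V -> R :=
  prodf (fun k => if k \in A then step' m (c 0 k) else step m (c 0 k)).

Let smooth_testf A c m : smooth (testf A c m).
Proof. by apply: smooth_prodf => k; case: ifP. Qed.

Let smooth_testf' A c m : smooth (testf' A c m).
Proof.
apply: smooth_prodf => k; case: ifP => // _; rewrite -derive1_ramp.
by have [] := elem1_derive1 (elem1_ramp m (c 0 k)).
Qed.

Let foldr_partial_testf A c m : uniq A -> foldr partial (testf A c m) A = testf' A c m.
Proof.
have H s : uniq s -> {subset s <= A} -> foldr partial (testf A c m) s =
    prodf (fun k => if k \in s then step' m (c 0 k) else
                    if k \in A then ramp m (c 0 k) else step m (c 0 k)).
  elim: s => [//|l s IH]/= /andP[ls us] sA.
  rewrite IH//; last by move=> k ks; apply: sA; rewrite inE ks orbT.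
  apply/funext => x; rewrite partial_prodf; last first.
    by rewrite (negbTE ls) sA ?mem_head//; exact: elem1_derivable.
  congr (prodf _ x); apply/funext => k; rewrite inE; case: eqVneq => [->|//] /=.
  by rewrite (negbTE ls) sA ?mem_head// derive1_ramp.
move=> uA; rewrite H//; congr prodf; apply/funext => k.
by case: (k \in A).
Qed.

Definition pos_part (a : R) : R := Num.max a 0.

(* The limit of smooth functions whose derivative along each [k] in [A] tends boundedly
   to the indicator of the orthant. *)
Definition orthant_kernel A c y : R :=
  \prod_k (if k \in A then pos_part (y 0 k - c 0 k) else (c 0 k < y 0 k)%R%:R).

Let stepE (m : nat) (c y : R) : step m c y = ebump 0 (m%:R * (y - c)).
Proof. by rewrite /step mulrBr. Qed.

Let step'E (m : nat) (c y : R) : step' m c y = ebump_ramp' (m%:R * (y - c)).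
Proof. by rewrite /step' mulrBr. Qed.

Let cvg_step m0 (c y : R) : ebump m0 (m%:R * (y - c)) @[m --> \oo] -->
  (((c < y) && (m0 == 0%N))%R%:R : R).
Proof.
have [cy|yc] := ltP c y.
  by apply: cvg_ebump; apply: cvg_natM; rewrite subr_gt0.
under eq_fun do rewrite ebump_le0 ?mulr_ge0_le0// ?subr_le0//.
exact: cvg_cst.
Qed.

Let cvg_testf A c y : testf A c m y @[m --> \oo] --> orthant_kernel A c y.
Proof.
rewrite /testf /prodf /orthant_kernel; elim: (index_enum _) => [|k s IH].
  under eq_fun do rewrite big_nil; rewrite big_nil; exact: cvg_cst.
under eq_fun do rewrite big_cons; rewrite big_cons; apply: cvgM => //.
case: ifP => _.
  under eq_fun do rewrite /ramp stepE.
  have -> : pos_part (y 0 k - c 0 k) = (y 0 k - c 0 k) * (c 0 k < y 0 k)%R%:R.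
    rewrite /pos_part; have [h|h] := ltP (c 0 k) (y 0 k).
      by rewrite mulr1 max_l// subr_ge0 ltW.
    by rewrite mulr0 max_r// subr_le0.
  apply: cvgMr; have := @cvg_step 0 (c 0 k) (y 0 k); by rewrite andbT.
under eq_fun do rewrite stepE.
by have := @cvg_step 0 (c 0 k) (y 0 k); rewrite andbT.
Qed.

Let cvg_testf' A c y : testf' A c m y @[m --> \oo] --> (\1_(orthant c) y : R).
Proof.
rewrite orthant_indicE /testf' /prodf; elim: (index_enum _) => [|k s IH].
  under eq_fun do rewrite big_nil; rewrite big_nil; exact: cvg_cst.
under eq_fun do rewrite big_cons; rewrite big_cons; apply: cvgM => //.
case: (k \in A).
  under eq_fun do rewrite step'E.
  have := cvgD (@cvg_step 0 (c 0 k) (y 0 k)) (@cvg_step 1 (c 0 k) (y 0 k)).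
  by rewrite andbT andbF mulr0n addr0 => h; exact: h.
under eq_fun do rewrite stepE.
by have := @cvg_step 0 (c 0 k) (y 0 k); rewrite andbT.
Qed.

Let testf'_le1 A c m y : `|testf' A c m y| <= 1.
Proof.
rewrite /testf' /prodf; elim/big_ind : _ => [|a b a1 b1|k _]; first by rewrite normr1.
  by rewrite normrM -[leRHS]mulr1 ler_pM.
case: ifP => _; first by rewrite ger0_norm ?ebump_ramp'_ge0 ?ebump_ramp'_le1.
by rewrite ger0_norm ?ebump_ge0 ?ebump0_le1.
Qed.

Let testf_le A c m y : cube y -> `|testf A c m y| <= \prod_k (1 + `|c 0 k|).
Proof.
move=> cy; rewrite /testf /prodf normr_prod; apply: ler_prod => k _.
rewrite normr_ge0/=; have st (z : R) : `|step m (c 0 k) z| <= 1.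
  by rewrite ger0_norm ?ebump_ge0 ?ebump0_le1.
case: ifP => _; last by rewrite (le_trans (st _))// lerDl.
rewrite normrM -[leRHS]mulr1 ler_pM//.
have /andP[y0 y1] := cy k; rewrite (le_trans (ler_normB _ _))// lerD2r.
by rewrite gtr0_norm// ltW.
Qed.

Lemma measurable_orthant_kernel A c : measurable_fun setT (orthant_kernel A c).
Proof.
apply: (measurable_fun_cvg (h := testf A c)) => [m|y _]; last exact: cvg_testf.
by apply: continuous_measurable_rV; apply: smooth_continuous; exact: smooth_testf.
Qed.

Lemma orthant_kernel_ge0 A c y : 0 <= orthant_kernel A c y.
Proof. by apply: prodr_ge0 => k _; case: ifP => _ //; rewrite /pos_part le_max lexx orbT. Qed.

Lemma orthant_kernel_le A c y : cube y ->
  orthant_kernel A c y <= \prod_k (1 + `|c 0 k|).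
Proof.
move=> cy; apply: ler_prod => k _.
case: ifP => _; last by case: (_ < _)%R; rewrite /= ?mulr1n ?mulr0n ?lexx ?ler01 ?lerDl ?addr_ge0//=.
rewrite /pos_part le_max lexx orbT/= ge_max addr_ge0// andbT.
have /andP[y0 y1] := cy k.
by rewrite lerD ?(ltW y1)// -normrN ler_norm.
Qed.

(** The hypothesis is applied to [testf A c m]. Its derivative along [A] is bounded by 1 and tends
    to the indicator of the orthant, while the function itself tends to the kernel. *)
Lemma integral_orthant_kernel A (v w : V -> R) : uniq A ->
  mu.-integrable setT (EFin \o v) -> mu.-integrable setT (EFin \o w) ->
  (forall y, ~ cube y -> w y = 0) ->
  (forall phi, smooth phi -> \int[mu]_t (v t * foldr partial phi A t) =
    (-1) ^+ size A * \int[mu]_t (w t * phi t)) ->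
  forall c, \int[mu]_(x in orthant c) v x =
    (-1) ^+ size A * \int[mu]_y (w y * orthant_kernel A c y).
Proof.
move=> uA iv iw w0 H c.
have mcont (f : V -> R) : smooth f -> measurable_fun setT f.
  by move=> sf; apply: continuous_measurable_rV; exact: smooth_continuous.
have [_ _ c1] := @Rintegral_bounded_cvg _ _ v 1 (testf' A c) (\1_(orthant c)) iv
  (fun m => mcont _ (@smooth_testf' A c m)) (measurable_indic (measurable_orthant c))
  (fun m x => @testf'_le1 A c m x) (fun x => @cvg_testf' A c x).
have mc := @measurable_open_cube R d.
have mtf m := mcont _ (@smooth_testf A c m).
have cb y : cube y -> \1_cube y = 1 :> R by move=> cy; rewrite indicE mem_set.
have ncb y : ~ cube y -> \1_cube y = 0 :> R by move=> cy; rewrite indicE memNset.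
have mk : measurable_fun setT (orthant_kernel A c).
  exact: (measurable_fun_cvg mtf (fun y _ => @cvg_testf A c y)).
have M0 : 0 <= \prod_k (1 + `|c 0 k|) by apply: prodr_ge0 => k _; rewrite addr_ge0.
(* Ramps are unbounded on R^d but not on the cube. Since [w] vanishes off the cube, the indicator of
   the cube can be inserted without changing the integral. *)
have bd m x : `|testf A c m x * \1_cube x| <= \prod_k (1 + `|c 0 k|).
  have [cx|cx] := pselect (cube x); first by rewrite cb// mulr1 testf_le.
  by rewrite ncb// mulr0 normr0.
have cv2 x : testf A c m x * \1_cube x @[m --> \oo] --> orthant_kernel A c x * \1_cube x.
  apply: cvgMl; exact: cvg_testf.
have [_ _ c2] := @Rintegral_bounded_cvg _ _ w (\prod_k (1 + `|c 0 k|))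
  (fun m x => testf A c m x * \1_cube x) (fun x => orthant_kernel A c x * \1_cube x) iw
  (fun m => measurable_funM (mtf m) (measurable_indic mc))
  (measurable_funM mk (measurable_indic mc)) bd
  cv2.
have wE (g : V -> R) : \int[mu]_x (w x * (g x * \1_cube x)) = \int[mu]_x (w x * g x).
  congr fine; apply: eq_integral => x _; congr EFin.
  have [cx|cx] := pselect (cube x); first by rewrite cb// mulr1.
  by rewrite w0// !mul0r.
have <- : \int[mu]_x (v x * \1_(orthant c) x) = \int[mu]_(x in orthant c) v x.
  rewrite [RHS]Rintegral_mkcond; congr fine; apply: eq_integral => x _; congr EFin.
  by rewrite patchE indicE; case: ifP; rewrite ?mulr1 ?mulr0.
have c3 := @cvgMr _ _ _ eventually_filter _ ((-1) ^+ size A : R) _ c2.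
rewrite wE in c3.
apply: (cvg_seq_unique _ c1 c3) => m /=.
by rewrite wE -foldr_partial_testf// H.
Qed.

End orthant_formula.

Section orthant_uniqueness.
Context {R : realType} {d : nat}.
Local Notation V := 'rV[R]_d.
Local Notation mu := (lebesgue_rV d).
Local Notation cube := (@open_cube R d).

Lemma orthantI (c c' : V) :
  orthant c `&` orthant c' = orthant (\row_i Num.max (c 0 i) (c' 0 i)).
Proof.
apply/seteqP; split => [x [cx c'x] i|x H].
  by rewrite mxE gt_max cx c'x.
by split => i; have := H i; rewrite mxE gt_max => /andP[].
Qed.

(** A tail integral is a priori integrable over orthants only, so the difference is first restricted
    to the orthants with corner -m, which exhaust the space. *)
Lemma ae_eq_of_orthants (v K : V -> R) :
  (forall c, mu.-integrable (orthant c) (EFin \o v)) ->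
  (forall c, mu.-integrable (orthant c) (EFin \o K)) ->
  (forall c, \int[mu]_(x in orthant c) v x = \int[mu]_(x in orthant c) K x) ->
  {ae mu, forall x, v x = K x}.
Proof.
move=> iv iK vK.
have mO := @measurable_orthant R d.
have : {ae mu, forall x, forall m, ((v \- K) \_ (orthant (const_mx (- m%:R) : V))) x = 0}.
  apply: ae_foralln => m; set c0 : V := const_mx _.
  apply: (@integral_orthants_eq0 _ _ _ c0).
  - rewrite (_ : EFin \o _ = (EFin \o (v \- K)) \_ (orthant c0)); last first.
      by apply/funext => x; rewrite /= !patchE; case: ifP.
    apply: (iffLR (integrable_mkcond _ (mO c0))).
    rewrite (_ : _ \o _ = (EFin \o v) \- (EFin \o K))%E//.
    by apply: integrableB.
  - by move=> x xc; rewrite patchE memNset.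
  - move=> c; rewrite -Rintegral_mkcondr orthantI RintegralB//.
    by rewrite vK subrr.
apply: filterS => x /= H; have [m Hm] : exists m : nat, forall i : 'I_d, - m%:R < x 0 i.
  exists (\sum_i Num.bound (`|x 0 i|)%R)%N => i; rewrite ltrNl.
  apply: le_lt_trans (ler_norm _) _; rewrite normrN.
  apply: lt_le_trans (archi_boundP (normr_ge0 _)) _.
  by rewrite ler_nat (bigD1 i)//= leq_addr.
have := H m; rewrite patchE mem_set; last by move=> i; rewrite mxE.
by move/subr0_eq.
Qed.

Section trace.
Variables (A : seq 'I_d) (v w : V -> R) (sg : R).
Hypotheses (iv : mu.-integrable setT (EFin \o v)) (iw : mu.-integrable setT (EFin \o w)).
Hypothesis w0 : forall y, ~ cube y -> w y = 0.
Hypothesis vw : forall c, \int[mu]_(x in orthant c) v x =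
  sg * \int[mu]_y (w y * orthant_kernel A c y).

Lemma integrable_mul_orthant_kernel (p : V -> R) c : measurable_fun setT p ->
  (forall y, `|p y| <= `|w y|) ->
  mu.-integrable setT (EFin \o (fun y => p y * orthant_kernel A c y)).
Proof.
move=> mp pw; set M := \prod_k (1 + `|c 0 k|).
apply: (le_integrable measurableT (g := fun y => (M%:E * (w y)%:E)%E)); last first.
- exact: integrableZl.
- move=> y _; change (`|p y * orthant_kernel A c y|%:E <= `|M * w y|%:E)%E.
  rewrite lee_fin !normrM.
  have [cy|cy] := pselect (cube y); last first.
    have := pw y; rewrite w0// normr0 normr_le0 => /eqP ->.
    by rewrite normr0 mul0r mulr0.
  rewrite mulrC ler_pM//.
  rewrite ger0_norm ?orthant_kernel_ge0// (le_trans (orthant_kernel_le _ _ cy))//.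
  exact: ler_norm.
- by apply/measurable_EFinP; apply: measurable_funM => //; exact: measurable_orthant_kernel.
Qed.

(** [P1] and [P2] stand for the tail integrals of the positive and the negative part of [w]. Tonelli
    is applied to each part with values in the extended reals; on orthants the results are
    integrable, hence finite almost everywhere, and [fine] loses nothing. *)
Lemma ae_eq_trace (P1 P2 : V -> \bar R) :
  measurable_fun setT P1 -> measurable_fun setT P2 ->
  (forall x, 0 <= P1 x)%E -> (forall x, 0 <= P2 x)%E ->
  (forall c, \int[mu]_(x in orthant c) P1 x =
     \int[mu]_y (w^\+ y * orthant_kernel A c y)%:E)%E ->
  (forall c, \int[mu]_(x in orthant c) P2 x =
     \int[mu]_y (w^\- y * orthant_kernel A c y)%:E)%E ->
  {ae mu, forall x, v x = sg * (fine (P1 x) - fine (P2 x))}.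
Proof.
move=> mP1 mP2 P10 P20 HP1 HP2.
have mO := @measurable_orthant R d.
have mw : measurable_fun setT w by apply/measurable_EFinP; exact: measurable_int iw.
have fineP (p : V -> R) (P : V -> \bar R) : measurable_fun setT p -> (forall y, `|p y| <= `|w y|) ->
    (forall y, 0 <= p y) -> measurable_fun setT P -> (forall x, 0 <= P x)%E ->
    (forall c, \int[mu]_(x in orthant c) P x =
       \int[mu]_y (p y * orthant_kernel A c y)%:E)%E ->
    forall c, mu.-integrable (orthant c) (EFin \o (fine \o P)) /\
      \int[mu]_(x in orthant c) fine (P x) = \int[mu]_y (p y * orthant_kernel A c y).
  move=> mp pw p0 mP P0 HP c.
  have mP' : measurable_fun (orthant c) P by exact: measurable_funS mP.
  have iP : mu.-integrable (orthant c) P.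
    apply/integrableP; split => //.
    under eq_integral do rewrite gee0_abs//.
    have /integrableP[_] := integrable_mul_orthant_kernel c mp pw.
    rewrite HP; congr (_ < _)%E; apply: eq_integral => y _.
    by rewrite gee0_abs//= lee_fin mulr_ge0// orthant_kernel_ge0.
  have mfP : measurable_fun (orthant c) (EFin \o (fine \o P)).
    by apply/measurable_EFinP; apply: measurableT_comp.
  split.
    apply: le_integrable iP => // x _ /=.
    by have := P0 x; case: (P x) => //= r; rewrite ?abse0 ?leey.
  rewrite /Rintegral -HP; congr fine; apply: ae_eq_integral => //.
  have := integrable_ae (mO c) iP; apply: filterS => x Hx Ox /=.
  by rewrite fineK// Hx.
have [mw1 mw2] : measurable_fun setT w^\+ /\ measurable_fun setT w^\-.
  by split; [exact: measurable_funrpos|exact: measurable_funrneg].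
have w1 y : `|w^\+ y| <= `|w y|.
  by rewrite ger0_norm ?funrpos_ge0// /funrpos ge_max ler_norm normr_ge0.
have w2 y : `|w^\- y| <= `|w y|.
  by rewrite ger0_norm ?funrneg_ge0// /funrneg ge_max -[`|w y|]normrN ler_norm normr_ge0.
have F1 := fineP _ _ mw1 w1 (funrpos_ge0 w) mP1 P10 HP1.
have F2 := fineP _ _ mw2 w2 (funrneg_ge0 w) mP2 P20 HP2.
have iB c : mu.-integrable (orthant c) (EFin \o (fun x => fine (P1 x) - fine (P2 x))).
  rewrite (_ : _ \o _ = (EFin \o (fine \o P1)) \- (EFin \o (fine \o P2)))%E//.
  by apply: integrableB => //; [have [] := F1 c|have [] := F2 c].
apply: ae_eq_of_orthants => c.
- exact: integrableS iv.
- rewrite (_ : _ \o _ = (fun x => sg%:E * (fine (P1 x) - fine (P2 x))%:E)%E)//.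
  exact: integrableZl.
- rewrite vw RintegralZl//; congr (_ * _).
  have [i1 e1] := F1 c; have [i2 e2] := F2 c.
  rewrite RintegralB// e1 e2 -RintegralB//.
  + apply: eq_Rintegral => y _; rewrite -mulrBl; congr (_ * _).
    by have /(congr1 (fun f => f y)) := funrposBneg w.
  + exact: integrable_mul_orthant_kernel.
  + exact: integrable_mul_orthant_kernel.
Qed.

End trace.
End orthant_uniqueness.

(** * Tail integrals and Tonelli *)

Section trace_tonelli.
Context {R : realType}.
Local Notation leb := (@lebesgue_measure R).

Lemma measurable_lt_nat dT (T : measurableType dT) (f g : T -> R) :
  measurable_fun setT f -> measurable_fun setT g ->
  measurable_fun setT (fun z => (f z < g z)%R%:R : R).
Proof.
move=> mf mg; rewrite (_ : (fun _ => _) = \1_[set z | f z < g z]); last first.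
  by apply/funext => z; rewrite indicE; congr ((nat_of_bool _)%:R); apply/idP/idP; rewrite inE.
apply: measurable_indic; have := measurable_fun_ltr mf mg measurableT (Y := [set true]) I.
by rewrite setTI; congr measurable; apply/seteqP; split => z /=.
Qed.

(** The weight that a point b receives when the tails starting at t are integrated over t > a. *)
Lemma integral_lt_lt (a b : R) :
  (\int[leb]_t ((a < t)%R%:R * (t < b)%R%:R)%:E = (pos_part (b - a))%:E)%E.
Proof.
transitivity (\int[leb]_t (\1_(`]a, b[%classic) t)%:E)%E.
  apply: eq_integral => t _; rewrite indicE mem_setE in_itv/= -natrM mulnb.
  by [].
rewrite integral_indic// setIT; apply: etrans (lebesgue_measure_itv `]a, b[) _; rewrite /= lte_fin /pos_part.
case: ltP => ab; first by rewrite max_l// subr_ge0 ltW.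
by rewrite max_r// subr_le0.
Qed.

Section orthants.
Context {d : nat}.
Local Notation V := 'rV[R]_d.
Local Notation mu := (lebesgue_rV d).

(** The points x between c and y form a box, and its volume is the kernel with every coordinate in
    [A]. *)
Lemma integral_orthant_between (c y : V) :
  (\int[mu]_x (\1_(orthant c) x * \1_(orthant x) y)%:E =
   (orthant_kernel (enum 'I_d) c y)%:E)%E.
Proof.
transitivity (\int[mu]_x (\1_(rect (fun i => `]c 0 i, y 0 i[%classic)) x)%:E)%E.
  apply: eq_integral => x _; rewrite !indicE -natrM mulnb; congr (_%:R)%:E.
  congr nat_of_bool; apply/idP/idP; last first.
    rewrite inE => H; apply/andP.
    by split; rewrite inE => i; have := H i; rewrite /= in_itv/= => /andP[].
  move=> /andP[]; rewrite !inE => cx xy i; rewrite /= in_itv/=.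
  by apply/andP; split; [exact: cx|exact: xy].
rewrite integral_indic//; last exact: measurable_rect.
rewrite setIT [LHS]lebesgue_rV_box// /orthant_kernel -prodEFin; apply: eq_bigr => k _.
rewrite mem_enum/= lebesgue_measure_itv/= lte_fin /pos_part.
case: ltP => ab; first by rewrite max_l// subr_ge0 ltW.
by rewrite max_r// subr_le0.
Qed.

Definition orthant_integral (p : V -> R) (x : V) : \bar R :=
  (\int[mu]_(y in orthant x) (p y)%:E)%E.

Lemma orthant_integralE p x :
  orthant_integral p x = (\int[mu]_y (p y * \1_(orthant x) y)%:E)%E.
Proof.
rewrite /orthant_integral integral_mkcond; apply: eq_integral => y _.
by rewrite patchE indicE; case: ifP; rewrite ?mulr1 ?mulr0.
Qed.

Let measurable_orthant2 :
  measurable_fun setT (fun z : V * V => \1_(orthant z.1) z.2 : R).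
Proof.
under eq_fun do rewrite orthant_indicE.
apply: measurable_prod => k _; apply: measurable_lt_nat.
  by apply: (measurableT_comp (measurable_coord k)); exact: measurable_fst.
by apply: (measurableT_comp (measurable_coord k)); exact: measurable_snd.
Qed.

Variable p : V -> R.
Hypotheses (mp : measurable_fun setT p) (p0 : forall y, 0 <= p y).

Let mp2 : measurable_fun setT (fun z : V * V => p z.2 * \1_(orthant z.1) z.2 : R).
Proof. by apply: measurable_funM => //; apply: measurableT_comp mp _; exact: measurable_snd. Qed.

Lemma measurable_orthant_integral : measurable_fun setT (orthant_integral p).
Proof.
rewrite (funext (orthant_integralE p)).
apply: (@measurable_fun_fubini_tonelli_F _ _ _ _ _ mu
  (fun z : V * V => (p z.2 * \1_(orthant z.1) z.2)%:E)).
  exact/measurable_EFinP.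
by move=> z; rewrite lee_fin mulr_ge0.
Qed.

Lemma orthant_integral_ge0 x : (0 <= orthant_integral p x)%E.
Proof. by apply: integral_ge0 => y _; rewrite lee_fin. Qed.

(** After the exchange of integrals the inner one measures the set of x between c and y. *)
Lemma integral_orthant_integral c :
  (\int[mu]_(x in orthant c) orthant_integral p x =
   \int[mu]_y (p y * orthant_kernel (enum 'I_d) c y)%:E)%E.
Proof.
have mI : measurable_fun setT (\1_(orthant c) : V -> R).
  by apply: measurable_indic; exact: measurable_orthant.
pose F (z : V * V) := (\1_(orthant c) z.1 * (p z.2 * \1_(orthant z.1) z.2))%:E.
have mF : measurable_fun setT F.
  apply/measurable_EFinP; apply: measurable_funM => //.
  by apply: measurableT_comp mI _; exact: measurable_fst.
transitivity (\int[mu]_x \int[mu]_y F (x, y))%E.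
  rewrite integral_mkcond; apply: eq_integral => x _; rewrite patchE.
  rewrite orthant_integralE /F/= [X in _ = X](_ : _ =
    (\1_(orthant c) x)%:E * \int[mu]_y (p y * \1_(orthant x) y)%:E)%E; last first.
    rewrite -ge0_integralZl_EFin//; first by move=> y _; rewrite lee_fin mulr_ge0.
    apply/measurable_EFinP; apply: measurable_funM => //.
    by apply: measurable_indic; exact: measurable_orthant.
  by rewrite indicE; case: ifP => _; rewrite ?mul1e ?mul0e.
rewrite fubini_tonelli//; last by move=> z; rewrite lee_fin !mulr_ge0.
apply: eq_integral => y _; rewrite EFinM -integral_orthant_between.
rewrite -ge0_integralZl_EFin//.
- by apply: eq_integral => x _; rewrite /F -EFinM mulrCA.
- apply/measurable_EFinP; apply: measurable_funM => //.
  under eq_fun do rewrite orthant_indicE.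
  by apply: measurable_prod => k _; apply: measurable_lt_nat => //; exact: measurable_coord.
Qed.

End orthants.
End trace_tonelli.

Section slice_tail.
Context {R : realType} {n : nat}.
Local Notation V := 'rV[R]_n.+1.
Local Notation mu := (lebesgue_rV n.+1).
Local Notation leb := (@lebesgue_measure R).
Local Notation insert := (@insert_coord R n.+1).
Variable l : 'I_n.+1.

Lemma col'_insert s x : col' l (insert l s x) = s.
Proof. by apply/rowP => k; rewrite mxE insert_coord_lift. Qed.

Lemma orthant_indic_insert (c : V) s t : \1_(orthant c) (insert l s t) =
  (c 0 l < t)%R%:R * \1_(orthant (col' l c)) s :> R.
Proof.
rewrite !orthant_indicE (bigD1_ord l)//= insert_coord_same; congr (_ * _).
by apply: eq_bigr => k _; rewrite insert_coord_lift mxE.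
Qed.

Lemma orthant_kernel_insert (c : V) s t : orthant_kernel [:: l] c (insert l s t) =
  pos_part (t - c 0 l) * \1_(orthant (col' l c)) s.
Proof.
rewrite orthant_indicE /orthant_kernel (bigD1_ord l)//= inE eqxx insert_coord_same.
congr (_ * _); apply: eq_bigr => k _.
by rewrite inE insert_coord_lift mxE eq_sym (negbTE (neq_lift _ _)).
Qed.

Lemma measurable_insert s : measurable_fun (T := measurableTypeR R) setT (insert l s).
Proof.
apply: measurable_fun_rV => k; have [j ->|->] := unliftP l k.
  under eq_fun do rewrite insert_coord_lift.
  exact: measurable_cst.
under eq_fun do rewrite insert_coord_same.
exact: measurable_id.
Qed.

Definition slice_tail (p : V -> R) (x : V) : \bar R :=
  (\int[leb]_(t in `]x 0%R l, +oo[) (p (insert l (col' l x) t))%:E)%E.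

Lemma slice_tailE p x : slice_tail p x =
  (\int[leb]_t ((x 0%R l < t)%R%:R * p (insert l (col' l x) t))%:E)%E.
Proof.
rewrite /slice_tail integral_mkcond; apply: eq_integral => t _.
rewrite patchE mem_setE in_itv/= andbT; case: ifP => _; first by rewrite mul1r.
by rewrite mul0r.
Qed.

Variable p : V -> R.
Hypotheses (mp : measurable_fun setT p) (p0 : forall y, 0 <= p y).

Lemma measurable_slice_tail : measurable_fun setT (slice_tail p).
Proof.
rewrite (funext (slice_tailE p)).
apply: (@measurable_fun_fubini_tonelli_F _ _ V (measurableTypeR R) _ leb
  (fun z => ((z.1 0%R l < z.2)%R%:R * p (insert l (col' l z.1) z.2))%:E)); last first.
  by move=> z; rewrite lee_fin mulr_ge0.
apply/measurable_EFinP; apply: measurable_funM.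
  apply: measurable_lt_nat; last exact: measurable_snd.
  by apply: (measurableT_comp (measurable_coord l)); exact: measurable_fst.
apply: (measurableT_comp mp); apply: measurable_fun_rV => k.
have [j ->|->] := unliftP l k.
  under eq_fun do rewrite insert_coord_lift mxE.
  by apply: (measurableT_comp (measurable_coord (lift l j))); exact: measurable_fst.
under eq_fun do rewrite insert_coord_same.
exact: measurable_snd.
Qed.

Lemma slice_tail_ge0 x : (0 <= slice_tail p x)%E.
Proof. by apply: integral_ge0 => y _; rewrite lee_fin. Qed.

Let mp_insert s : measurable_fun (T := measurableTypeR R) setT (fun t => p (insert l s t)).
Proof. exact: (measurableT_comp mp (measurable_insert s)). Qed.

(** The exchange of integrals takes place in a plane, between the starting point t of the tail and
    the point u of integration, both along coordinate [l]; the other coordinates [s] are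
    parameters. *)
Lemma integral_slice_tail c :
  (\int[mu]_(x in orthant c) slice_tail p x =
   \int[mu]_y (p y * orthant_kernel [:: l] c y)%:E)%E.
Proof.
have mI : measurable_fun setT (\1_(orthant c) : V -> R).
  by apply: measurable_indic; exact: measurable_orthant.
have mK := measurable_orthant_kernel [:: l] c.
transitivity (\int[mu]_x ((\1_(orthant c) x)%:E * slice_tail p x))%E.
  rewrite integral_mkcond; apply: eq_integral => x _; rewrite patchE indicE.
  by case: ifP => _; rewrite ?mul1e ?mul0e.
rewrite (ge0_integral_insert l); last 2 first.
- by apply: emeasurable_funM; [exact/measurable_EFinP|exact: measurable_slice_tail].
- by move=> x; rewrite mule_ge0// ?lee_fin// slice_tail_ge0.
rewrite [RHS](ge0_integral_insert l); last 2 first.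
- by apply/measurable_EFinP; exact: measurable_funM.
- by move=> x; rewrite lee_fin mulr_ge0// orthant_kernel_ge0.
apply: eq_integral => s _.
pose F (z : measurableTypeR R * measurableTypeR R) :=
  (\1_(orthant c) (insert l s z.1) * ((z.1 < z.2)%R%:R * p (insert l s z.2)))%:E.
transitivity (\int[leb]_t \int[leb]_u F (t, u))%E.
  apply: eq_integral => t _; rewrite slice_tailE col'_insert insert_coord_same /F/=.
  rewrite -ge0_integralZl_EFin//.
  - by move=> u _; rewrite lee_fin mulr_ge0.
  - apply/measurable_EFinP; apply: measurable_funM; last exact: mp_insert.
    exact: measurable_lt_nat.
rewrite (@fubini_tonelli _ _ (measurableTypeR R) (measurableTypeR R) _ leb leb F)//; last 2 first.
- apply/measurable_EFinP; apply: measurable_funM.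
    under eq_fun do rewrite orthant_indic_insert.
    apply: measurable_funM => //; apply: measurable_lt_nat => //.
  apply: measurable_funM; first exact: measurable_lt_nat.
  exact: (measurableT_comp (mp_insert s)).
- by move=> z; rewrite lee_fin !mulr_ge0.
apply: eq_integral => u _; rewrite orthant_kernel_insert.
rewrite [X in _ = X%:E](_ : _ = (p (insert l s u) * \1_(orthant (col' l c)) s) *
  pos_part (u - c 0 l)); last by rewrite -mulrA [X in _ * X]mulrC.
rewrite EFinM -integral_lt_lt -ge0_integralZl_EFin//.
- apply: eq_integral => t _; rewrite /F/= orthant_indic_insert -EFinM; congr EFin; ring.
- apply/measurable_EFinP; apply: measurable_funM; exact: measurable_lt_nat.
- by rewrite mulr_ge0.
Qed.

End slice_tail.

(** * Continuity of integrals in the domain of integration *)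

Section continuous_integral_sets.
Context {R : realType} {dT : measure_display} {T : measurableType dT}.
Variables (mu : {measure set T -> \bar R}) (g : T -> R).
Hypothesis ig : mu.-integrable setT (EFin \o g).

Let mg : measurable_fun setT g.
Proof. by apply/measurable_EFinP; exact: measurable_int ig. Qed.

Let igS (S : set T) : measurable S ->
  mu.-integrable setT (EFin \o (fun y => `|g y| * \1_S y)).
Proof.
move=> mS; apply: (le_integrable measurableT (g := EFin \o g)) => //.
- apply/measurable_EFinP; apply: measurable_funM; last exact: measurable_indic.
  exact: measurableT_comp.
- move=> y _; rewrite /= lee_fin normrM normr_id indicE.
  by case: (y \in S); rewrite ?normr1 ?normr0 ?mulr1 ?mulr0.
Qed.

Let cvg_small (S : nat -> set T) : (forall n, measurable (S n)) ->
  {ae mu, forall y, \forall n \near \oo, ~ S n y} ->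
  \int[mu]_y (`|g y| * \1_(S n) y) @[n --> \oo] --> (0 : R).
Proof.
move=> mS Soo.
have H1 : {ae mu, forall y, setT y -> (`|g y| * \1_(S n) y)%:E @[n --> \oo] --> (0%:E : \bar R)}.
  apply: filterS Soo => y Sy _; apply: cvg_EFin; first exact: nearW.
  rewrite -[0](mulr0 `|g y|); apply: cvgMr; apply: cvg_near_cst.
  by apply: filterS Sy => n Sny; rewrite indicE memNset.
have H2 : {ae mu, forall y (n : nat), setT y ->
    (`|(`|g y| * \1_(S n) y)%:E| <= `|(g y)%:E|)%E}.
  apply: aeW => y n _; rewrite /= lee_fin normrM normr_id indicE.
  by case: (y \in S n); rewrite ?normr1 ?normr0 ?mulr1 ?mulr0.
have [_ _ H3] := @dominated_convergence _ _ _ mu setT measurableT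
  (fun n y => (`|g y| * \1_(S n) y)%:E) (cst 0%E) (fun y => `|(g y)%:E|%E)
  (fun n => measurable_int _ (igS (mS n))) (@measurable_cst _ _ _ _ _ _) H1
  (integrable_abse ig) H2.
rewrite integral0 in H3.
exact: (fine_cvg (a := 0) H3).
Qed.

(** For x near x0 the two domains differ only inside [S n], so the integrals differ by at most the
    integral of |g| over [S n]. This tends to 0 because almost every point eventually leaves
    [S n]. *)
Lemma cvg_Rintegral_sets (X : topologicalType) (E : X -> set T) (x0 : X)
    (S : nat -> set T) :
  (forall x, measurable (E x)) -> (forall n, measurable (S n)) ->
  {ae mu, forall y, \forall n \near \oo, ~ S n y} ->
  (forall n, \forall x \near x0, forall y, ~ S n y -> (E x y <-> E x0 y)) ->
  \int[mu]_(y in E x) g y @[x --> x0] --> \int[mu]_(y in E x0) g y.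
Proof.
move=> mE mS Soo ES; apply/cvgrPdist_lt => e e0.
have /cvgrPdist_lt /(_ e e0) := cvg_small mS Soo.
move=> [n _ /(_ n (leqnn n)) /=]; rewrite sub0r normrN => Hn.
apply: filterS (ES n) => x Ex; apply: le_lt_trans Hn.
have iE (A : set T) : measurable A -> mu.-integrable setT (EFin \o (g \_ A)).
  move=> mA; rewrite (_ : _ \o _ = (EFin \o g) \_ A); last first.
    by apply/funext => y; rewrite /= !patchE; case: ifP.
  by apply: (iffLR (integrable_mkcond _ mA)); exact: integrableS ig.
have iD : mu.-integrable setT (EFin \o (fun y => (g \_ (E x0)) y - (g \_ (E x)) y)).
  rewrite (_ : _ \o _ = (EFin \o (g \_ (E x0))) \- (EFin \o (g \_ (E x))))%E//.
  by apply: integrableB => //; exact: iE.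
rewrite !(Rintegral_mkcond _ (E _)) -RintegralB ?iE//.
apply: le_trans (le_normr_Rintegral measurableT iD) _.
apply: le_trans (ler_norm _); apply: le_Rintegral => //.
- exact: (integrable_abse iD).
- exact: igS.
- move=> y _; rewrite !patchE indicE; have [Sy|Sy] := pselect (S n y).
    rewrite (mem_set Sy) mulr1; case: ifP; case: ifP => _ _.
    + by rewrite subrr normr0.
    + by rewrite subr0.
    + by rewrite sub0r normrN.
    + by rewrite subrr normr0.
  rewrite (memNset Sy) mulr0 (_ : (y \in E x) = (y \in E x0)) ?subrr ?normr0//.
  by apply/idP/idP; rewrite !inE; have [? ?] := Ex y Sy.
Qed.

End continuous_integral_sets.

Section continuity_of_traces.
Context {R : realType}.
Local Notation leb := (@lebesgue_measure R : {measure set (measurableTypeR R) -> \bar R}).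

(** It promotes almost everywhere equality to equality everywhere, since sets of full measure are
    dense. Continuity is asked on [U] only, because a representative is continuous only inside the
    cube. *)
Lemma eq_on_open_of_dense (T : topologicalType) (U A : set T) (f g : T -> R) :
  dense A -> open U -> (forall x, U x -> A x -> f x = g x) ->
  (forall x, U x -> {for x, continuous f}) ->
  (forall x, U x -> {for x, continuous g}) ->
  forall x, U x -> f x = g x.
Proof.
move=> dA oU fg cf cg x Ux; apply/eqP; apply: contrapT => /negP fgx.
have c : {for x, continuous (fun y => f y - g y)} by apply: cvgB; [exact: cf|exact: cg].
have : \forall y \near x, U y /\ f y - g y != 0.
  apply: filterI; first exact: open_nbhs_nbhs.
  have : nbhs (f x - g x) [set z : R | z != 0].
    apply: open_nbhs_nbhs; split; first exact: open_neq.
    by rewrite /= subr_eq0.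
  exact: c.
rewrite /prop_near1 nbhsE => -[W [oW Wx] WU].
have [y [Wy Ay]] := dA W (ex_intro _ x Wx) oW.
by have [Uy] := WU y Wy; rewrite fg// subrr eqxx.
Qed.

Lemma near_natSinv_lt_norm (a b : R) : a != b -> \forall n \near \oo, n.+1%:R^-1 < `|a - b|.
Proof.
by rewrite -subr_eq0 -normr_gt0 => ab; exact: (near_infty_natSinv_lt (PosNum ab)).
Qed.

Lemma ae_dense_R (Q : set R) : {ae leb, forall t, Q t} -> dense Q.
Proof.
move=> [N [mN N0 QN]] O [x Ox] oO; apply: contrapT => OQ.
have /nbhs_ballP[e /= e0 eO] : nbhs x O by exact: open_nbhs_nbhs.
have eN : ball x e `<=` N.
  move=> y xy; apply: QN => Qy; apply: OQ; exists y; split => //; exact: eO.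
have : (leb (ball x e) <= leb N)%E.
  by apply: le_measure; rewrite ?inE//; exact: measurable_ball.
have -> : leb (ball x e) = (e *+ 2)%:E := lebesgue_measure_ball x (ltW e0).
by rewrite N0 lee_fin leNgt pmulrn_lgt0// e0.
Qed.

(** Moving the end point by less than 1/(n+1) changes the half-line only inside an interval around
    [t0], and these intervals shrink to a null set. *)
Lemma continuous_tail_integral (g : R -> R) : leb.-integrable setT (EFin \o g) ->
  continuous (fun t => \int[leb]_(u in `]t, +oo[) g u).
Proof.
move=> ig t0.
have keyl (a b c e : R) : 0 < e -> a - e < b -> b < a + e -> c < b - e -> (a < c <-> b < c).
  by split; lra.
have keyr (a b c e : R) : 0 < e -> a - e < b -> b < a + e -> b + e < c -> (a < c <-> b < c).
  by split; lra.
apply: (@cvg_Rintegral_sets _ _ _ leb g ig R (fun t => `]t, +oo[%classic) t0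
  (fun n => `[t0 - n.+1%:R^-1, t0 + n.+1%:R^-1]%classic)) => //.
- have H : {ae leb, forall u, u != t0}.
    exists [set t0]; split => //; first exact: lebesgue_measure_set1.
    by move=> u /= /negP; rewrite negbK => /eqP.
  apply: (@filterS _ _ (ae_filter_ringOfSetsType leb) _ _ _ H) => u ut; have := near_natSinv_lt_norm ut.
  apply: filterS => n; rewrite ltNge => /negP h; apply: contra_not h; rewrite /= in_itv/= => /andP[h1 h2].
  by rewrite ler_distl h1 h2.
- move=> n; have : 0 < n.+1%:R^-1 :> R by rewrite invr_gt0.
  move: (n.+1%:R^-1) => e e0; apply: filterS (nbhsx_ballx t0 _ e0) => t; rewrite /ball/= ltr_distl => /andP[h1 h2] u.
  rewrite /= !in_itv/= !andbT => /negP; rewrite negb_and -!ltNge => /orP[h|h].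
    exact: keyl e0 h1 h2 h.
  exact: keyr e0 h1 h2 h.
Qed.

Section vector_space.
Context {d : nat}.
Local Notation V := 'rV[R]_d.
Local Notation mu := (lebesgue_rV d).

Lemma ae_dense_rV (Q : set V) : {ae mu, forall x, Q x} -> dense Q.
Proof.
move=> [N [mN N0 QN]] O [x Ox] oO; apply: contrapT => OQ.
have /nbhs_ballP[e /= e0 eO] : nbhs x O by exact: open_nbhs_nbhs.
have eN : ball x e `<=` N.
  move=> y xy; apply: QN => Qy; apply: OQ; exists y; split => //; exact: eO.
have mB : measurable (ball x e).
  by rewrite ball_rectE//; apply: measurable_rect => i; exact: measurable_ball.
have : (mu (ball x e) <= mu N)%E by apply: le_measure; rewrite ?inE.
rewrite N0 ball_rectE// [X in (X <= _)%E]lebesgue_rV_box; last first.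
  by move=> i; exact: measurable_ball.
under eq_bigr do rewrite lebesgue_measure_ball ?ltW//.
rewrite prodEFin lee_fin leNgt prodr_gt0// => i _.
by rewrite pmulrn_lgt0.
Qed.

Lemma ae_coord_neq (x0 : V) : {ae mu, forall y : V, forall k, y 0 k != x0 0 k}.
Proof.
apply: (@filter_forall V _ (fun k y => y 0 k != x0 0 k) _ (ae_filter_ringOfSetsType mu)) => k.
exists (rect (fun j => if j == k then [set x0 0 k] else setT)); split.
- by apply: measurable_rect => j; case: eqP.
- rewrite [LHS]lebesgue_rV_box; last by move=> j; case: eqP.
  by rewrite (bigD1 k)//= eqxx lebesgue_measure_set1 mul0e.
- move=> y /= /negP; rewrite negbK => /eqP yk j.
  by case: eqP => [->|].
Qed.

Lemma continuous_orthant_integral (g : V -> R) : mu.-integrable setT (EFin \o g) ->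
  continuous (fun x => \int[mu]_(y in orthant x) g y).
Proof.
move=> ig x0.
(* The union of the slabs of half-width 1/(n+1) around the hyperplanes y_k = x0_k, written as the
   complement of a box. Orthants with nearby corners differ only there, and the slabs shrink to a
   null set. *)
pose S n := ~` rect (fun k => ~` `[x0 0 k - n.+1%:R^-1, x0 0 k + n.+1%:R^-1]%classic).
apply: (@cvg_Rintegral_sets _ _ _ mu g ig V orthant x0 S).
- exact: measurable_orthant.
- by move=> n; apply: measurableC; apply: measurable_rect => k; exact: measurableC.
- apply: filterS (ae_coord_neq x0) => y Hy.
  have : \forall n \near \oo, forall k, n.+1%:R^-1 < `|y 0 k - x0 0 k|.
    by apply: filter_forall => k; exact: near_natSinv_lt_norm.
  apply: filterS => n Hn; apply => k; rewrite /= in_itv/= => /andP[h1 h2].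
  by have := Hn k; rewrite ltNge ler_distl h1 h2.
- move=> n; have : 0 < n.+1%:R^-1 :> R by rewrite invr_gt0.
  rewrite /S; move: (n.+1%:R^-1) => e e0; apply: filterS (nbhsx_ballx x0 _ e0) => x.
  rewrite ball_rectE// => xe y /contrapT yS.
  have key (a b c : R) : `|a - b| < e -> ~ (b - e <= c <= b + e) -> (a < c <-> b < c).
    rewrite ltr_distl => /andP[h1 h2] /negP; rewrite negb_and -!ltNge => /orP[h|h].
      by split; lra.
    by split; lra.
  split => H k.
    apply: (iffLR (key (x 0 k) (x0 0 k) (y 0 k) _ _)) (H k); last first.
      by have := yS k; rewrite /= in_itv/=.
    by have := xe k; rewrite /ball/= distrC.
  apply: (iffRL (key (x 0 k) (x0 0 k) (y 0 k) _ _)) (H k); last first.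
    by have := yS k; rewrite /= in_itv/=.
  by have := xe k; rewrite /ball/= distrC.
Qed.

End vector_space.

End continuity_of_traces.

Section slices.
Context {R : realType} {n : nat}.
Local Notation leb := (@lebesgue_measure R : {measure set (measurableTypeR R) -> \bar R}).
Local Notation insert := (@insert_coord R n.+1).
Variable l : 'I_n.+1.

(** By Tonelli the measures of the slices of a null set integrate to 0, so almost every slice is
    null. *)
Lemma ae_slice (Q : set 'rV[R]_n.+1) : {ae lebesgue_rV n.+1, forall x, Q x} ->
  {ae lebesgue_rV n, forall s, {ae leb, forall t, Q (insert l s t)}}.
Proof.
move=> [N [mN N0 QN]].
have mI : measurable_fun setT (\1_N : 'rV[R]_n.+1 -> R) by exact: measurable_indic.
pose G s := (\int[leb]_t (\1_N (insert l s t))%:E)%E.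
have mG : measurable_fun setT G.
  apply: (@measurable_fun_fubini_tonelli_G _ _ (measurableTypeR R) _ _ leb
    (fun p => (\1_N (insert_pair l p))%:E)); last by move=> p; rewrite lee_fin.
  by apply/measurable_EFinP; apply: (measurableT_comp mI); exact: measurable_insert_pair.
have G0 s : (0 <= G s)%E by apply: integral_ge0 => t _; rewrite lee_fin.
have : (\int[lebesgue_rV n]_s `|G s| = 0)%E.
  rewrite -[RHS]N0 -[N in RHS]setIT -integral_indic// (ge0_integral_insert l)//.
  - by apply: eq_integral => s _; rewrite gee0_abs.
  - exact/measurable_EFinP.
move/(iffLR (ae_eq_integral_abs _ measurableT mG)); apply: filterS => s /(_ I).
have mNs : measurable (insert l s @^-1` N : set (measurableTypeR R)).
  by rewrite -[X in measurable X]setTI; exact: measurable_insert.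
rewrite /G (@integral_indic _ (measurableTypeR R) _ leb setT measurableT (insert l s @^-1` N))//.
rewrite setIT => Ns0; exists (insert l s @^-1` N); split => //.
by move=> t /= Qt; exact: QN.
Qed.

End slices.

Section boundary_limits.
Context {R : realType}.
(** [k] is continuous on the whole line and vanishes on t < 0, so its value at 0 is its limit from
    the left; [u] coincides with it between 0 and 1 and inherits the limits at both ends. *)
Lemma boundary_limits (k u : R -> R) : continuous k ->
  (forall t, t < 0 -> k t = 0) -> (forall t, 1 <= t -> k t = 0) ->
  (forall t, 0 < t < 1 -> u t = k t) ->
  [/\ u x @[x --> 0^'+] --> 0, u x @[x --> 1^'-] --> 0 &
      {within `[0, 1], continuous (u \_ `]0, 1[)}].
Proof.
move=> ck kneg k1 uk.
have k0 : k 0 = 0.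
  have c1 : k x @[x --> 0^'-] --> k 0 by apply: cvg_at_left_filter; exact: ck.
  have c2 : k x @[x --> 0^'-] --> 0.
    apply: cvg_near_cst; near=> t; apply: kneg; near: t; exact: nbhs_left_lt.
  exact: (cvg_unique (@norm_hausdorff _ _) c1 c2).
have cu x (F : set_system R) : Filter F -> k t @[t --> F] --> k x ->
    (\forall t \near F, 0 < t < 1) -> k x = 0 -> u t @[t --> F] --> 0.
  move=> FF kF F01 <-; apply: cvg_trans kF; apply: near_eq_cvg.
  by apply: filterS F01 => t /uk ->.
split.
- apply: (cu 0 _ _ _ _ k0); first by apply: cvg_at_right_filter; exact: ck.
  near=> t; apply/andP; split; near: t; first exact: nbhs_right_gt.
  exact: nbhs_right_lt.
- apply: (cu 1 _ _ _ _ (k1 _ (lexx 1))); first by apply: cvg_at_left_filter; exact: ck.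
  near=> t; apply/andP; split; near: t; last exact: nbhs_left_lt.
  exact: nbhs_left_gt.
- apply: (subspace_eq_continuous (f := k)); last exact: continuous_subspaceT.
  move=> t; rewrite inE/= in_itv/= => /andP[t0 t1].
  change (k t = (u \_ `]0, 1[) t); rewrite patchE.
  case: ifPn; first by rewrite inE/= in_itv/= => /uk.
  rewrite notin_setE/= in_itv/= => /negP; rewrite negb_and -!leNgt => /orP[h|h].
    by rewrite (_ : t = 0) ?k0//; apply/eqP; rewrite eq_le h t0.
  by rewrite k1.
Unshelve. all: by end_near. Qed.
End boundary_limits.

Section Rintegral_funrposneg.
Context {R : realType} {dT : measure_display} {T : measurableType dT}.

Lemma Rintegral_funrposneg (mu : {measure set T -> \bar R}) (D : set T) (g : T -> R) :
  measurable D -> mu.-integrable D (EFin \o g) ->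
  \int[mu]_(x in D) g x =
  fine (\int[mu]_(x in D) (g^\+ x)%:E) - fine (\int[mu]_(x in D) (g^\- x)%:E).
Proof.
move=> mD ig; rewrite -[fine (\int[mu]_(x in D) (g^\+ x)%:E)]/(\int[mu]_(x in D) g^\+ x).
rewrite -[fine (\int[mu]_(x in D) (g^\- x)%:E)]/(\int[mu]_(x in D) g^\- x).
rewrite -RintegralB//; [|exact: integrable_funrpos|exact: integrable_funrneg].
by apply: eq_Rintegral => x _; rewrite -[in LHS](funrposBneg g).
Qed.

End Rintegral_funrposneg.

Section traces.
Context {R : realType} {d alpha : nat}.
Local Notation V := 'rV[R]_d.
Local Notation mu := (lebesgue_rV d).
Local Notation cube := (@open_cube R d).
Variable f : V -> R.
Hypothesis Hf : gauss_sobolev alpha f.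

(** A version of the derivative of D^r g along each coordinate of [A], extended by 0 outside of the
    cube. *)
Let tail (r : 'I_d -> nat) (A : seq 'I_d) : V -> R :=
  terms_pull (wderivs f) (dterms_word A (dterms_word (multi_word r) [:: term0])).

Let integrable_tail r A : (forall i, r i + count_mem i A <= alpha)%N ->
  mu.-integrable setT (EFin \o tail r A).
Proof.
move=> rA; apply: (integrable_terms_pull (gauss_L2_wderivs Hf)).
exact: order_le_trans (order_le_dterms_word A (order_le_cot_wderiv r)).
Qed.

Lemma ae_eq_cot_wderiv_trace r A (P1 P2 : V -> \bar R) : uniq A ->
  (forall i, r i + count_mem i A <= alpha)%N ->
  measurable_fun setT P1 -> measurable_fun setT P2 ->
  (forall x, 0 <= P1 x)%E -> (forall x, 0 <= P2 x)%E ->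
  (forall c, \int[mu]_(x in orthant c) P1 x =
     \int[mu]_y ((tail r A)^\+ y * orthant_kernel A c y)%:E)%E ->
  (forall c, \int[mu]_(x in orthant c) P2 x =
     \int[mu]_y ((tail r A)^\- y * orthant_kernel A c y)%:E)%E ->
  {ae mu, forall x, cot_wderiv f r x =
     (-1) ^+ size A * (fine (P1 x) - fine (P2 x))}.
Proof.
move=> uA rA mP1 mP2 P10 P20 HP1 HP2.
have ra i : (r i <= alpha)%N by rewrite (leq_trans _ (rA i))// leq_addr.
apply: (ae_eq_trace (integrable_cot_wderiv Hf ra) (integrable_tail rA) _ _
  mP1 mP2 P10 P20 HP1 HP2).
- by move=> y ny; rewrite /tail terms_pull_out.
- apply: integral_orthant_kernel => //.
  + exact: (integrable_cot_wderiv Hf ra).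
  + exact: integrable_tail.
  + by move=> y ny; rewrite /tail terms_pull_out.
  + move=> phi sphi; apply: terms_word_by_parts sphi => //.
    * exact: gauss_L2_wderivs.
    * exact: wderivs_by_parts.
    * exact: order_le_cot_wderiv.
Qed.

Lemma cot_wderiv_trace (r : 'I_d -> nat) : (forall i, r i < alpha)%N ->
  exists H : V -> R, [/\ continuous H,
    (forall (x : V) l, x 0 l < 0 -> H x = 0),
    (forall (x : V) l, 1 <= x 0 l -> H x = 0) &
    {ae mu, forall x, cot_wderiv f r x = H x}].
Proof.
move=> ra; pose A := enum 'I_d.
have rA i : (r i + count_mem i A <= alpha)%N.
  by rewrite count_uniq_mem ?enum_uniq// mem_enum/= addn1.
pose w := tail r A; have iw := integrable_tail rA.
have mw : measurable_fun setT w by apply/measurable_EFinP; exact: measurable_int iw.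
have [mw1 mw2] : measurable_fun setT w^\+ /\ measurable_fun setT w^\-.
  by split; [exact: measurable_funrpos|exact: measurable_funrneg].
pose H x := (-1) ^+ size A * \int[mu]_(y in orthant x) w y.
have cH : continuous H.
  move=> x; exact: (@cvgMr _ _ _ (nbhs_filter x) _ ((-1) ^+ size A : R) _
    (continuous_orthant_integral iw (x := x))).
have vH : {ae mu, forall x, cot_wderiv f r x = H x}.
  have := ae_eq_cot_wderiv_trace (enum_uniq _) rA
    (measurable_orthant_integral mw1 (funrpos_ge0 w))
    (measurable_orthant_integral mw2 (funrneg_ge0 w))
    (orthant_integral_ge0 (funrpos_ge0 w)) (orthant_integral_ge0 (funrneg_ge0 w))
    (integral_orthant_integral mw1 (funrpos_ge0 w))
    (integral_orthant_integral mw2 (funrneg_ge0 w)).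
  apply: filterS => x ->; rewrite /H Rintegral_funrposneg//.
    exact: measurable_orthant.
  by apply: integrableS iw => //; exact: measurable_orthant.
(* For x_l >= 1 the orthant misses the cube. For x_l < 0 it may contain it, so there the vanishing
   comes from almost everywhere equality with a function that is 0, on an open set where [H] is
   continuous. *)
exists H; split => // [x l xl|x l xl].
  have open_neg : open [set y : V | y 0 l < 0].
    have cl : continuous (fun y : V => y 0 l) by move=> y; exact: coord_continuous.
    exact: (open_comp (fun y _ => cl y) (@open_lt R 0)).
  apply: (eq_on_open_of_dense (ae_dense_rV vH) open_neg _ _ _ (g := cst 0)) xl.
  - move=> y /= yl <-; apply: terms_pull_out => /(_ l); rewrite ltNge => /andP[].
    by rewrite ltW.
  - by move=> y _; exact: cH.
  - by move=> y _; exact: cst_continuous.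
rewrite /H (_ : \int[mu]_(y in orthant x) w y = 0) ?mulr0//.
rewrite /Rintegral integral0_eq// => y xy; rewrite /w /tail terms_pull_out//.
move=> /(_ l) /andP[_]; rewrite ltNge (le_trans xl)// ltW//; exact: xy.
Qed.

End traces.

Section slice_traces.
Context {R : realType} {n alpha : nat}.
Local Notation V := 'rV[R]_n.+1.
Local Notation mu := (lebesgue_rV n.+1).
Local Notation leb := (@lebesgue_measure R : {measure set (measurableTypeR R) -> \bar R}).
Local Notation cube := (@open_cube R n.+1).
Local Notation insert := (@insert_coord R n.+1).
Variable f : V -> R.
Hypothesis Hf : gauss_sobolev alpha f.

Lemma cot_wderiv_slice_trace (l : 'I_n.+1) (r : 'I_n.+1 -> nat) :
  (forall i, r i <= alpha)%N -> (r l < alpha)%N ->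
  exists K : V -> R, {ae mu, forall x, cot_wderiv f r x = K x} /\
    {ae lebesgue_rV n, forall s,
      [/\ continuous (fun t => K (insert l s t)),
        (forall t, t < 0 -> K (insert l s t) = 0) &
        (forall t, 1 <= t -> K (insert l s t) = 0)]}.
Proof.
move=> ra rl; pose A := [:: l].
have rA i : (r i + count_mem i A <= alpha)%N.
  by rewrite /= addn0; case: eqP => [<-|_]; rewrite ?addn1// addn0.
pose w := terms_pull (wderivs f) (dterms_word A (dterms_word (multi_word r) [:: term0])).
have iw : mu.-integrable setT (EFin \o w).
  apply: (integrable_terms_pull (gauss_L2_wderivs Hf)).
  exact: order_le_trans (order_le_dterms_word A (order_le_cot_wderiv r)).
have mw : measurable_fun setT w by apply/measurable_EFinP; exact: measurable_int iw.
have [mw1 mw2] : measurable_fun setT w^\+ /\ measurable_fun setT w^\-.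
  by split; [exact: measurable_funrpos|exact: measurable_funrneg].
pose K x := (-1) ^+ size A * (fine (slice_tail l w^\+ x) - fine (slice_tail l w^\- x)).
have vK : {ae mu, forall x, cot_wderiv f r x = K x}.
  have uA : uniq A by [].
  exact: (ae_eq_cot_wderiv_trace Hf uA rA
    (measurable_slice_tail l mw1 (funrpos_ge0 w))
    (measurable_slice_tail l mw2 (funrneg_ge0 w))
    (slice_tail_ge0 l (funrpos_ge0 w)) (slice_tail_ge0 l (funrneg_ge0 w))
    (integral_slice_tail l mw1 (funrpos_ge0 w))
    (integral_slice_tail l mw2 (funrneg_ge0 w))).
exists K; split => //.
have iws := ae_integrable2 (integrable_insert l iw).
have vKs := ae_slice l vK.
(* The lines kept are those along which [w] is integrable and the equality of D^r g and [K] holds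
   almost everywhere. *)
apply: filterS2 iws vKs => s iws vKs.
have KE t : K (insert l s t) = - \int[leb]_(u in `]t, +oo[) w (insert l s u).
  rewrite /K /= expr1 mulN1r; congr (- _).
  rewrite [RHS]Rintegral_funrposneg//; last exact: integrableS iws.
  by rewrite /slice_tail col'_insert insert_coord_same.
have cK : continuous (fun t => K (insert l s t)).
  rewrite (funext KE) => t; apply: cvgN; exact: (continuous_tail_integral iws).
split => // [t t0|t t1].
- have dQ : dense [set u | cot_wderiv f r (insert l s u) = K (insert l s u)].
    exact: ae_dense_R vKs.
  apply: (@eq_on_open_of_dense R R [set u | u < 0] _ (fun u => K (insert l s u)) (cst 0)
    dQ (@open_lt R 0) _ _ _ t t0).
  + move=> y /= y0 <-; apply: terms_pull_out => /(_ l).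
    by rewrite insert_coord_same ltNge ltW.
  + by move=> y _; exact: cK.
  + by move=> y _; exact: cst_continuous.
- rewrite KE /Rintegral integral0_eq ?oppr0// => u; rewrite /= in_itv/= andbT => tu.
  rewrite /w terms_pull_out// => /(_ l); rewrite insert_coord_same => /andP[_].
  by rewrite ltNge (le_trans t1)// ltW.
Qed.

End slice_traces.

(** * Boundary values of arbitrary representatives *)

Section boundary_values.
Context {R : realType}.

Lemma insert_cube n (l : 'I_n.+1) (s : 'rV[R]_n) t :
  open_cube n s -> 0 < t < 1 -> open_cube n.+1 (insert_coord l s t).
Proof.
move=> cs t01 i; have [k ->|->] := unliftP l i; first by rewrite insert_coord_lift.
by rewrite insert_coord_same.
Qed.

Lemma continuous_insert n (l : 'I_n.+1) (s : 'rV[R]_n) :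
  continuous (insert_coord (d := n.+1) l s).
Proof.
have -> : insert_coord (d := n.+1) l s =
    (fun t => insert_coord (d := n.+1) l s 0 + t *: (delta_mx 0 l : 'rV_n.+1)).
  apply/funext => t; apply/rowP => i; rewrite [RHS]mxE [X in _ + X]mxE [X in _ + _ * X]mxE eqxx/=.
  have [k ->|->] := unliftP l i.
    by rewrite !insert_coord_lift eq_sym (negbTE (neq_lift _ _)) mulr0 addr0.
  by rewrite !insert_coord_same eqxx mulr1 add0r.
move=> t; apply: cvgD; first exact: cvg_cst.
by apply: cvgZr_tmp.
Qed.

Lemma L2norm_cot_wderiv_unif alpha d : exists C : R, 0 < C /\
  forall f : 'rV[R]_d -> R, gauss_sobolev alpha f ->
  forall r : 'I_d -> nat, (forall i, (r i <= alpha)%N) ->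
    weakly_derivable (open_cube d) r (cot_transform f) /\
    (L2norm (closed_cube d) (cst 1%R)
        (wderiv (open_cube d) r (cot_transform f))
      <= C%:E * gauss_sobolev_norm alpha f)%E.
Proof.
have /choice[C HC] : forall r : {ffun 'I_d -> 'I_alpha.+1}, exists C : R, 0 <= C /\
    forall f : 'rV[R]_d -> R, gauss_sobolev alpha f ->
    (L2norm (closed_cube d) (cst 1%R) (wderiv (open_cube d) (fun i => r i) (cot_transform f))
      <= C%:E * gauss_sobolev_norm alpha f)%E.
  move=> r; have [|C C0 HC] := @L2norm_cot_wderiv R d alpha (fun i => r i).
    by move=> i; rewrite -ltnS.
  by exists C.
(* The multi-indices with entries at most alpha are finite in number, so their constants can be
   summed; the 1 makes the result positive. *)
exists (1 + \sum_r C r); split.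
  by rewrite ltr_pwDl// sumr_ge0// => r _; have [] := HC r.
move=> f Hf r ra; split.
  by exists (cot_wderiv f r); exact: is_wderiv_cot_transform Hf _ ra.
pose q : {ffun 'I_d -> 'I_alpha.+1} := [ffun i => inord (r i)].
have -> : r = (fun i => q i : nat) by apply/funext => i; rewrite ffunE inordK// ltnS.
have [_ /(_ f Hf)] := HC q; move=> /le_trans; apply.
rewrite lee_wpmul2r ?poweR_ge0// lee_fin (bigD1 q)//= addrCA lerDl.
by rewrite addr_ge0// sumr_ge0// => p _; have [] := HC p.
Qed.

Lemma continuous_repr_limits n alpha (f : 'rV[R]_n.+1 -> R) (r : 'I_n.+1 -> nat) :
  gauss_sobolev alpha f -> (forall i, r i < alpha)%N ->
  let Drg := wderiv (open_cube n.+1) r (cot_transform f) in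
  (exists h, continuous_repr Drg h) /\
  forall h, continuous_repr Drg h ->
    forall (l : 'I_n.+1) (s : 'rV[R]_n), open_cube n s ->
      let u : R -> R := fun x => h (insert_coord l s x) in
      u x @[x --> 0^'+] --> 0 /\ u x @[x --> 1^'-] --> 0.
Proof.
move=> Hf ra Drg; have [H [cH Hneg H1 vH]] := cot_wderiv_trace Hf ra.
have DH : {ae lebesgue_rV n.+1, forall x, open_cube n.+1 x -> H x = Drg x}.
  apply: filterS2 vH (ae_eq_cot_wderiv Hf (fun i => ltnW (ra i))) => x vH Dv cx.
  by rewrite /Drg Dv// vH.
split; first by exists H; split => // x _; exact: cH.
move=> h [hD ch] l s cs u.
have hH : {ae lebesgue_rV n.+1, forall x, open_cube n.+1 x -> h x = H x}.
  by apply: filterS2 hD DH => x hD DH cx; rewrite hD// DH.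
(* Two functions that are continuous on the open cube and agree almost everywhere agree at each of
   its points, so no exceptional lines remain. *)
have hHE x : open_cube n.+1 x -> h x = H x.
  apply: (eq_on_open_of_dense (ae_dense_rV hH) open_open_cube _ _ _ (f := h) (g := H)).
  - by move=> y cy; apply.
  - by move=> y cy; apply: ch; rewrite inE.
  - by move=> y _; exact: cH.
have cHs : continuous (fun t => H (insert_coord l s t)).
  by move=> t; apply: continuous_comp; [exact: continuous_insert|exact: cH].
have Hs0 t : t < 0 -> H (insert_coord l s t) = 0.
  by move=> t0; apply: (Hneg _ l); rewrite insert_coord_same.
have Hs1 t : 1 <= t -> H (insert_coord l s t) = 0.
  by move=> t1; apply: (H1 _ l); rewrite insert_coord_same.
have uE t : 0 < t < 1 -> u t = H (insert_coord l s t).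
  by move=> t01; apply: hHE; exact: insert_cube.
by have [] := boundary_limits cHs Hs0 Hs1 uE.
Qed.

Lemma line_continuous_repr_limits n alpha (f : 'rV[R]_n.+1 -> R)
    (l : 'I_n.+1) (r : 'I_n.+1 -> nat) :
  gauss_sobolev alpha f -> (forall i, r i <= alpha)%N -> (r l < alpha)%N ->
  let Drg := wderiv (open_cube n.+1) r (cot_transform f) in
  (exists h, line_continuous_repr l Drg h) /\
  forall h, line_continuous_repr l Drg h ->
    \forall s \ae lebesgue_rV n, open_cube n s ->
      let u : R -> R := fun x => h (insert_coord l s x) in
      [/\ u x @[x --> 0^'+] --> 0, u x @[x --> 1^'-] --> 0 &
          {within `[0, 1], continuous (u \_ `]0, 1[)}].
Proof.
move=> Hf ra rl Drg; have [K [vK Ks]] := cot_wderiv_slice_trace Hf ra rl.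
have DK : {ae lebesgue_rV n.+1, forall x, open_cube n.+1 x -> K x = Drg x}.
  apply: filterS2 vK (ae_eq_cot_wderiv Hf ra) => x vK Dv cx.
  by rewrite /Drg Dv// vK.
split.
  exists K; split => //; apply: filterS Ks => s [cK _ _] _ t _; exact: cK.
move=> h [hD ch].
have hK : {ae lebesgue_rV n.+1, forall x, open_cube n.+1 x -> h x = K x}.
  by apply: filterS2 hD DK => x hD DK cx; rewrite hD// DK.
(* Three null sets of lines are discarded: where [K] fails to be continuous or to vanish beyond the
   ends, where [h] fails to be continuous, and where [h] and [K] fail to agree almost everywhere on
   the line. *)
apply: filterS3 Ks ch (ae_slice l hK) => s [cK Kneg K1] ch hKs cs.
pose u t := h (insert_coord l s t).
apply: (@boundary_limits R (fun t => K (insert_coord l s t)) u cK Kneg K1) => t t01.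
have dQ : dense [set t | open_cube n.+1 (insert_coord l s t) ->
    h (insert_coord l s t) = K (insert_coord l s t)].
  exact: ae_dense_R hKs.
have oI : open (`]0, 1[%classic : set R) by exact: interval_open.
have := @eq_on_open_of_dense R R `]0, 1[%classic _ u (fun t => K (insert_coord l s t)) dQ oI.
apply.
- by move=> y; rewrite /= in_itv/= => y01; apply; exact: insert_cube.
- by move=> y y01; exact: (ch cs y).
- by move=> y _; exact: cK.
- by rewrite /= in_itv.
Qed.

End boundary_values.

Theorem proposition4p9 (R : realType) (alpha d : nat)
    (alpha_gt0 : (0 < alpha)%N) (d_gt0 : (0 < d)%N) :
  (* (i) *)
  (exists C : R, 0 < C /\
    forall f : 'rV[R]_d -> R, gauss_sobolev alpha f ->
    forall r : 'I_d -> nat, (forall i, (r i <= alpha)%N) ->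
      weakly_derivable (open_cube d) r (cot_transform f) /\
      (L2norm (closed_cube d) (cst 1%R)
          (wderiv (open_cube d) r (cot_transform f))
        <= C%:E * gauss_sobolev_norm alpha f)%E) /\
  forall f : 'rV[R]_d -> R, gauss_sobolev alpha f ->
    (* (ii) *)
    (forall (l : 'I_d) (r : 'I_d -> nat),
      (forall i, (r i <= alpha)%N) -> (r l <= alpha - 1)%N ->
      let Drg := wderiv (open_cube d) r (cot_transform f) in
      (exists h, line_continuous_repr l Drg h) /\
      forall h, line_continuous_repr l Drg h ->
        \forall s \ae lebesgue_rV d.-1, open_cube d.-1 s ->
          let u : R -> R := fun x => h (insert_coord l s x) in
          [/\ u x @[x --> 0^'+] --> 0,
              u x @[x --> 1^'-] --> 0 &
              {within `[0, 1], continuous (u \_ `]0, 1[)}]) /\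
    (* (iii) *)
    (forall r : 'I_d -> nat, (forall i, (r i <= alpha - 1)%N) ->
      let Drg := wderiv (open_cube d) r (cot_transform f) in
      (exists h, continuous_repr Drg h) /\
      forall h, continuous_repr Drg h ->
        forall (l : 'I_d) (s : 'rV[R]_d.-1), open_cube d.-1 s ->
          let u : R -> R := fun x => h (insert_coord l s x) in
          u x @[x --> 0^'+] --> 0 /\ u x @[x --> 1^'-] --> 0).
Proof.
split; first exact: L2norm_cot_wderiv_unif.
(* Writing d as n.+1 makes [d.-1] reduce to n, the dimension of the remaining coordinates. *)
case: d d_gt0 => // n _ f Hf.
(* Subtraction on [nat] is truncated; as alpha is positive, alpha - 1 is its true predecessor. *)
have ltS m : (m <= alpha - 1)%N = (m < alpha)%N by rewrite subn1 -ltnS prednK.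
split.
  move=> l r ra; rewrite ltS => rl.
  exact: (line_continuous_repr_limits Hf ra rl).
move=> r ra; apply: (continuous_repr_limits Hf) => i.
by rewrite -ltS.
Qed.
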